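(* Let $h,\nu$ be fixed real numbers with $\nu\ge-\tfrac12$, $h>0$ and $h>\nu(\nu+1)$. Put $$\omega:=\sqrt{h-\nu(\nu+1)}>0,\qquad B:=\frac{\Gamma(1+\mathrm{i}\omega)\,\Gamma(\mathrm{i}\omega)}{\Gamma(1+\mathrm{i}\omega+\nu)\,\Gamma(\mathrm{i}\omega-\nu)},$$ and, for $k\in(0,1)$, $k':=\sqrt{1-k^2}$. Let $D(h,\nu,k)$ be the Hill discriminant of Lamé's equation $y''+\bigl(h-\nu(\nu+1)k^2\operatorname{sn}^2(t,k)\bigr)y=0$, regarded as an equation with period $2K(k)$. Then $$D(h,\nu,k)=2\operatorname{Re}\bigl(B\,\mathrm{e}^{2\mathrm{i}\omega\ln(4/k')}\bigr)+O\bigl((1-k)\ln(1-k)\bigr)\qquad\text{as }k\to1 .$$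
   Context: For $k\in(0,1)$, $\operatorname{sn}(t,k)$ is the Jacobian elliptic function of modulus $k$, and $K(k)=\int_0^1\frac{\mathrm{d}t}{\sqrt{1-t^2}\sqrt{1-k^2t^2}}$ is the complete elliptic integral of the first kind. The function $t\mapsto\operatorname{sn}^2(t,k)$ has period $2K(k)$. For a Hill equation $\ddot w+q(t)w=0$ with $q$ continuous of period $\sigma>0$, the Hill discriminant is the trace of the linear endomorphism $w(t)\mapsto w(t+\sigma)$ of the two-dimensional solution space. $D(h,\nu,k)$ is this discriminant for Lamé's equation with $\sigma=2K(k)$. Equivalently, $D(h,\nu,k)=2\bigl(y_1(K)y_2'(K)+y_1'(K)y_2(K)\bigr)=2\bigl(2y_1(K)y_2'(K)-1\bigr)$, where $K=K(k)$ and $y_1,y_2$ are the solutions of Lamé's equation with $y_1(0)=y_2'(0)=1$, $y_1'(0)=y_2(0)=0$. $\Gamma$ is the gamma function; $k\to1$ means $k\to1$ from below, and the $O$-term is for fixed $h,\nu$. *)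

(* Defs.v *)
From Stdlib Require Import Reals Factorial.
From Coquelicot Require Import Coquelicot.

Local Open Scope R_scope.

(* [f = O(g)] along the filter [F]. *)
Definition is_bigO {T : Type} (F : (T -> Prop) -> Prop) (f g : T -> R) : Prop :=
  exists M : R, F (fun x => Rabs (f x) <= M * Rabs (g x)).

Definition Cexp (z : C) : C :=
  (RtoC (exp (Re z)) * (cos (Im z), sin (Im z)))%C.

(* z (z + 1) ... (z + n - 1) *)
Fixpoint rising_factorial (z : C) (n : nat) : C :=
  match n with
  | O => RtoC 1
  | S m => (rising_factorial z m * (z + RtoC (INR m)))%C
  end.

(* The term at n = 0, where [ln 0] is a junk value, does not affect the limit. *)
Definition gauss_gamma_seq (z : C) (n : nat) : C :=
  (RtoC (INR (fact n)) * Cexp (z * RtoC (ln (INR n)))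
   / rising_factorial z (S n))%C.

(* Gauss's formula Gamma(z) = lim n! n^z / (z (z + 1) ... (z + n)). It holds at
   every z other than 0, -1, -2, ..., in particular for Re z <= 0, where Euler's
   integral diverges. *)
Definition Gamma (z : C) : C :=
  (real (Lim_seq (fun n => Re (gauss_gamma_seq z n))),
   real (Lim_seq (fun n => Im (gauss_gamma_seq z n)))).

(* The singularity of the integrand at t = 1 makes the integral improper. *)
Definition ellipK (k : R) : R :=
  RInt_gen (fun t => 1 / (sqrt (1 - t ^ 2) * sqrt (1 - k ^ 2 * t ^ 2)))
    (at_point 0) (at_left 1).

Definition ellipF (phi k : R) : R :=
  RInt (fun theta => 1 / sqrt (1 - k ^ 2 * sin theta ^ 2)) 0 phi.

(* For 0 < k < 1, phi |-> F(phi, k) is an increasing bijection of R, so the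
   amplitude, and hence sn, is defined on the whole real line. *)
Definition jacobi_am (t k : R) : R := iota (fun phi : R => ellipF phi k = t).

Definition jacobi_sn (t k : R) : R := sin (jacobi_am t k).

(* w'' + q w = 0 on R. [ex_derive w] is not implied by the second conjunct,
   because [Derive] is total. *)
Definition hill_solution (q w : R -> R) : Prop :=
  forall t : R, ex_derive w t /\ is_derive (Derive w) t (- (q t * w t)).

Definition hill_basis (q w1 w2 : R -> R) : Prop :=
  hill_solution q w1 /\ hill_solution q w2 /\
  (forall a b : R, (forall t, a * w1 t + b * w2 t = 0) -> a = 0 /\ b = 0) /\
  (forall w, hill_solution q w ->
     exists a b : R, forall t, w t = a * w1 t + b * w2 t).

(* [d] is the trace of the endomorphism w(t) |-> w(t + sigma), read off its
   matrix in a basis of the solution space. *)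
Definition is_hill_discriminant (q : R -> R) (sigma d : R) : Prop :=
  exists (w1 w2 : R -> R) (a11 a12 a21 a22 : R),
    hill_basis q w1 w2 /\
    (forall t, w1 (t + sigma) = a11 * w1 t + a21 * w2 t) /\
    (forall t, w2 (t + sigma) = a12 * w1 t + a22 * w2 t) /\
    d = a11 + a22.

Definition hill_discriminant (q : R -> R) (sigma : R) : R :=
  iota (fun d : R => is_hill_discriminant q sigma d).

Definition lame_potential (h nu k t : R) : R :=
  h - nu * (nu + 1) * k ^ 2 * jacobi_sn t k ^ 2.

Definition lame_discriminant (h nu k : R) : R :=
  hill_discriminant (lame_potential h nu k) (2 * ellipK k).

(* Main.v *)
Require Import Defs.
From Stdlib Require Import Reals.
From Coquelicot Require Import Coquelicot.
From Stdlib Require Import Ranalysis5 PSeries_reg Factorial Lra Lia Psatz.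

(** With a = nu (nu + 1), w = omega and s = iw, Lame's equation reads
    y'' + (w^2 + a dn^2) y = 0, and dn^2 tends to sech^2. The limit equation has
    the solution f(t) = e^{-st} F(-nu, nu + 1; 1 + s; x), x = 1 / (1 + e^{2t}).
    The function W = y f' - y' f satisfies W' = a (dn^2 - sech^2) y f, where
    dn^2 - sech^2 >= 0 has integral O(k'^2 K) over [0, K]; so W(K) is W(0), an
    explicit combination of f(0) and f'(0), up to that error, while at K the
    functions f and f' are e^{-sK} and -s e^{-sK} up to O(k'^2). Hence
    (s y1 + y1') (s y2 + y2') at K, whose imaginary part is w D / 2, equals
    - e^{2sK} f(0) f'(0) + O(k'^2 K). Finally - f(0) f'(0) = s B: contiguity at
    x = 1/2 gives B(s + 1) / B(s) = s (s + 1) / (s (s + 1) - a) for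
    B(s) = - f(0) f'(0) / s, and B(s + n) -> 1, which is Gauss's product for the
    Gamma quotient. *)

Local Open Scope R_scope.


(** The length K of the interval grows like ln(1/k'), so a Gronwall estimate with a merely bounded
    perturbation would lose a power of 1/k'. The remedy is that |a| dn^2 <= |a| dn = |a| am', whose
    integral over [0, K] is |a| pi / 2 for every k: solutions of Lame's equation with fixed initial
    data are bounded uniformly in k, although they need not decay. The comparison goes through a
    Wronskian with f because f is explicit at both ends: near x = 0 it is a pure exponential, and at
    t = 0 it is a hypergeometric value at x = 1/2. Since s^2 is real, Re f and Im f solve the same
    real equation, and real estimates suffice. The product (s y1 + y1') (s y2 + y2') is the right
    one since its imaginary part is w (y1 y2' + y1' y2), which the symmetry t -> 2K - t of the
    potential identifies with w D / 2. Only the product f(0) f'(0) enters, so neither factor is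
    evaluated in closed form: a first-order recurrence in s together with the limit 1 along s + n
    determines it. All Gamma arguments are non-real, which keeps every denominator away from 0. *)

(** * Elementary bounds for real sequences and complex numbers *)

Lemma eventually_decr_bounded (u : nat -> R) (J : nat) :
  (forall n, (J <= n)%nat -> u (S n) <= u n) -> exists M, forall n, u n <= M.
Proof.
  revert u; induction J as [|J IH]; intros u Hu.
  - exists (u 0%nat); induction n; [lra|].
    apply Rle_trans with (u n); [apply Hu; lia|assumption].
  - destruct (IH (fun n => u (S n))) as [M HM].
    { intros n Hn; apply Hu; lia. }
    exists (Rmax M (u 0%nat)); intros [|n]; [apply Rmax_r|].
    apply Rle_trans with M; [apply HM|apply Rmax_l].
Qed.

Lemma Rabs_Re_le_Cmod (z : C) : Rabs (Re z) <= Cmod z.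
Proof. apply Rle_trans with (2 := Rmax_Cmod z); apply Rmax_l. Qed.

Lemma Rabs_Im_le_Cmod (z : C) : Rabs (Im z) <= Cmod z.
Proof. apply Rle_trans with (2 := Rmax_Cmod z); apply Rmax_r. Qed.

Lemma Re_le_Cmod (z : C) : Re z <= Cmod z.
Proof. apply Rle_trans with (1 := Rle_abs _); apply Rabs_Re_le_Cmod. Qed.

Lemma Cmod_le_Rabs (z : C) : Cmod z <= Rabs (Re z) + Rabs (Im z).
Proof.
  replace z with (RtoC (Re z) + RtoC (Im z) * Ci)%C at 1
    by (destruct z as [x y]; apply injective_projections; simpl; ring).
  apply Rle_trans with (1 := Cmod_triangle _ _).
  rewrite Cmod_mult, !Cmod_R, Cmod_Ci; lra.
Qed.

Lemma Im_neq_0_Cneq (z : C) : Im z <> 0 -> z <> RtoC 0.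
Proof. intros H E; apply H; rewrite E; reflexivity. Qed.

Lemma Im_plus (z w : C) : Im (z + w)%C = Im z + Im w.
Proof. reflexivity. Qed.

Lemma Re_plus (z w : C) : Re (z + w)%C = Re z + Re w.
Proof. reflexivity. Qed.

Lemma Im_RtoC (x : R) : Im (RtoC x) = 0.
Proof. reflexivity. Qed.

Lemma Re_RtoC (x : R) : Re (RtoC x) = x.
Proof. reflexivity. Qed.

(** * Complex power series of a real variable *)

(** Kept as two real series, so that radius, differentiation and mean value arguments apply to each
    component. *)
Definition CPS (c : nat -> C) (x : R) : C :=
  (PSeries (fun n => Re (c n)) x, PSeries (fun n => Im (c n)) x).

(** Radius 1 is enough, since the series are used at arguments [xi t] in (0, 1); an inequality is
    needed because the coefficients may terminate. *)
Definition unit_radius (c : nat -> C) : Prop :=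
  Rbar_le 1 (CV_radius (fun n => Re (c n))) /\
  Rbar_le 1 (CV_radius (fun n => Im (c n))).

Definition Cderive_coef (c : nat -> C) (n : nat) : C := (RtoC (INR (S n)) * c (S n))%C.

Definition Cshift (c : nat -> C) (n : nat) : C :=
  match n with O => RtoC 0 | S m => c m end.

Lemma CPS_ext (c d : nat -> C) (x : R) :
  (forall n, c n = d n) -> CPS c x = CPS d x.
Proof.
  intros H; unfold CPS; f_equal; apply PSeries_ext; intros n; now rewrite H.
Qed.

Lemma radius_ex_pseries (u : nat -> R) (x : R) :
  Rbar_le 1 (CV_radius u) -> Rabs x < 1 -> ex_pseries u x.
Proof.
  intros H Hx; apply CV_radius_inside.
  apply Rbar_lt_le_trans with (Finite 1); assumption.
Qed.

Lemma radius_lincomb (u v : nat -> R) (a b : R) :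
  Rbar_le 1 (CV_radius u) -> Rbar_le 1 (CV_radius v) ->
  Rbar_le 1 (CV_radius (PS_plus (PS_scal a u) (PS_scal b v))).
Proof.
  assert (S : forall (w : nat -> R) e, Rbar_le 1 (CV_radius w) ->
    Rbar_le 1 (CV_radius (PS_scal e w))).
  (* Scaling by 0 makes the radius infinite, hence the separate case. *)
  { intros w e H; destruct (Req_dec e 0) as [->|He].
    - rewrite (CV_radius_ext _ (fun _ => 0)).
      2:{ intros n; apply Rmult_0_l. }
      rewrite CV_radius_const_0; exact I.
    - now rewrite CV_radius_scal. }
  intros Hu Hv.
  apply Rbar_le_trans with (2 := CV_radius_plus _ _).
  apply Rbar_min_case; now apply S.
Qed.

Lemma PSeries_lincomb (u v : nat -> R) (a b x : R) :
  Rbar_le 1 (CV_radius u) -> Rbar_le 1 (CV_radius v) -> Rabs x < 1 ->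
  PSeries (fun n => a * u n + b * v n) x = a * PSeries u x + b * PSeries v x.
Proof.
  intros Hu Hv Hx.
  rewrite <- 2!PSeries_scal, <- PSeries_plus.
  - reflexivity.
  - apply ex_pseries_scal; [apply Rmult_comm|now apply radius_ex_pseries].
  - apply ex_pseries_scal; [apply Rmult_comm|now apply radius_ex_pseries].
Qed.

Lemma unit_radius_scal (z : C) (c : nat -> C) :
  unit_radius c -> unit_radius (fun n => z * c n)%C.
Proof.
  intros [H1 H2]; split.
  - rewrite (CV_radius_ext _ (PS_plus (PS_scal (Re z) (fun n => Re (c n)))
      (PS_scal (- Im z) (fun n => Im (c n))))); [now apply radius_lincomb|].
    intros n; unfold PS_plus, PS_scal, plus, scal, Re, Im; simpl; unfold mult; simpl; ring.
  - rewrite (CV_radius_ext _ (PS_plus (PS_scal (Re z) (fun n => Im (c n)))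
      (PS_scal (Im z) (fun n => Re (c n))))); [now apply radius_lincomb|].
    intros n; unfold PS_plus, PS_scal, plus, scal, Re, Im; simpl; unfold mult; simpl; ring.
Qed.

Lemma unit_radius_plus (c d : nat -> C) :
  unit_radius c -> unit_radius d -> unit_radius (fun n => c n + d n)%C.
Proof.
  intros [H1 H2] [H3 H4]; split.
  - rewrite (CV_radius_ext _ (PS_plus (PS_scal 1 (fun n => Re (c n)))
      (PS_scal 1 (fun n => Re (d n))))); [now apply radius_lincomb|].
    intros n; unfold PS_plus, PS_scal, plus, scal, Re, Im; simpl; unfold mult; simpl; ring.
  - rewrite (CV_radius_ext _ (PS_plus (PS_scal 1 (fun n => Im (c n)))
      (PS_scal 1 (fun n => Im (d n))))); [now apply radius_lincomb|].
    intros n; unfold PS_plus, PS_scal, plus, scal, Re, Im; simpl; unfold mult; simpl; ring.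
Qed.

Lemma unit_radius_derive (c : nat -> C) : unit_radius c -> unit_radius (Cderive_coef c).
Proof.
  intros [H1 H2]; split.
  - rewrite (CV_radius_ext _ (PS_derive (fun n => Re (c n)))).
    + now rewrite CV_radius_derive.
    + intros n; unfold Cderive_coef, PS_derive, Re, Im; cbn -[INR]; ring.
  - rewrite (CV_radius_ext _ (PS_derive (fun n => Im (c n)))).
    + now rewrite CV_radius_derive.
    + intros n; unfold Cderive_coef, PS_derive, Re, Im; cbn -[INR]; ring.
Qed.

Lemma unit_radius_shift (c : nat -> C) : unit_radius c -> unit_radius (Cshift c).
Proof.
  intros [H1 H2]; split.
  - rewrite (CV_radius_ext _ (PS_incr_1 (fun n => Re (c n)))).
    + now rewrite CV_radius_incr_1.
    + intros [|n]; reflexivity.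
  - rewrite (CV_radius_ext _ (PS_incr_1 (fun n => Im (c n)))).
    + now rewrite CV_radius_incr_1.
    + intros [|n]; reflexivity.
Qed.

Lemma CPS_scal (z : C) (c : nat -> C) (x : R) :
  unit_radius c -> Rabs x < 1 -> CPS (fun n => z * c n)%C x = (z * CPS c x)%C.
Proof.
  intros [H1 H2] Hx; unfold CPS.
  apply injective_projections; simpl.
  - rewrite <- (PSeries_ext (fun n => Re z * Re (c n) + - Im z * Im (c n))).
    + rewrite PSeries_lincomb by assumption; unfold Re, Im; simpl; ring.
    + intros n; unfold Re, Im; simpl; ring.
  - rewrite <- (PSeries_ext (fun n => Re z * Im (c n) + Im z * Re (c n))).
    + rewrite PSeries_lincomb by assumption; unfold Re, Im; simpl; ring.
    + intros n; unfold Re, Im; simpl; ring.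
Qed.

Lemma CPS_plus (c d : nat -> C) (x : R) :
  unit_radius c -> unit_radius d -> Rabs x < 1 ->
  CPS (fun n => c n + d n)%C x = (CPS c x + CPS d x)%C.
Proof.
  intros [H1 H2] [H3 H4] Hx; unfold CPS.
  apply injective_projections; simpl.
  - rewrite <- (PSeries_ext (fun n => 1 * Re (c n) + 1 * Re (d n))).
    + rewrite PSeries_lincomb by assumption; ring.
    + intros n; unfold Re, Im; simpl; ring.
  - rewrite <- (PSeries_ext (fun n => 1 * Im (c n) + 1 * Im (d n))).
    + rewrite PSeries_lincomb by assumption; ring.
    + intros n; unfold Re, Im; simpl; ring.
Qed.

Lemma CPS_shift (c : nat -> C) (x : R) : CPS (Cshift c) x = (RtoC x * CPS c x)%C.
Proof.
  unfold CPS; apply injective_projections; simpl.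
  - rewrite (PSeries_ext _ (PS_incr_1 (fun n => Re (c n)))) by (intros [|n]; reflexivity).
    rewrite PSeries_incr_1; unfold Re, Im; ring.
  - rewrite (PSeries_ext _ (PS_incr_1 (fun n => Im (c n)))) by (intros [|n]; reflexivity).
    rewrite PSeries_incr_1; unfold Re, Im; ring.
Qed.

Lemma CPS_zero (c : nat -> C) (x : R) : (forall n, c n = RtoC 0) -> CPS c x = RtoC 0.
Proof.
  intros H; apply injective_projections; simpl.
  - rewrite (PSeries_ext _ (fun _ => 0)); [apply PSeries_const_0|intros n; now rewrite H].
  - rewrite (PSeries_ext _ (fun _ => 0)); [apply PSeries_const_0|intros n; now rewrite H].
Qed.

Lemma is_derive_CPS_Re (c : nat -> C) (x : R) : unit_radius c -> Rabs x < 1 ->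
  is_derive (fun x => Re (CPS c x)) x (Re (CPS (Cderive_coef c) x)).
Proof.
  intros [H1 H2] Hx; cbn -[INR Cderive_coef].
  rewrite (PSeries_ext _ (PS_derive (fun n => Re (c n)))).
  - apply is_derive_PSeries, Rbar_lt_le_trans with (Finite 1); assumption.
  - intros n; unfold Cderive_coef, PS_derive, Re, Im; cbn -[INR]; ring.
Qed.

Lemma is_derive_CPS_Im (c : nat -> C) (x : R) : unit_radius c -> Rabs x < 1 ->
  is_derive (fun x => Im (CPS c x)) x (Im (CPS (Cderive_coef c) x)).
Proof.
  intros [H1 H2] Hx; cbn -[INR Cderive_coef].
  rewrite (PSeries_ext _ (PS_derive (fun n => Im (c n)))).
  - apply is_derive_PSeries, Rbar_lt_le_trans with (Finite 1); assumption.
  - intros n; unfold Cderive_coef, PS_derive, Re, Im; cbn -[INR]; ring.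
Qed.

Lemma bounded_unit_radius (c : nat -> C) (M : R) :
  (forall n, Cmod (c n) <= M) -> unit_radius c.
Proof.
  intros H.
  assert (G : forall u : nat -> R, (forall n, Rabs (u n) <= M) -> Rbar_le 1 (CV_radius u)).
  { intros u Hu; apply (proj1 (CV_radius_bounded u)).
    exists M; intros n; rewrite pow1, Rmult_1_r; apply Hu. }
  split; apply G; intros n; eapply Rle_trans; [|apply H| |apply H].
  - apply Rabs_Re_le_Cmod.
  - apply Rabs_Im_le_Cmod.
Qed.

Lemma PSeries_half_bound (u : nat -> R) (M : R) :
  (forall n, Rabs (u n) <= M) -> Rabs (PSeries u (1/2)) <= 2 * M.
Proof.
  intros Hu.
  assert (G : ex_series (fun n => M * (1/2)^n)).
  { apply (ex_series_scal (V := R_NormedModule) M), ex_series_geom.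
    rewrite Rabs_pos_eq; lra. }
  assert (L : forall n, 0 <= Rabs (u n * (1/2)^n) <= M * (1/2)^n).
  { intros n; split; [apply Rabs_pos|].
    rewrite Rabs_mult, (Rabs_pos_eq ((1/2)^n)) by (apply pow_le; lra).
    apply Rmult_le_compat_r; [apply pow_le; lra|apply Hu]. }
  unfold PSeries.
  eapply Rle_trans; [apply Series_Rabs|].
  - apply (ex_series_le (V := R_CompleteNormedModule) _ (fun n => M * (1/2)^n)); [|exact G].
    intros n; unfold norm; simpl; unfold abs; simpl.
    rewrite Rabs_Rabsolu; apply L.
  - eapply Rle_trans; [apply Series_le; [apply L|exact G]|].
    rewrite Series_scal_l, Series_geom by (rewrite Rabs_pos_eq; lra); lra.
Qed.

(** Without its constant term each component is 1/2 times a series bounded by 2 M at 1/2; the two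
    components contribute M each. *)
Lemma CPS_half_bound (c : nat -> C) (M : R) :
  (forall n, Cmod (c (S n)) <= M) -> Cmod (CPS c (1/2) - c 0%nat)%C <= 2 * M.
Proof.
  intros H.
  assert (Hc : unit_radius c).
  { apply bounded_unit_radius with (Rmax M (Cmod (c 0%nat))); intros [|n];
    [apply Rmax_r|eapply Rle_trans; [apply H|apply Rmax_l]]. }
  assert (E : forall u : nat -> R, Rbar_le 1 (CV_radius u) ->
    (forall n, Rabs (u (S n)) <= M) -> Rabs (PSeries u (1/2) - u 0%nat) <= M).
  { intros u Hu HM.
    rewrite PSeries_decr_1 by (apply radius_ex_pseries; [exact Hu|rewrite Rabs_pos_eq; lra]).
    replace (u 0%nat + 1/2 * PSeries (PS_decr_1 u) (1/2) - u 0%nat)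
      with (1/2 * PSeries (PS_decr_1 u) (1/2)) by ring.
    rewrite Rabs_mult, (Rabs_pos_eq (1/2)) by lra.
    pose proof (PSeries_half_bound (PS_decr_1 u) M HM); lra. }
  destruct Hc as [H1 H2].
  eapply Rle_trans; [apply Cmod_le_Rabs|].
  apply Rle_trans with (M + M); [|lra].
  apply Rplus_le_compat.
  - apply (E (fun n => Re (c n)) H1); intros n.
    eapply Rle_trans; [apply Rabs_Re_le_Cmod|apply H].
  - apply (E (fun n => Im (c n)) H2); intros n.
    eapply Rle_trans; [apply Rabs_Im_le_Cmod|apply H].
Qed.

(** * The hypergeometric function F(-nu, nu + 1; 1 + s; x) *)

(* With a = nu (nu + 1), (n - nu) (n + nu + 1) = n^2 + n - a. *)
Fixpoint hyp_coef (a : R) (s : C) (n : nat) : C :=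
  match n with
  | O => RtoC 1
  | S m => (hyp_coef a s m * RtoC (INR m ^ 2 + INR m - a)
            / (RtoC (INR m + 1) * (RtoC (INR m + 1) + s)))%C
  end.

Definition hypF (a : R) (s : C) : R -> C := CPS (hyp_coef a s).
Definition hypF1 (a : R) (s : C) : R -> C := CPS (Cderive_coef (hyp_coef a s)).
Definition hypF2 (a : R) (s : C) : R -> C :=
  CPS (Cderive_coef (Cderive_coef (hyp_coef a s))).

Lemma hyp_den_neq_0 (s : C) (x : R) : Im s <> 0 -> (RtoC x + s)%C <> RtoC 0.
Proof. intros H; apply Im_neq_0_Cneq; rewrite Im_plus, Im_RtoC; lra. Qed.

Lemma INR_plus_1_neq_0 (m : nat) : RtoC (INR m + 1) <> RtoC 0.
Proof. intros H; apply RtoC_inj in H; pose proof (pos_INR m); lra. Qed.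

Lemma hyp_coef_S (a : R) (s : C) (m : nat) : Im s <> 0 ->
  (RtoC (INR m + 1) * (RtoC (INR m + 1) + s) * hyp_coef a s (S m)
   = RtoC (INR m ^ 2 + INR m - a) * hyp_coef a s m)%C.
Proof.
  intros H.
  change (hyp_coef a s (S m)) with (hyp_coef a s m * RtoC (INR m ^ 2 + INR m - a)
    / (RtoC (INR m + 1) * (RtoC (INR m + 1) + s)))%C.
  field.
  split; [now apply hyp_den_neq_0|apply INR_plus_1_neq_0].
Qed.

(** A modulus is at least the real part, which bounds the factor m + 1 + s from below. Keeping
    [Re s] in the bound gives smallness when [s] is shifted far to the right. *)
Lemma hyp_coef_Cmod_S (a : R) (s : C) (m : nat) : Im s <> 0 -> 0 <= Re s ->
  Cmod (hyp_coef a s (S m)) <=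
  Cmod (hyp_coef a s m) * ((INR m * (INR m + 1) + Rabs a)
    / ((INR m + 1) * (INR m + 1 + Re s))).
Proof.
  intros H Hs; pose proof (pos_INR m) as Hm.
  assert (P1 : 0 < INR m + 1) by lra.
  assert (P2 : 0 < INR m + 1 + Re s) by lra.
  apply Rmult_le_reg_l with ((INR m + 1) * (INR m + 1 + Re s)).
  { now apply Rmult_lt_0_compat. }
  apply Rle_trans with ((INR m + 1) * Cmod (RtoC (INR m + 1) + s) * Cmod (hyp_coef a s (S m))).
  - apply Rmult_le_compat_r; [apply Cmod_ge_0|].
    apply Rmult_le_compat_l; [lra|].
    exact (Re_le_Cmod (RtoC (INR m + 1) + s)).
  - rewrite <- (Rabs_pos_eq (INR m + 1)) at 1 by lra.
    rewrite <- Cmod_R, <- !Cmod_mult, hyp_coef_S, Cmod_mult, Cmod_R by assumption.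
    replace ((INR m + 1) * (INR m + 1 + Re s) * (Cmod (hyp_coef a s m) * ((INR m * (INR m + 1) + Rabs a) / ((INR m + 1) * (INR m + 1 + Re s)))))
      with ((INR m * (INR m + 1) + Rabs a) * Cmod (hyp_coef a s m)) by (field; lra).
    apply Rmult_le_compat_r; [apply Cmod_ge_0|].
    unfold Rminus; eapply Rle_trans; [apply Rabs_triang|].
    rewrite Rabs_Ropp, Rabs_pos_eq by nra; lra.
Qed.

(** The denominator (m + 1) (m + 1 + Re s) exceeds m (m + 1) by exactly (m + 1) (1 + Re s), so the
    condition on [a] says that the ratio bound is at most 1. *)
Lemma hyp_coef_decr (a : R) (s : C) (m : nat) : Im s <> 0 -> 0 <= Re s ->
  Rabs a <= (INR m + 1) * (1 + Re s) ->
  Cmod (hyp_coef a s (S m)) <= Cmod (hyp_coef a s m).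
Proof.
  intros H Hs Ha; pose proof (pos_INR m) as Hm.
  eapply Rle_trans; [now apply hyp_coef_Cmod_S|].
  rewrite <- (Rmult_1_r (Cmod (hyp_coef a s m))) at 2.
  apply Rmult_le_compat_l; [apply Cmod_ge_0|].
  apply Rmult_le_reg_r with ((INR m + 1) * (INR m + 1 + Re s)); [nra|].
  unfold Rdiv; rewrite Rmult_assoc, Rinv_l by nra; nra.
Qed.

Lemma hyp_coef_bounded (a : R) (s : C) : Im s <> 0 -> 0 <= Re s ->
  exists M, forall n, Cmod (hyp_coef a s n) <= M.
Proof.
  intros H Hs.
  destruct (INR_unbounded (Rabs a)) as [J HJ].
  apply eventually_decr_bounded with J.
  intros n Hn; apply hyp_coef_decr; try assumption.
  apply le_INR in Hn; pose proof (pos_INR n); nra.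
Qed.

Lemma hyp_unit_radius (a : R) (s : C) : Im s <> 0 -> 0 <= Re s ->
  unit_radius (hyp_coef a s).
Proof.
  intros H Hs; destruct (hyp_coef_bounded a s H Hs) as [M HM].
  now apply bounded_unit_radius with M.
Qed.

Lemma hypF_0 (a : R) (s : C) : hypF a s 0 = RtoC 1.
Proof.
  unfold hypF, CPS; apply injective_projections; simpl; now rewrite PSeries_0.
Qed.

(** Under this condition on [a] the coefficients decrease in modulus from index 0 on, so the bound
    |a| / (1 + Re s) for the one of index 1 holds for all later ones. *)
Lemma hypF_half_near_1 (a : R) (s : C) : Im s <> 0 -> 0 <= Re s -> Rabs a <= 1 + Re s ->
  Cmod (hypF a s (1/2) - RtoC 1)%C <= 2 * (Rabs a / (1 + Re s)).
Proof.
  intros H Hs Ha.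
  apply (CPS_half_bound (hyp_coef a s)).
  induction n as [|n IH].
  - eapply Rle_trans; [now apply hyp_coef_Cmod_S|].
    change (hyp_coef a s 0) with (RtoC 1); change (INR 0) with 0.
    rewrite Cmod_1; right; field; lra.
  - eapply Rle_trans; [|exact IH].
    apply hyp_coef_decr; try assumption.
    pose proof (pos_INR (S n)); nra.
Qed.

(** Compared coefficientwise: multiplication by x is [Cshift], and each coefficient is one instance
    of [hyp_coef_S]. *)
Lemma hyp_ode (a : R) (s : C) (x : R) : Im s <> 0 -> 0 <= Re s -> Rabs x < 1 ->
  (RtoC (x * (1 - x)) * hypF2 a s x + (1 + s - RtoC (2 * x)) * hypF1 a s x
   + RtoC a * hypF a s x = 0)%C.
Proof.
  intros H Hs Hx.
  pose proof (hyp_unit_radius a s H Hs) as G.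
  pose proof (unit_radius_derive _ G) as G1.
  pose proof (unit_radius_derive _ G1) as G2.
  set (c := hyp_coef a s) in *.
  set (c1 := Cderive_coef c) in *. set (c2 := Cderive_coef c1) in *.
  transitivity (CPS (fun n => Cshift c2 n + ((-1) * Cshift (Cshift c2) n
     + ((1 + s) * c1 n + ((-2) * Cshift c1 n + RtoC a * c n))))%C x).
  - pose proof (unit_radius_shift _ G2) as G3.
    pose proof (unit_radius_shift _ G3) as G4.
    pose proof (unit_radius_shift _ G1) as G5.
    rewrite CPS_plus; try assumption.
    2:{ apply unit_radius_plus; [now apply unit_radius_scal|].
        apply unit_radius_plus; [now apply unit_radius_scal|].
        apply unit_radius_plus; now apply unit_radius_scal. }
    rewrite CPS_plus; try assumption.
    2:{ now apply unit_radius_scal. }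
    2:{ apply unit_radius_plus; [now apply unit_radius_scal|].
        apply unit_radius_plus; now apply unit_radius_scal. }
    rewrite CPS_plus; try assumption.
    2:{ now apply unit_radius_scal. }
    2:{ apply unit_radius_plus; now apply unit_radius_scal. }
    rewrite CPS_plus; try assumption; try now apply unit_radius_scal.
    rewrite !CPS_scal by assumption.
    rewrite !CPS_shift.
    unfold hypF, hypF1, hypF2; fold c; fold c1; fold c2.
    rewrite !RtoC_mult, RtoC_minus; ring.
  - apply CPS_zero; intros n.
    assert (R0 := hyp_coef_S a s n H); fold c in R0.
    rewrite RtoC_minus, !RtoC_plus, RtoC_pow in R0.
    (* Indices 0 and 1 are separate because the double shift puts zeros there. *)
    destruct n as [|[|n]]; unfold Cshift, c2, c1, Cderive_coef.
    + simpl in R0 |- *.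
      transitivity ((0 + 1) * (0 + 1 + s) * c 1%nat - (0 * (0 * 1) + 0 - RtoC a) * c 0%nat)%C;
        [ring|rewrite R0; ring].
    + simpl in R0 |- *. rewrite RtoC_plus.
      transitivity ((1 + 1) * (1 + 1 + s) * c 2%nat - (1 * (1 * 1) + 1 - RtoC a) * c 1%nat)%C;
        [ring|rewrite R0; ring].
    + rewrite !S_INR, !RtoC_plus in *. 
      match type of R0 with ?L = ?R' => transitivity (L - R')%C end;
        [ring|rewrite R0; ring].
Qed.

(** * Contiguity relations at x = 1/2 *)

Lemma Cmult_cancel_l (x y z : C) : x <> RtoC 0 -> (x * y = x * z)%C -> y = z.
Proof.
  intros Hx E.
  transitivity (/ x * (x * y))%C; [field; assumption|rewrite E; field; assumption].
Qed.

(** The Pochhammer symbols (2 + s)_n and (1 + s)_n have quotient (n + 1 + s) / (1 + s). *)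
Lemma hyp_coef_contiguous (a : R) (s : C) (n : nat) : Im s <> 0 ->
  ((RtoC (INR n + 1) + s) * hyp_coef a (s + 1) n = (1 + s) * hyp_coef a s n)%C.
Proof.
  intros H; induction n as [|n IH].
  - simpl; rewrite Rplus_0_l; ring.
  - assert (H' : Im (s + 1)%C <> 0) by (rewrite Im_plus, Im_RtoC; lra).
    pose proof (hyp_coef_S a s n H) as R1.
    pose proof (hyp_coef_S a (s + 1)%C n H') as R2.
    pose proof (hyp_den_neq_0 s (INR n + 1) H) as N1.
    pose proof (INR_plus_1_neq_0 n) as N2.
    rewrite S_INR; rewrite !RtoC_plus in *.
    set (p := RtoC (INR n ^ 2 + INR n - a)) in *.
    set (N := RtoC (INR n)) in *.
    set (u := hyp_coef a (s + 1) (S n)) in *; set (v := hyp_coef a s (S n)) in *.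
    apply (Cmult_cancel_l ((N + 1) * (N + 1 + s))%C).
    { now apply Cmult_neq_0. }
    transitivity ((N + 1 + s) * ((N + 1) * (N + 1 + (s + 1)) * u))%C; [ring|].
    rewrite R2.
    transitivity ((1 + s) * ((N + 1) * (N + 1 + s) * v))%C; [|ring].
    rewrite R1.
    transitivity (p * ((N + 1 + s) * hyp_coef a (s + 1) n))%C; [ring|].
    rewrite IH; ring.
Qed.

Lemma Cshift_derive (c : nat -> C) (n : nat) :
  Cshift (Cderive_coef c) n = (RtoC (INR n) * c n)%C.
Proof. destruct n as [|n]; [simpl; ring|reflexivity]. Qed.

(** At x = 1/2 this turns the second factor of [hypB a s] into a multiple of F at s + 1, while
    [hypF_lower] identifies the second factor at s + 1 with F at s. Together they give the
    recurrence for [hypB]. *)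
Lemma hypF_raise (a : R) (s : C) (x : R) : Im s <> 0 -> 0 <= Re s -> Rabs x < 1 ->
  ((s * (s + 1) - RtoC a) * hypF a (s + 1) x
   = (s + 1) * (s * hypF a s x + RtoC (1 - x) * hypF1 a s x))%C.
Proof.
  intros H Hs Hx.
  assert (H' : Im (s + 1)%C <> 0) by (rewrite Im_plus, Im_RtoC; lra).
  assert (Hs' : 0 <= Re (s + 1)%C) by (rewrite Re_plus, Re_RtoC; lra).
  pose proof (hyp_unit_radius a s H Hs) as G.
  pose proof (hyp_unit_radius a _ H' Hs') as G'.
  pose proof (unit_radius_derive _ G) as G1.
  pose proof (unit_radius_shift _ G1) as G2.
  unfold hypF, hypF1.
  transitivity (CPS (fun n => (s * (s + 1)) * hyp_coef a s n
     + ((s + 1) * Cderive_coef (hyp_coef a s) n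
        + - (s + 1) * Cshift (Cderive_coef (hyp_coef a s)) n))%C x).
  - rewrite <- CPS_scal by assumption.
    apply CPS_ext; intros n.
    pose proof (hyp_coef_contiguous a s n H) as E.
    pose proof (hyp_coef_S a s n H) as R1.
    pose proof (hyp_den_neq_0 s (INR n + 1) H) as N1.
    rewrite Cshift_derive; unfold Cderive_coef; rewrite S_INR.
    (* The factor n + 1 + s makes [hyp_coef_contiguous] applicable, after which only coefficients
       for [s] remain. *)
    apply (Cmult_cancel_l (RtoC (INR n + 1) + s)%C); [assumption|].
    transitivity ((s * (s + 1) - RtoC a) * ((RtoC (INR n + 1) + s) * hyp_coef a (s + 1) n))%C;
      [ring|rewrite E].
    rewrite RtoC_minus, !RtoC_plus, RtoC_pow in *.
    match type of R1 with ?L = ?R' =>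
      transitivity ((s + 1) * L + (s + 1) * (RtoC (INR n) + 1 + s) * (s - RtoC (INR n)) * hyp_coef a s n)%C end;
      [rewrite R1; ring|ring].
  - rewrite CPS_plus, CPS_plus, !CPS_scal, CPS_shift, RtoC_minus;
      try assumption; try now apply unit_radius_scal.
    + ring.
    + apply unit_radius_plus; now apply unit_radius_scal.
Qed.

Lemma hypF_lower (a : R) (s : C) (x : R) : Im s <> 0 -> 0 <= Re s -> Rabs x < 1 ->
  ((s + 1) * hypF a s x = (s + 1) * hypF a (s + 1) x + RtoC x * hypF1 a (s + 1) x)%C.
Proof.
  intros H Hs Hx.
  assert (H' : Im (s + 1)%C <> 0) by (rewrite Im_plus, Im_RtoC; lra).
  assert (Hs' : 0 <= Re (s + 1)%C) by (rewrite Re_plus, Re_RtoC; lra).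
  pose proof (hyp_unit_radius a s H Hs) as G.
  pose proof (hyp_unit_radius a _ H' Hs') as G'.
  pose proof (unit_radius_derive _ G') as G1.
  unfold hypF, hypF1.
  rewrite <- CPS_shift, <- !CPS_scal, <- CPS_plus; try assumption.
  - apply CPS_ext; intros n; rewrite Cshift_derive.
    pose proof (hyp_coef_contiguous a s n H) as E.
    rewrite RtoC_plus in E.
    transitivity ((1 + s) * hyp_coef a s n)%C; [ring|rewrite <- E; ring].
  - now apply unit_radius_scal.
  - now apply unit_radius_shift.
Qed.

(** This is - f(0) f'(0) / s: at t = 0 one has x = 1/2, f(0) = F and f'(0) = - s F - F' / 2. *)
Definition hypB (a : R) (s : C) : C :=
  (hypF a s (1/2) * (hypF a s (1/2) + hypF1 a s (1/2) / (2 * s)))%C.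

Lemma hypPsi_succ (a : R) (s : C) : Im s <> 0 -> 0 <= Re s ->
  (hypF a (s + 1) (1/2) + hypF1 a (s + 1) (1/2) / (2 * (s + 1)) = hypF a s (1/2))%C.
Proof.
  intros H Hs.
  assert (N : (s + 1)%C <> 0%C) by (apply Im_neq_0_Cneq; rewrite Im_plus, Im_RtoC; lra).
  assert (N2 : RtoC 2 <> 0%C) by (intros E; apply RtoC_inj in E; lra).
  pose proof (hypF_lower a s (1/2) H Hs) as E.
  rewrite Rabs_pos_eq in E by lra; specialize (E ltac:(lra)).
  apply (Cmult_cancel_l (s + 1)%C); [assumption|].
  rewrite E, RtoC_div by lra; field; repeat split; assumption.
Qed.

(** No derivative is left in this form, so the limit of [hypB] along s + n follows from that of F
    alone. *)
Lemma hypB_succ_prod (a : R) (s : C) : Im s <> 0 -> 0 <= Re s ->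
  hypB a (s + 1) = (hypF a (s + 1) (1/2) * hypF a s (1/2))%C.
Proof. intros H Hs; unfold hypB; now rewrite hypPsi_succ. Qed.

Lemma hypB_succ (a : R) (s : C) : Im s <> 0 -> 0 <= Re s ->
  (hypB a (s + 1) * (s * (s + 1) - RtoC a) = hypB a s * (s * (s + 1)))%C.
Proof.
  intros H Hs; rewrite hypB_succ_prod by assumption; unfold hypB.
  assert (N : s <> 0%C) by now apply Im_neq_0_Cneq.
  assert (N2 : RtoC 2 <> 0%C) by (intros E; apply RtoC_inj in E; lra).
  pose proof (hypF_raise a s (1/2) H Hs) as E.
  rewrite Rabs_pos_eq in E by lra; specialize (E ltac:(lra)).
  transitivity (hypF a s (1/2) * ((s * (s + 1) - RtoC a) * hypF a (s + 1) (1/2)))%C; [ring|].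
  rewrite E.
  replace (1 - 1/2) with (1/2) by lra.
  rewrite RtoC_div by lra; field; repeat split; assumption.
Qed.


(** * Limits of complex sequences *)

(** Componentwise, to match [Gamma], which is built from the limits of real and imaginary parts. *)
Definition Cis_lim (u : nat -> C) (l : C) : Prop :=
  is_lim_seq (fun n => Re (u n)) (Re l) /\ is_lim_seq (fun n => Im (u n)) (Im l).

Lemma Cis_lim_unique (u : nat -> C) (l m : C) : Cis_lim u l -> Cis_lim u m -> l = m.
Proof.
  intros [H1 H2] [H3 H4]; apply injective_projections.
  - apply is_lim_seq_unique in H1, H3; unfold Re in *; congruence.
  - apply is_lim_seq_unique in H2, H4; unfold Im in *; congruence.
Qed.

Lemma Cis_lim_ext (u v : nat -> C) (l : C) :
  (forall n, u n = v n) -> Cis_lim u l -> Cis_lim v l.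
Proof.
  intros H [H1 H2]; split; eapply is_lim_seq_ext; try eassumption;
  intros n; simpl; now rewrite H.
Qed.

Lemma Cis_lim_mult (u v : nat -> C) (l m : C) :
  Cis_lim u l -> Cis_lim v m -> Cis_lim (fun n => u n * v n)%C (l * m)%C.
Proof.
  intros [H1 H2] [H3 H4]; split; simpl.
  - apply is_lim_seq_minus'; now apply is_lim_seq_mult'.
  - apply is_lim_seq_plus'; now apply is_lim_seq_mult'.
Qed.

Lemma Cis_lim_const (l : C) : Cis_lim (fun _ => l) l.
Proof. split; apply is_lim_seq_const. Qed.

Lemma Cis_lim_Cmod (u : nat -> C) (l : C) (e : nat -> R) :
  (forall n, Cmod (u n - l)%C <= e n) -> is_lim_seq e 0 -> Cis_lim u l.
Proof.
  intros H He.
  assert (G : forall v : nat -> R, forall m, (forall n, Rabs (v n - m) <= e n) -> is_lim_seq v m).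
  { intros v m Hv.
    apply is_lim_seq_le_le with (fun n => m - e n) (fun n => m + e n).
    - intros n; specialize (Hv n); apply Rabs_le_between in Hv; lra.
    - replace m with (m - 0) at 1 by ring; apply is_lim_seq_minus'; [apply is_lim_seq_const|assumption].
    - replace m with (m + 0) at 1 by ring; apply is_lim_seq_plus'; [apply is_lim_seq_const|assumption]. }
  split; apply G; intros n; (eapply Rle_trans; [|apply (H n)]).
  - apply (Rabs_Re_le_Cmod (u n - l)).
  - apply (Rabs_Im_le_Cmod (u n - l)).
Qed.

(** The bound is the decrement of a null sequence [q]: so u - q is nondecreasing, u + q is
    nonincreasing, and the latter is bounded below by the initial value of the former. *)
Lemma ex_lim_telescoping (u : nat -> R) (K : R) (N : nat) :
  (forall n, (N <= n)%nat -> Rabs (u (S n) - u n) <= K * (/ INR (S n) - / INR (S (S n)))) ->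
  ex_finite_lim_seq u.
Proof.
  intros H.
  assert (G : ex_finite_lim_seq (fun n => u (n + N)%nat)).
  2:{ destruct G as [l Hl]; exists l; now apply (is_lim_seq_incr_n _ N). }
  set (q := fun n => K * / INR (S (n + N))).
  assert (D : forall n, Rabs (u (S n + N)%nat - u (n + N)%nat) <= q n - q (S n)).
  { intros n; eapply Rle_trans; [apply (H (n + N)%nat); lia|unfold q; simpl Nat.add; lra]. }
  assert (Q : is_lim_seq q 0).
  { replace (Finite 0) with (Rbar_mult K 0) by (simpl; f_equal; ring).
    apply is_lim_seq_scal_l.
    apply (is_lim_seq_incr_n (fun n => / INR (S n)) N).
    apply (is_lim_seq_incr_1 (fun n => / INR n)).
    replace (Finite 0) with (Rbar_inv p_infty) by reflexivity.
    apply is_lim_seq_inv; [apply is_lim_seq_INR|discriminate]. }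
  assert (L : ex_finite_lim_seq (fun n => u (n + N)%nat + q n)).
  { assert (I : forall n, u (0 + N)%nat - q 0%nat <= u (n + N)%nat - q n).
    { induction n; [lra|]. specialize (D n); apply Rabs_le_between in D; lra. }
    assert (P : forall n, q (S n) <= q n).
    { intros n; pose proof (Rabs_pos (u (S n + N)%nat - u (n + N)%nat)); specialize (D n); lra. }
    assert (P' : forall n, 0 <= q n).
    { intros n; apply (is_lim_seq_decr_compare q 0 Q P). }
    apply ex_finite_lim_seq_decr with (u (0 + N)%nat - q 0%nat).
    - intros n; specialize (D n); apply Rabs_le_between in D; lra.
    - intros n; specialize (I n); specialize (P' n); lra. }
  destruct L as [l Hl]; exists (l - 0).
  apply is_lim_seq_ext with (fun n => (u (n + N)%nat + q n) - q n); [intros n; ring|].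
  now apply is_lim_seq_minus'.
Qed.

(* Since sum 1/n^2 converges, [Cmod (g n) * exp (K / n)] is eventually decreasing. *)
Lemma ex_Clim_product (g : nat -> C) (K : R) (N : nat) : 0 <= K ->
  (forall n, (N <= n)%nat ->
     Cmod (g (S n) - g n)%C <= Cmod (g n) * (K * (/ INR (S n) - / INR (S (S n))))) ->
  exists l, Cis_lim g l.
Proof.
  intros HK H.
  assert (P : forall n, 0 < / INR (S (S n)) <= / INR (S n)).
  { intros n; assert (0 < INR (S n)) by (apply lt_0_INR; lia).
    split; [apply Rinv_0_lt_compat, lt_0_INR; lia|].
    apply Rinv_le_contravar; [assumption|apply le_INR; lia]. }
  destruct (eventually_decr_bounded (fun n => Cmod (g n) * exp (K * / INR (S n))) N) as [M HM].
  { intros n Hn; specialize (H n Hn); specialize (P n).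
    set (p := / INR (S n)) in *; set (q := / INR (S (S n))) in *.
    (* The modulus grows by a factor of at most 1 + K (p - q) <= exp (K (p - q)), which the change
       of weight from exp (K p) to exp (K q) compensates. *)
    apply Rle_trans with (Cmod (g n) * exp (K * (p - q)) * exp (K * q)).
    - apply Rmult_le_compat_r; [left; apply exp_pos|].
      apply Rle_trans with (Cmod (g n) * (1 + K * (p - q))).
      + replace (g (S n)) with (g n + (g (S n) - g n))%C by ring.
        eapply Rle_trans; [apply Cmod_triangle|lra].
      + apply Rmult_le_compat_l; [apply Cmod_ge_0|apply exp_ineq1_le].
    - rewrite Rmult_assoc, <- exp_plus; right; f_equal; f_equal; ring. }
  assert (B : forall n, Cmod (g n) <= M).
  { intros n; apply Rle_trans with (2 := HM n).
    rewrite <- (Rmult_1_r (Cmod (g n))) at 1.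
    apply Rmult_le_compat_l; [apply Cmod_ge_0|].
    pose proof (exp_ineq1_le (K * / INR (S n))); destruct (P n); nra. }
  assert (B' : forall n, (N <= n)%nat ->
     Cmod (g (S n) - g n)%C <= M * K * (/ INR (S n) - / INR (S (S n)))).
  { intros n Hn; eapply Rle_trans; [now apply H|].
    rewrite Rmult_assoc; apply Rmult_le_compat_r; [|apply B].
    destruct (P n); apply Rmult_le_pos; lra. }
  destruct (ex_lim_telescoping (fun n => Re (g n)) (M * K) N) as [x Hx].
  { intros n Hn; apply Rle_trans with (2 := B' n Hn).
    apply (Rabs_Re_le_Cmod (g (S n) - g n)). }
  destruct (ex_lim_telescoping (fun n => Im (g n)) (M * K) N) as [y Hy].
  { intros n Hn; apply Rle_trans with (2 := B' n Hn).
    apply (Rabs_Im_le_Cmod (g (S n) - g n)). }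
  now exists (x, y).
Qed.

(** * The complex exponential *)

Lemma Cexp_plus (u v : C) : Cexp (u + v) = (Cexp u * Cexp v)%C.
Proof.
  unfold Cexp; rewrite Re_plus, Im_plus, exp_plus, cos_plus, sin_plus.
  apply injective_projections; simpl; ring.
Qed.

Lemma Cexp_0 : Cexp 0 = RtoC 1.
Proof.
  unfold Cexp; simpl; rewrite exp_0, cos_0, sin_0; apply injective_projections; simpl; ring.
Qed.

Lemma Cexp_neq_0 (z : C) : Cexp z <> RtoC 0.
Proof.
  intros H; apply C1_nz.
  rewrite <- Cexp_0; replace (RtoC 0) with (z + - z)%C by ring.
  rewrite Cexp_plus, H; ring.
Qed.

(** Two applications of the mean value theorem express the remainder as f2(e) c d with c <= d,
    whence M in place of the sharp M / 2. *)
Lemma taylor2_bound (f f1 f2 : R -> R) (M d : R) :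
  0 <= d <= 1 ->
  (forall x, is_derive f x (f1 x)) -> (forall x, is_derive f1 x (f2 x)) ->
  (forall x, 0 <= x <= 1 -> Rabs (f2 x) <= M) ->
  Rabs (f d - f 0 - f1 0 * d) <= M * d ^ 2.
Proof.
  intros Hd H1 H2 HM.
  assert (HM0 : 0 <= M) by (eapply Rle_trans; [apply Rabs_pos|apply (HM 0); lra]).
  destruct (MVT_gen (fun x => f x - f1 0 * x) 0 d (fun x => f1 x - f1 0)) as (c & Hc & E).
  - intros x _; auto_derive; [exists (f1 x); apply H1|].
    replace (Derive _ x) with (f1 x) by (symmetry; apply is_derive_unique, H1); ring.
  - intros x _; apply continuity_pt_filterlim, (ex_derive_continuous (fun x => f x - f1 0 * x)).
    auto_derive; exists (f1 x); apply H1.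
  - rewrite Rmin_left, Rmax_right in Hc by lra.
    destruct (MVT_gen f1 0 c f2) as (e & He & E').
    + intros x _; apply H2.
    + intros x _; apply continuity_pt_filterlim, (ex_derive_continuous f1).
      exists (f2 x); apply H2.
    + rewrite Rmin_left, Rmax_right in He by lra.
      replace (f d - f 0 - f1 0 * d) with (f2 e * (c * d)) by nra.
      rewrite Rabs_mult.
      rewrite (Rabs_pos_eq (c * d)) by nra.
      apply Rmult_le_compat; [apply Rabs_pos|nra|apply HM; lra|nra].
Qed.

Lemma Cexp_taylor (z : C) : exists M, 0 <= M /\ forall d, 0 <= d <= 1 ->
  Cmod (Cexp (z * RtoC d) - 1 - z * RtoC d)%C <= M * d ^ 2.
Proof.
  destruct z as [a b].
  (* [M0] bounds the second derivatives of e^{ax} cos bx and e^{ax} sin bx on [0, 1]; below, [u] and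
     [v] stand for a sine and a cosine up to order and sign. *)
  set (M0 := exp (Rabs a) * (Rabs a + Rabs b) ^ 2).
  assert (E : forall x u v, 0 <= x <= 1 -> Rabs u <= 1 -> Rabs v <= 1 ->
    Rabs (exp (a * x) * ((a ^ 2 - b ^ 2) * u + 2 * a * b * v)) <= M0).
  { intros x u v Hx Hu Hv; unfold M0; rewrite Rabs_mult.
    apply Rmult_le_compat; try apply Rabs_pos.
    - rewrite Rabs_pos_eq by (left; apply exp_pos).
      assert (a * x <= Rabs a) by (destruct (Rcase_abs a); [rewrite Rabs_left|rewrite Rabs_pos_eq]; nra).
      destruct (Rle_lt_or_eq_dec _ _ H) as [H'|H']; [left; now apply exp_increasing|rewrite H'; lra].
    - eapply Rle_trans; [apply Rabs_triang|]. rewrite !Rabs_mult.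
      rewrite (Rabs_pos_eq 2) by lra.
      assert (Rabs (a ^ 2 - b ^ 2) <= Rabs a ^ 2 + Rabs b ^ 2).
      { unfold Rminus; eapply Rle_trans; [apply Rabs_triang|].
        rewrite Rabs_Ropp, <- !RPow_abs; lra. }
      pose proof (Rabs_pos a); pose proof (Rabs_pos b).
      pose proof (Rabs_pos u); pose proof (Rabs_pos v).
      pose proof (Rabs_pos (a ^ 2 - b ^ 2)).
      assert (0 <= Rabs a * Rabs b) by nra.
      assert (Rabs (a ^ 2 - b ^ 2) * Rabs u <= Rabs (a ^ 2 - b ^ 2)) by nra.
      assert (2 * Rabs a * Rabs b * Rabs v <= 2 * Rabs a * Rabs b) by nra.
      nra. }
  assert (M0p : 0 <= M0).
  { unfold M0; apply Rmult_le_pos; [left; apply exp_pos|apply pow2_ge_0]. }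
  exists (M0 + M0); split; [lra|]; intros d Hd.
  eapply Rle_trans; [apply Cmod_le_Rabs|].
  rewrite Rmult_plus_distr_r; apply Rplus_le_compat.
  - replace (Re (Cexp ((a, b) * RtoC d) - 1 - (a, b) * RtoC d)%C)
      with (exp (a * d) * cos (b * d) - exp (a * 0) * cos (b * 0) - a * d).
    2:{ rewrite !Rmult_0_r, exp_0, cos_0. unfold Cexp; simpl.
        replace (a * d - b * 0) with (a * d) by ring.
        replace (a * 0 + b * d) with (b * d) by ring. ring. }
    replace (a * d) with (exp (a * 0) * (a * cos (b * 0) - b * sin (b * 0)) * d) at 2
      by (rewrite !Rmult_0_r, exp_0, cos_0, sin_0; ring).
    apply (taylor2_bound (fun x => exp (a * x) * cos (b * x))
      (fun x => exp (a * x) * (a * cos (b * x) - b * sin (b * x)))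
      (fun x => exp (a * x) * ((a ^ 2 - b ^ 2) * cos (b * x) + 2 * a * b * - sin (b * x))));
      [assumption| | |].
    + intros x; auto_derive; [trivial|ring].
    + intros x; auto_derive; [trivial|ring].
    + intros x Hx; apply E; [assumption| |rewrite Rabs_Ropp].
      * apply Rabs_le, COS_bound.
      * apply Rabs_le, SIN_bound.
  - replace (Im (Cexp ((a, b) * RtoC d) - 1 - (a, b) * RtoC d)%C)
      with (exp (a * d) * sin (b * d) - exp (a * 0) * sin (b * 0) - b * d).
    2:{ rewrite !Rmult_0_r, sin_0. unfold Cexp; simpl.
        replace (a * d - b * 0) with (a * d) by ring.
        replace (a * 0 + b * d) with (b * d) by ring. ring. }
    replace (b * d) with (exp (a * 0) * (a * sin (b * 0) + b * cos (b * 0)) * d) at 2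
      by (rewrite !Rmult_0_r, exp_0, cos_0, sin_0; ring).
    apply (taylor2_bound (fun x => exp (a * x) * sin (b * x))
      (fun x => exp (a * x) * (a * sin (b * x) + b * cos (b * x)))
      (fun x => exp (a * x) * ((a ^ 2 - b ^ 2) * sin (b * x) + 2 * a * b * cos (b * x))));
      [assumption| | |].
    + intros x; auto_derive; [trivial|ring].
    + intros x; auto_derive; [trivial|ring].
    + intros x Hx; apply E; [assumption| |].
      * apply Rabs_le, SIN_bound.
      * apply Rabs_le, COS_bound.
Qed.

(** * Convergence of Gauss's product *)

Lemma rising_factorial_neq_0 (z : C) (n : nat) : Im z <> 0 -> rising_factorial z n <> RtoC 0.
Proof.
  intros H; induction n as [|n IH]; simpl; [apply C1_nz|].
  apply Cmult_neq_0; [assumption|].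
  apply Im_neq_0_Cneq; rewrite Im_plus, Im_RtoC; lra.
Qed.

Lemma fact_neq_0_C (n : nat) : RtoC (INR (fact n)) <> RtoC 0.
Proof. intros E; apply RtoC_inj in E; now apply (INR_fact_neq_0 n). Qed.

Lemma gauss_gamma_neq_0 (z : C) (n : nat) : Im z <> 0 -> gauss_gamma_seq z n <> RtoC 0.
Proof.
  intros H; unfold gauss_gamma_seq, Cdiv.
  apply Cmult_neq_0; [apply Cmult_neq_0; [apply fact_neq_0_C|apply Cexp_neq_0]|].
  intros E; apply C1_nz.
  rewrite <- (Cinv_r (rising_factorial z (S n))) by now apply rising_factorial_neq_0.
  rewrite E; ring.
Qed.

Lemma gauss_gamma_S (z : C) (n : nat) : Im z <> 0 ->
  (gauss_gamma_seq z (S n) * (z + RtoC (INR (S n)))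
   = gauss_gamma_seq z n
     * (RtoC (INR (S n)) * Cexp (z * RtoC (ln (INR (S n)) - ln (INR n)))))%C.
Proof.
  intros H; unfold gauss_gamma_seq.
  change (rising_factorial z (S (S n)))
    with (rising_factorial z (S n) * (z + RtoC (INR (S n))))%C.
  rewrite fact_simpl, mult_INR, RtoC_mult, RtoC_minus.
  replace (z * RtoC (ln (INR (S n))))%C
    with (z * RtoC (ln (INR n)) + z * (RtoC (ln (INR (S n))) - RtoC (ln (INR n))))%C by ring.
  rewrite Cexp_plus; field; split.
  - now apply rising_factorial_neq_0.
  - apply Im_neq_0_Cneq; rewrite Im_plus, Im_RtoC; lra.
Qed.

Lemma ln_le_sub1 (x : R) : 0 < x -> ln x <= x - 1.
Proof.
  intros Hx; pose proof (exp_ineq1_le (ln x)) as H; rewrite exp_ln in H by assumption; lra.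
Qed.

Lemma ln_succ_diff (n : nat) : (1 <= n)%nat ->
  / INR (S n) <= ln (INR (S n)) - ln (INR n) <= / INR n.
Proof.
  intros Hn; apply le_INR in Hn; simpl in Hn; rewrite S_INR.
  rewrite <- ln_div by lra; split.
  - rewrite <- (Ropp_involutive (ln _)), <- ln_Rinv by (apply Rdiv_lt_0_compat; lra).
    pose proof (ln_le_sub1 (/ ((INR n + 1) / INR n))) as L.
    assert (P : / ((INR n + 1) / INR n) = 1 - / (INR n + 1)) by (field; lra).
    rewrite P in *.
    assert (/ (INR n + 1) < 1) by (rewrite <- Rinv_1; apply Rinv_lt_contravar; lra); lra.
  - eapply Rle_trans; [apply ln_le_sub1, Rdiv_lt_0_compat; lra|right; field; lra].
Qed.

(** The ratio (n + 1) (1 + 1/n)^z / (n + 1 + z) is 1 + O(1/n^2), stated as a telescoping bound for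
    [ex_Clim_product]. The lower bound on |r| serves the reciprocal sequence. *)
Lemma gauss_gamma_ratio (z : C) : Im z <> 0 -> exists K N, 0 <= K /\
  forall n, (N <= n)%nat -> (1 <= n)%nat /\ exists r : C,
    gauss_gamma_seq z (S n) = (gauss_gamma_seq z n * r)%C /\
    Cmod (r - 1)%C <= K * (/ INR (S n) - / INR (S (S n))) /\ / 2 <= Cmod r.
Proof.
  intros Hz; destruct (Cexp_taylor z) as (M & HM & T).
  set (K0 := 2 * (2 * M + Cmod z)).
  assert (HK0 : 0 <= K0) by (unfold K0; pose proof (Cmod_ge_0 z); lra).
  (* For n beyond this bound, 2 |z| yields |z + n + 1| >= n / 2, and 2 K0 yields K0 / n^2 <= 1/2. *)
  destruct (INR_unbounded (2 * Cmod z + 2 * K0)) as [N HN].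
  (* The factor 6 comes from (m + 1) (m + 2) <= 6 m^2 for m >= 1; [S N] excludes n = 0, where ln 0
     would occur. *)
  exists (6 * K0), (S N); split; [lra|]; intros n Hn.
  assert (Hn1 : (1 <= n)%nat) by lia; split; [assumption|].
  assert (Hn2 : 2 * Cmod z + 2 * K0 < INR n).
  { apply Rlt_le_trans with (1 := HN), le_INR; lia. }
  assert (Hn3 : 1 <= INR n) by (apply (le_INR 1); lia).
  pose proof (ln_succ_diff n Hn1) as D; rewrite S_INR in D.
  pose proof (gauss_gamma_S z n Hz) as E; rewrite S_INR in E.
  set (d := ln (INR n + 1) - ln (INR n)) in *.
  rewrite !S_INR.
  set (m := INR n) in *.
  assert (Hden : (z + RtoC (m + 1))%C <> 0%C).
  { apply Im_neq_0_Cneq; rewrite Im_plus, Im_RtoC; lra. }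
  assert (Hm : / m <= 1) by (rewrite <- Rinv_1; apply Rinv_le_contravar; lra).
  assert (Hm0 : 0 < / (m + 1)) by (apply Rinv_0_lt_compat; lra).
  assert (Hden' : m / 2 <= Cmod (z + RtoC (m + 1))).
  { assert (m + 1 <= Cmod (z + RtoC (m + 1)) + Cmod z); [|lra].
    apply Rle_trans with (Cmod (RtoC (m + 1))).
    - rewrite Cmod_R, Rabs_pos_eq; lra.
    - replace (RtoC (m + 1)) with ((z + RtoC (m + 1)) + (- z))%C at 1 by ring.
      rewrite <- (Cmod_opp z); apply Cmod_triangle. }
  set (r := (RtoC (m + 1) * Cexp (z * RtoC d) / (z + RtoC (m + 1)))%C).
  assert (R1 : Cmod (r - 1) <= K0 / m ^ 2).
  (* The linear term (m + 1) z d of the exponential cancels the z of the denominator up to O(1/m),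
     since d lies between 1/(m + 1) and 1/m. *)
  { replace (r - 1)%C with ((RtoC (m + 1) * (Cexp (z * RtoC d) - 1 - z * RtoC d)
      + z * RtoC ((m + 1) * d - 1)) / (z + RtoC (m + 1)))%C.
    2:{ unfold r; rewrite RtoC_minus, !RtoC_mult; field; assumption. }
    rewrite Cmod_div by assumption.
    apply Rmult_le_reg_r with (Cmod (z + RtoC (m + 1))); [lra|].
    unfold Rdiv; rewrite Rmult_assoc, Rinv_l, Rmult_1_r by lra.
    apply Rle_trans with ((2 * M + Cmod z) / m).
    - eapply Rle_trans; [apply Cmod_triangle|].
      rewrite !Cmod_mult, !Cmod_R, Rabs_pos_eq by lra.
      assert (A1 : (m + 1) * d <= 1 + / m).
      { apply Rle_trans with ((m + 1) * / m); [apply Rmult_le_compat_l; lra|right; field; lra]. }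
      assert (A2 : 1 <= (m + 1) * d).
      { apply Rle_trans with ((m + 1) * / (m + 1)); [right; field; lra|apply Rmult_le_compat_l; lra]. }
      assert (A3 : Rabs ((m + 1) * d - 1) <= / m) by (rewrite Rabs_pos_eq; lra).
      assert (A4 : Cmod (Cexp (z * RtoC d) - 1 - z * RtoC d) <= M * (/ m) ^ 2).
      { eapply Rle_trans; [apply T; lra|]. apply Rmult_le_compat_l; [assumption|].
        apply pow_incr; lra. }
      apply Rle_trans with (2 * m * (M * (/ m) ^ 2) + Cmod z * / m).
      + apply Rplus_le_compat; [|apply Rmult_le_compat_l; [apply Cmod_ge_0|assumption]].
        apply Rmult_le_compat; try lra; apply Cmod_ge_0.
      + right; field; lra.
    - apply Rle_trans with (K0 * / m ^ 2 * (m / 2)).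
      + right; unfold K0; field; lra.
      + apply Rmult_le_compat_l; [|assumption].
        apply Rmult_le_pos; [assumption|left; apply Rinv_0_lt_compat; nra]. }
  exists r; repeat split.
  - apply (Cmult_cancel_l _ _ _ Hden).
    transitivity (gauss_gamma_seq z (S n) * (z + RtoC (m + 1)))%C; [ring|].
    rewrite E; unfold r; field; assumption.
  - eapply Rle_trans; [exact R1|].
    replace (6 * K0 * (/ (m + 1) - / (m + 1 + 1))) with (6 * K0 / ((m + 1) * (m + 2)))
      by (field; lra).
    unfold Rdiv; rewrite (Rmult_comm 6), Rmult_assoc; apply Rmult_le_compat_l; [assumption|].
    apply Rmult_le_reg_r with (m ^ 2 * ((m + 1) * (m + 2))).
    { apply Rmult_lt_0_compat; nra. }
    replace (/ m ^ 2 * (m ^ 2 * ((m + 1) * (m + 2)))) with ((m + 1) * (m + 2)) by (field; lra).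
    replace (6 * / ((m + 1) * (m + 2)) * (m ^ 2 * ((m + 1) * (m + 2)))) with (6 * m ^ 2)
      by (field; lra).
    nra.
  - assert (K0 / m ^ 2 <= / 2).
    { apply Rmult_le_reg_r with (m ^ 2); [nra|].
      unfold Rdiv; rewrite Rmult_assoc, Rinv_l by nra. pose proof (Cmod_ge_0 z); nra. }
    assert (1 <= Cmod r + Cmod (r - 1)).
    { apply Rle_trans with (Cmod 1); [rewrite Cmod_1; lra|].
      replace (RtoC 1) with (r + - (r - 1))%C at 1 by ring.
      rewrite <- (Cmod_opp (r - 1)); apply Cmod_triangle. }
    lra.
Qed.

(** The limit is nonzero because the reciprocals converge as well: the two limits have product 1. *)
Lemma gauss_gamma_lim (z : C) : Im z <> 0 ->
  Cis_lim (gauss_gamma_seq z) (Gamma z) /\ Gamma z <> RtoC 0.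
Proof.
  intros Hz; destruct (gauss_gamma_ratio z Hz) as (K & N & HK & H).
  assert (L1 : exists l, Cis_lim (gauss_gamma_seq z) l).
  { apply (ex_Clim_product _ K N HK); intros n Hn.
    destruct (H n Hn) as (_ & r & E & B & _).
    replace (gauss_gamma_seq z (S n) - gauss_gamma_seq z n)%C
      with (gauss_gamma_seq z n * (r - 1))%C by (rewrite E; ring).
    rewrite Cmod_mult; apply Rmult_le_compat_l; [apply Cmod_ge_0|assumption]. }
  (* The reciprocals have ratio 1/r, and 1/r - 1 = - (r - 1) / r is at most twice as large as r - 1
     because |r| >= 1/2. *)
  assert (L2 : exists l, Cis_lim (fun n => / gauss_gamma_seq z n)%C l).
  { apply (ex_Clim_product _ (2 * K) N); [lra|]; intros n Hn.
    destruct (H n Hn) as (_ & r & E & B & Hr).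
    assert (Nr : r <> 0%C) by (intros E0; rewrite E0, Cmod_0 in Hr; lra).
    pose proof (gauss_gamma_neq_0 z n Hz) as N0.
    replace (/ gauss_gamma_seq z (S n) - / gauss_gamma_seq z n)%C
      with (/ gauss_gamma_seq z n * (- (r - 1) / r))%C by (rewrite E; field; now split).
    rewrite Cmod_mult; apply Rmult_le_compat_l; [apply Cmod_ge_0|].
    rewrite Cmod_div, Cmod_opp by assumption.
    apply Rmult_le_reg_r with (Cmod r); [lra|].
    unfold Rdiv; rewrite Rmult_assoc, Rinv_l, Rmult_1_r by lra.
    pose proof (Cmod_ge_0 (r - 1)).
    eapply Rle_trans; [exact B|]; nra. }
  destruct L1 as [l Hl], L2 as [l' Hl'].
  assert (E : Gamma z = l).
  { destruct Hl as [Hl1 Hl2]; apply injective_projections; unfold Gamma; cbn [fst snd].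
    - now rewrite (is_lim_seq_unique _ _ Hl1).
    - now rewrite (is_lim_seq_unique _ _ Hl2). }
  rewrite E; split; [assumption|].
  intros E0; apply C1_nz.
  transitivity (l * l')%C; [|rewrite E0; ring].
  apply (Cis_lim_unique (fun n => gauss_gamma_seq z n * / gauss_gamma_seq z n)%C).
  - eapply Cis_lim_ext; [|apply (Cis_lim_const (RtoC 1))].
    intros n; simpl; rewrite Cinv_r; [reflexivity|now apply gauss_gamma_neq_0].
  - now apply Cis_lim_mult.
Qed.

(** Iterates [hypB_succ], using t (t + 1) - nu (nu + 1) = (t + 1 + nu) (t - nu) with t = s + n. *)
Lemma hypB_rising (nu : R) (s : C) (n : nat) : Im s <> 0 -> 0 <= Re s ->
  (hypB (nu * (nu + 1)) s * (rising_factorial s n * rising_factorial (1 + s) n)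
   = hypB (nu * (nu + 1)) (s + RtoC (INR n))
     * (rising_factorial (1 + s + RtoC nu) n * rising_factorial (s - RtoC nu) n))%C.
Proof.
  intros H Hs; induction n as [|n IH].
  - simpl; replace (s + 0)%C with s by ring; ring.
  - cbn [rising_factorial].
    assert (Hn : Im (s + RtoC (INR n))%C <> 0) by (rewrite Im_plus, Im_RtoC; lra).
    assert (Hn' : 0 <= Re (s + RtoC (INR n))%C).
    { rewrite Re_plus, Re_RtoC; pose proof (pos_INR n); lra. }
    pose proof (hypB_succ (nu * (nu + 1)) _ Hn Hn') as E.
    rewrite S_INR, RtoC_plus.
    replace (s + (RtoC (INR n) + 1))%C with (s + RtoC (INR n) + 1)%C by ring.
    set (B := hypB (nu * (nu + 1)) s) in *.
    set (B1 := hypB (nu * (nu + 1)) (s + RtoC (INR n) + 1)) in *.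
    set (B0 := hypB (nu * (nu + 1)) (s + RtoC (INR n))) in *.
    set (x := rising_factorial s n) in *. set (y := rising_factorial (1 + s) n) in *.
    transitivity ((B * (x * y)) * ((s + RtoC (INR n)) * (1 + s + RtoC (INR n))))%C; [ring|].
    rewrite IH.
    set (x' := rising_factorial (1 + s + RtoC nu) n) in *.
    set (y' := rising_factorial (s - RtoC nu) n) in *.
    transitivity ((x' * y') * (B0 * ((s + RtoC (INR n)) * (s + RtoC (INR n) + 1))))%C; [ring|].
    rewrite <- E, RtoC_mult, RtoC_plus; ring.
Qed.

(** The shift is by [S n] because the n-th term of Gauss's sequence has n + 1 factors in its
    denominator. *)
Lemma hypB_lim (a : R) (s : C) : Im s <> 0 -> 0 <= Re s ->
  Cis_lim (fun n => hypB a (s + RtoC (INR (S n)))) (RtoC 1).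
Proof.
  intros H Hs.
  assert (L0 : is_lim_seq (fun n => Rabs a * / INR n) 0).
  { replace (Finite 0) with (Rbar_mult (Rabs a) 0) by (simpl; f_equal; ring).
    apply is_lim_seq_scal_l.
    replace (Finite 0) with (Rbar_inv p_infty) by reflexivity.
    apply is_lim_seq_inv; [apply is_lim_seq_INR|discriminate]. }
  (* From n = N on, the real part of s + n exceeds |a|, as [hypF_half_near_1] requires. *)
  destruct (INR_unbounded (Rabs a)) as [N HN].
  assert (L : Cis_lim (fun n => hypF a (s + RtoC (INR (n + N))) (1/2)) (RtoC 1)).
  { apply Cis_lim_Cmod with (fun n => 2 * (Rabs a * / INR (S (n + N)))).
    - intros n.
      assert (INR N <= INR (n + N)) by (apply le_INR; lia).
      pose proof (pos_INR N).
      assert (Hr : Re (s + RtoC (INR (n + N)))%C = Re s + INR (n + N)) by reflexivity.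
      eapply Rle_trans; [apply hypF_half_near_1|].
      + rewrite Im_plus, Im_RtoC; lra.
      + rewrite Hr; lra.
      + rewrite Hr; lra.
      + rewrite Hr; apply Rmult_le_compat_l; [lra|].
        apply Rmult_le_compat_l; [apply Rabs_pos|].
        rewrite S_INR; apply Rinv_le_contravar; lra.
    - replace (Finite 0) with (Rbar_mult 2 0) by (simpl; f_equal; ring).
      apply is_lim_seq_scal_l.
      apply (is_lim_seq_incr_n (fun n => Rabs a * / INR (S n)) N).
      now apply (is_lim_seq_incr_1 (fun n => Rabs a * / INR n)). }
  assert (L' : Cis_lim (fun n => hypF a (s + RtoC (INR n)) (1/2)) (RtoC 1)).
  { destruct L as [L1 L2]; split; now apply (is_lim_seq_incr_n _ N). }
  replace (RtoC 1) with (RtoC 1 * RtoC 1)%C by ring.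
  apply Cis_lim_ext with (fun n => hypF a (s + RtoC (INR (S n))) (1/2)
     * hypF a (s + RtoC (INR n)) (1/2))%C.
  - intros n; rewrite S_INR, RtoC_plus.
    replace (s + (RtoC (INR n) + 1))%C with (s + RtoC (INR n) + 1)%C by ring.
    rewrite hypB_succ_prod; [reflexivity| |].
    + rewrite Im_plus, Im_RtoC; lra.
    + rewrite Re_plus, Re_RtoC; pose proof (pos_INR n); lra.
  - apply Cis_lim_mult; [|assumption].
    destruct L' as [L1 L2]; split.
    + now apply (is_lim_seq_incr_1 (fun n => Re (hypF a (s + RtoC (INR n)) (1/2)))).
    + now apply (is_lim_seq_incr_1 (fun n => Im (hypF a (s + RtoC (INR n)) (1/2)))).
Qed.

Lemma hypB_Gamma (nu : R) (s : C) : Im s <> 0 -> 0 <= Re s ->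
  hypB (nu * (nu + 1)) s
  = (Gamma (1 + s) * Gamma s / (Gamma (1 + s + RtoC nu) * Gamma (s - RtoC nu)))%C.
Proof.
  intros H Hs.
  assert (H1 : Im (1 + s)%C <> 0) by (rewrite Im_plus, Im_RtoC; lra).
  assert (H2 : Im (1 + s + RtoC nu)%C <> 0) by (rewrite !Im_plus, !Im_RtoC; lra).
  assert (H3 : Im (s - RtoC nu)%C <> 0) by (simpl; unfold Im in H; lra).
  destruct (gauss_gamma_lim _ H) as [L0 _].
  destruct (gauss_gamma_lim _ H1) as [L1 _].
  destruct (gauss_gamma_lim _ H2) as [L2 N2].
  destruct (gauss_gamma_lim _ H3) as [L3 N3].
  set (B := hypB (nu * (nu + 1)) s).
  assert (E : (Gamma (1 + s) * Gamma s * 1 = B * (Gamma (1 + s + RtoC nu) * Gamma (s - RtoC nu)))%C).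
  { apply (Cis_lim_unique (fun n => gauss_gamma_seq (1 + s) n * gauss_gamma_seq s n
      * hypB (nu * (nu + 1)) (s + RtoC (INR (S n))))%C).
    - apply Cis_lim_mult; [now apply Cis_lim_mult|now apply hypB_lim].
    - apply Cis_lim_ext with (fun n => B * (gauss_gamma_seq (1 + s + RtoC nu) n
        * gauss_gamma_seq (s - RtoC nu) n))%C.
      2:{ apply Cis_lim_mult; [apply Cis_lim_const|now apply Cis_lim_mult]. }
      intros n; unfold gauss_gamma_seq.
      pose proof (hypB_rising nu s (S n) H Hs) as E; fold B in E.
      pose proof (rising_factorial_neq_0 _ (S n) H) as R0.
      pose proof (rising_factorial_neq_0 _ (S n) H1) as R1.
      pose proof (rising_factorial_neq_0 _ (S n) H2) as R2.
      pose proof (rising_factorial_neq_0 _ (S n) H3) as R3.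
      set (l := RtoC (ln (INR n))).
      (* Both pairs of Gamma arguments have the sum 1 + 2 s, so the powers of n cancel, as do the
         factorials. *)
      assert (X : (Cexp ((1 + s + RtoC nu) * l) * Cexp ((s - RtoC nu) * l)
                   = Cexp ((1 + s) * l) * Cexp (s * l))%C).
      { rewrite <- !Cexp_plus; f_equal; ring. }
      set (b := hypB (nu * (nu + 1)) (s + RtoC (INR (S n)))) in *.
      set (r0 := rising_factorial s (S n)) in *.
      set (r1 := rising_factorial (1 + s) (S n)) in *.
      set (r2 := rising_factorial (1 + s + RtoC nu) (S n)) in *.
      set (r3 := rising_factorial (s - RtoC nu) (S n)) in *.
      set (f := RtoC (INR (fact n))).
      transitivity (f * f * (Cexp ((1 + s + RtoC nu) * l) * Cexp ((s - RtoC nu) * l))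
        * (B * (r0 * r1)) / (r0 * r1 * r2 * r3))%C; [field; now repeat split|].
      rewrite X, E; field; now repeat split. }
  replace (Gamma (1 + s) * Gamma s)%C with (Gamma (1 + s) * Gamma s * 1)%C by ring.
  rewrite E; field; now split.
Qed.


(** * The amplitude and the complete elliptic integral *)

(** This takes the place of integrating inequalities: to estimate a function by an integral, its
    difference with an explicit antiderivative is shown to be nonincreasing. *)
Lemma le_of_derive_nonpos (f df : R -> R) (a b : R) : a <= b ->
  (forall x, a <= x <= b -> is_derive f x (df x)) ->
  (forall x, a <= x <= b -> df x <= 0) -> f b <= f a.
Proof.
  intros Hab H1 H2.
  destruct (MVT_gen f a b df) as (c & Hc & E).
  - rewrite Rmin_left, Rmax_right by assumption; intros x Hx; apply H1; lra.
  - rewrite Rmin_left, Rmax_right by assumption; intros x Hx.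
    apply continuity_pt_filterlim, (ex_derive_continuous f); exists (df x); now apply H1.
  - rewrite Rmin_left, Rmax_right in Hc by assumption.
    specialize (H2 c Hc); nra.
Qed.

Lemma eq_of_derive_zero (f : R -> R) : (forall x, is_derive f x 0) -> forall a b, f a = f b.
Proof.
  intros H.
  assert (L : forall a b, a <= b -> f b <= f a).
  { intros a b Hab; apply le_of_derive_nonpos with (fun _ => 0); intros; try lra; apply H. }
  assert (G : forall a b, a <= b -> - f b <= - f a).
  { intros a b Hab; apply (le_of_derive_nonpos (fun x => - f x) (fun _ => - 0)); intros; try lra.
    apply (is_derive_opp (K := R_AbsRing) (V := R_NormedModule) f x 0), H. }
  intros a b; destruct (Rle_dec a b) as [l|l].
  - specialize (L a b l); specialize (G a b l); lra.
  - specialize (L b a ltac:(lra)); specialize (G b a ltac:(lra)); lra.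
Qed.

(** dn as a function of the amplitude; 1 / [dnphi] is the integrand of [ellipF]. *)
Definition dnphi (k phi : R) : R := sqrt (1 - k ^ 2 * sin phi ^ 2).

Lemma sin2_cos2_pow (x : R) : sin x ^ 2 + cos x ^ 2 = 1.
Proof. rewrite <- (sin2_cos2 x); unfold Rsqr; ring. Qed.

Lemma dnphi_sqr_pos (k phi : R) : 0 < k < 1 -> 0 < 1 - k ^ 2 * sin phi ^ 2.
Proof. intros Hk; pose proof (sin2_cos2_pow phi); nra. Qed.

Lemma dnphi_pos (k phi : R) : 0 < k < 1 -> 0 < dnphi k phi.
Proof. intros Hk; now apply sqrt_lt_R0, dnphi_sqr_pos. Qed.

Lemma dnphi_sqr (k phi : R) : 0 < k < 1 -> dnphi k phi ^ 2 = 1 - k ^ 2 * sin phi ^ 2.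
Proof. intros Hk; apply pow2_sqrt; left; now apply dnphi_sqr_pos. Qed.

Lemma dnphi_le_1 (k phi : R) : 0 < k < 1 -> dnphi k phi <= 1.
Proof.
  intros Hk; pose proof (dnphi_pos k phi Hk); pose proof (dnphi_sqr k phi Hk).
  pose proof (pow2_ge_0 (sin phi)); pose proof (pow2_ge_0 k); nra.
Qed.

Lemma is_derive_dnphi (k phi : R) : 0 < k < 1 ->
  is_derive (dnphi k) phi (- k ^ 2 * sin phi * cos phi / dnphi k phi).
Proof.
  intros Hk; pose proof (dnphi_sqr_pos k phi Hk) as P.
  pose proof (dnphi_pos k phi Hk) as P'.
  unfold dnphi in *; auto_derive.
  - replace (1 + - (k * (k * 1) * (sin phi * (sin phi * 1)))) with (1 - k ^ 2 * sin phi ^ 2) by ring.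
    assumption.
  - replace (1 + - (k * (k * 1) * (sin phi * (sin phi * 1)))) with (1 - k ^ 2 * sin phi ^ 2) by ring.
    field; lra.
Qed.

Lemma is_derive_ellipF (k phi : R) : 0 < k < 1 ->
  is_derive (fun phi => ellipF phi k) phi (1 / dnphi k phi).
Proof.
  intros Hk.
  assert (C : forall x, continuous (fun x => 1 / dnphi k x) x).
  { intros x; apply (ex_derive_continuous (fun x => 1 / dnphi k x)).
    auto_derive; split; [|split; [|trivial]].
    - exists (- k ^ 2 * sin x * cos x / dnphi k x); now apply is_derive_dnphi.
    - pose proof (dnphi_pos k x Hk); lra. }
  apply (is_derive_RInt (fun x => 1 / dnphi k x) _ 0).
  - apply filter_forall; intros b.
    apply (RInt_correct (fun x => 1 / dnphi k x)), ex_RInt_continuous; intros; apply C.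
  - apply C.
Qed.

(** The integrand is at least 1. This one inequality gives injectivity and surjectivity of F, and
    the Lipschitz constant 1 of the amplitude. *)
Lemma ellipF_expanding (k phi psi : R) : 0 < k < 1 -> phi <= psi ->
  psi - phi <= ellipF psi k - ellipF phi k.
Proof.
  intros Hk H.
  enough (psi - ellipF psi k <= phi - ellipF phi k) by lra.
  apply (le_of_derive_nonpos (fun x => x - ellipF x k) (fun x => 1 - 1 / dnphi k x)); [assumption| |].
  - intros x _; apply (is_derive_minus (K := R_AbsRing) (V := R_NormedModule) (fun x => x)).
    + apply (is_derive_id (K := R_AbsRing)).
    + now apply is_derive_ellipF.
  - intros x _; pose proof (dnphi_pos k x Hk); pose proof (dnphi_le_1 k x Hk).
    assert (1 <= 1 / dnphi k x); [|lra].
    apply Rmult_le_reg_r with (dnphi k x); [assumption|]; field_simplify; lra.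
Qed.

Lemma ellipF_0 (k : R) : ellipF 0 k = 0.
Proof. apply (RInt_point (V := R_CompleteNormedModule)). Qed.

Lemma ellipF_inj (k phi psi : R) : 0 < k < 1 -> ellipF phi k = ellipF psi k -> phi = psi.
Proof.
  intros Hk E; destruct (Rle_dec phi psi) as [l|l].
  - pose proof (ellipF_expanding k phi psi Hk l); lra.
  - pose proof (ellipF_expanding k psi phi Hk ltac:(lra)); lra.
Qed.

Lemma ellipF_surj (k t : R) : 0 < k < 1 -> exists phi, ellipF phi k = t.
Proof.
  intros Hk.
  assert (C : continuity (fun phi => ellipF phi k)).
  { intros x; apply continuity_pt_filterlim, (ex_derive_continuous (fun phi => ellipF phi k)).
    exists (1 / dnphi k x); now apply is_derive_ellipF. }
  pose proof (ellipF_expanding k 0 (Rabs t) Hk (Rabs_pos t)) as H1.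
  pose proof (ellipF_expanding k (- Rabs t) 0 Hk ltac:(pose proof (Rabs_pos t); lra)) as H2.
  rewrite ellipF_0 in H1, H2.
  pose proof (Rabs_pos t).
  assert (B : - Rabs t <= t <= Rabs t) by (apply Rabs_le_between; lra).
  destruct (IVT_gen (fun phi => ellipF phi k) (- Rabs t) (Rabs t) t C) as (x & _ & E).
  - rewrite Rmin_left, Rmax_right by lra; lra.
  - now exists x.
Qed.

Lemma ellipF_am (k t : R) : 0 < k < 1 -> ellipF (jacobi_am t k) k = t.
Proof.
  intros Hk; unfold jacobi_am.
  apply (iota_correct (V := R_CompleteNormedModule) (fun phi => ellipF phi k = t)).
  destruct (ellipF_surj k t Hk) as [phi H]; exists phi; split; [assumption|].
  intros psi H'; apply ellipF_inj with k; [assumption|congruence].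
Qed.

Lemma am_eq (k t phi : R) : 0 < k < 1 -> ellipF phi k = t -> jacobi_am t k = phi.
Proof. intros Hk H; apply ellipF_inj with k; [assumption|]; now rewrite ellipF_am. Qed.

Lemma is_derive_am (k t : R) : 0 < k < 1 ->
  is_derive (fun t => jacobi_am t k) t (dnphi k (jacobi_am t k)).
Proof.
  intros Hk; apply is_derive_Reals.
  pose proof (is_derive_ellipF k (jacobi_am t k) Hk) as D.
  apply is_derive_Reals in D.
  pose proof (dnphi_pos k (jacobi_am t k) Hk) as P.
  pose proof (dnphi_le_1 k (jacobi_am t k) Hk) as P1.
  set (d := dnphi k (jacobi_am t k)) in *.
  intros eps Heps; destruct (D eps Heps) as [delta Hd].
  exists delta; intros h Hh Hhd.
  set (g := jacobi_am (t + h) k - jacobi_am t k).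
  assert (Eg : ellipF (jacobi_am t k + g) k = t + h).
  { unfold g; replace (jacobi_am t k + (jacobi_am (t + h) k - jacobi_am t k))
      with (jacobi_am (t + h) k) by ring; now apply ellipF_am. }
  pose proof (ellipF_am k t Hk) as E0.
  assert (Hg0 : g <> 0).
  { intros E; rewrite E, Rplus_0_r in Eg; lra. }
  assert (Hgh : Rabs g <= Rabs h).
  { destruct (Rle_dec 0 g) as [l|l].
    - pose proof (ellipF_expanding k (jacobi_am t k) (jacobi_am t k + g) Hk ltac:(lra)).
      rewrite !Rabs_pos_eq; lra.
    - pose proof (ellipF_expanding k (jacobi_am t k + g) (jacobi_am t k) Hk ltac:(lra)).
      rewrite !Rabs_left; lra. }
  specialize (Hd g Hg0 ltac:(lra)).
  rewrite Eg, E0 in Hd.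
  replace (t + h - t) with h in Hd by ring.
  (* The second factor has absolute value at most 1, since |g| <= |h| and d <= 1, so the [delta] for
     the derivative of F serves for its inverse. *)
  replace (g / h - d) with ((h / g - 1 / d) * (- (g / h * d))) by (field; repeat split; lra).
  rewrite Rabs_mult, Rabs_Ropp, Rabs_mult, Rabs_div, (Rabs_pos_eq d) by lra.
  assert (0 < Rabs h) by now apply Rabs_pos_lt.
  assert (0 < Rabs g) by now apply Rabs_pos_lt.
  assert (Q : 0 < Rabs g / Rabs h <= 1).
  { split; [now apply Rdiv_lt_0_compat|].
    apply Rmult_le_reg_r with (Rabs h); [assumption|]; field_simplify; lra. }
  assert (0 < Rabs g / Rabs h * d <= 1) by nra.
  pose proof (Rabs_pos (h / g - 1 / d)); nra.
Qed.

Lemma ellipF_odd (k phi : R) : 0 < k < 1 -> ellipF (- phi) k = - ellipF phi k.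
Proof.
  intros Hk.
  enough (ellipF phi k + ellipF (- phi) k = ellipF 0 k + ellipF (- 0) k) as E.
  { rewrite Ropp_0, !ellipF_0 in E; lra. }
  apply (eq_of_derive_zero (fun phi => ellipF phi k + ellipF (- phi) k)).
  intros x; replace 0 with (1 / dnphi k x + -1 * (1 / dnphi k (- x))).
  - apply (is_derive_plus (K := R_AbsRing) (V := R_NormedModule) (fun x => ellipF x k)).
    + now apply is_derive_ellipF.
    + apply (is_derive_comp (K := R_AbsRing) (V := R_NormedModule) (fun x => ellipF x k) Ropp).
      * now apply is_derive_ellipF.
      * auto_derive; [trivial|ring].
  - unfold dnphi; rewrite sin_neg; replace ((- sin x) ^ 2) with (sin x ^ 2) by ring; ring.
Qed.

(** F(phi + pi) - F(phi) has derivative 0; its value is read off at phi = - pi/2 by oddness. *)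
Lemma ellipF_plus_PI (k phi : R) : 0 < k < 1 ->
  ellipF (phi + PI) k = ellipF phi k + 2 * ellipF (PI / 2) k.
Proof.
  intros Hk.
  enough (ellipF (phi + PI) k - ellipF phi k
    = ellipF (- (PI / 2) + PI) k - ellipF (- (PI / 2)) k) as E.
  { rewrite ellipF_odd in E by assumption.
    replace (- (PI / 2) + PI) with (PI / 2) in E by field; lra. }
  apply (eq_of_derive_zero (fun phi => ellipF (phi + PI) k - ellipF phi k)).
  intros x; replace 0 with (1 * (1 / dnphi k (x + PI)) - 1 / dnphi k x).
  - apply (is_derive_minus (K := R_AbsRing) (V := R_NormedModule) (fun x => ellipF (x + PI) k)).
    + apply (is_derive_comp (K := R_AbsRing) (V := R_NormedModule) (fun x => ellipF x k) (fun x => x + PI)).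
      * now apply is_derive_ellipF.
      * auto_derive; [trivial|ring].
    + now apply is_derive_ellipF.
  - unfold dnphi; rewrite neg_sin; replace ((- sin x) ^ 2) with (sin x ^ 2) by ring; ring.
Qed.

Lemma is_derive_asin (x : R) : -1 < x < 1 -> is_derive asin x (1 / sqrt (1 - x ^ 2)).
Proof.
  intros Hx; apply is_derive_Reals.
  apply derive_pt_eq_1 with (derivable_pt_asin x Hx).
  rewrite derive_pt_asin; do 3 f_equal; unfold Rsqr; ring.
Qed.

Lemma one_minus_kx_pos (k x : R) : 0 < k < 1 -> -1 < x < 1 -> 0 < 1 - k ^ 2 * x ^ 2.
Proof.
  intros Hk Hx; assert (0 < k ^ 2 < 1) by nra; assert (0 <= x ^ 2 < 1) by nra; nra.
Qed.

Lemma is_derive_ellipF_asin (k x : R) : 0 < k < 1 -> -1 < x < 1 ->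
  is_derive (fun x => ellipF (asin x) k) x (1 / (sqrt (1 - x ^ 2) * sqrt (1 - k ^ 2 * x ^ 2))).
Proof.
  intros Hk Hx.
  assert (0 < sqrt (1 - x ^ 2)) by (apply sqrt_lt_R0; nra).
  assert (0 < sqrt (1 - k ^ 2 * x ^ 2)) by (apply sqrt_lt_R0, one_minus_kx_pos; assumption).
  replace (1 / (sqrt (1 - x ^ 2) * sqrt (1 - k ^ 2 * x ^ 2)))
    with (1 / sqrt (1 - x ^ 2) * (1 / dnphi k (asin x))).
  - apply (is_derive_comp (K := R_AbsRing) (V := R_NormedModule) (fun x => ellipF x k) asin).
    + now apply is_derive_ellipF.
    + now apply is_derive_asin.
  - unfold dnphi; rewrite sin_asin by lra; field; split; lra.
Qed.

(** The substitution t = sin theta gives the antiderivative F(asin t), differentiable only inside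
    (-1, 1); the endpoint is reached by continuity of F at pi/2. *)
Lemma ellipK_eq (k : R) : 0 < k < 1 -> ellipK k = ellipF (PI / 2) k.
Proof.
  intros Hk; unfold ellipK.
  pose proof PI_RGT_0 as Hpi.
  apply (is_RInt_gen_unique (V := R_CompleteNormedModule) _).
  intros P HP.
  assert (C : continuous (fun phi => ellipF phi k) (PI / 2)).
  { apply (ex_derive_continuous (fun phi => ellipF phi k)).
    exists (1 / dnphi k (PI / 2)); now apply is_derive_ellipF. }
  destruct (C P HP) as [e He].
  pose proof (cond_pos e) as He0.
  (* For sin phi < y < 1 the value asin y lies in (phi, pi/2), hence within [e] of pi/2; the maximum
     with 0 keeps y positive. *)
  set (phi := Rmax 0 (PI / 2 - e / 2)).
  assert (Hphi : 0 <= phi < PI / 2 /\ PI / 2 - phi < e).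
  { unfold phi; destruct (Rle_dec 0 (PI / 2 - e / 2)).
    - rewrite Rmax_right; lra.
    - rewrite Rmax_left; lra. }
  apply (Filter_prod _ _ _ (fun x => x = 0) (fun y => sin phi < y < 1)).
  - reflexivity.
  - assert (Hs : sin phi < 1).
    { rewrite <- sin_PI2; apply sin_increasing_1; lra. }
    exists (mkposreal (1 - sin phi) ltac:(lra)); intros y Hy Hy1.
    unfold ball in Hy; simpl in Hy; unfold AbsRing_ball, abs, minus, plus, opp in Hy; simpl in Hy.
    apply Rabs_lt_between in Hy; lra.
  - intros x y -> [Hy1 Hy2]; cbn [fst snd].
    assert (H0 : 0 <= sin phi) by (apply sin_ge_0; lra).
    exists (ellipF (asin y) k); split.
    + replace (ellipF (asin y) k) with (ellipF (asin y) k - ellipF (asin 0) k)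
        by (rewrite asin_0, ellipF_0; ring).
      apply (is_RInt_derive (V := R_CompleteNormedModule) (fun x => ellipF (asin x) k)).
      * rewrite Rmin_left, Rmax_right by lra; intros x Hx.
        apply is_derive_ellipF_asin; [assumption|lra].
      * rewrite Rmin_left, Rmax_right by lra; intros x Hx.
        apply (ex_derive_continuous (fun t => 1 / (sqrt (1 - t ^ 2) * sqrt (1 - k ^ 2 * t ^ 2)))).
        assert (A : 0 < 1 - x ^ 2) by nra.
        assert (B : 0 < 1 - k ^ 2 * x ^ 2) by (apply one_minus_kx_pos; lra).
        pose proof (sqrt_lt_R0 _ A); pose proof (sqrt_lt_R0 _ B).
        auto_derive.
        replace (1 + - (x * (x * 1))) with (1 - x ^ 2) by ring.
        replace (1 + - (k * (k * 1) * (x * (x * 1)))) with (1 - k ^ 2 * x ^ 2) by ring.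
        repeat split; try assumption; nra.
    + apply He.
      pose proof (asin_bound_lt y ltac:(lra)).
      assert (phi < asin y).
      { apply Rnot_le_lt; intros L.
        pose proof (sin_incr_1 (asin y) phi ltac:(lra) ltac:(lra) ltac:(lra) ltac:(lra) L) as L'.
        rewrite sin_asin in L' by lra; lra. }
      unfold ball; simpl; unfold AbsRing_ball, abs, minus, plus, opp; simpl.
      apply Rabs_lt_between; lra.
Qed.

Lemma ellipK_pos (k : R) : 0 < k < 1 -> 0 < ellipK k.
Proof.
  intros Hk; rewrite ellipK_eq by assumption.
  pose proof PI_RGT_0.
  pose proof (ellipF_expanding k 0 (PI / 2) Hk ltac:(lra)) as E; rewrite ellipF_0 in E; lra.
Qed.

Lemma am_0 (k : R) : 0 < k < 1 -> jacobi_am 0 k = 0.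
Proof. intros Hk; apply am_eq; [assumption|apply ellipF_0]. Qed.

Lemma am_K (k : R) : 0 < k < 1 -> jacobi_am (ellipK k) k = PI / 2.
Proof. intros Hk; apply am_eq; [assumption|]; symmetry; now apply ellipK_eq. Qed.

Lemma am_plus_2K (k t : R) : 0 < k < 1 ->
  jacobi_am (t + 2 * ellipK k) k = jacobi_am t k + PI.
Proof.
  intros Hk; apply am_eq; [assumption|].
  now rewrite ellipF_plus_PI, ellipF_am, ellipK_eq.
Qed.

Lemma am_reflect (k t : R) : 0 < k < 1 ->
  jacobi_am (2 * ellipK k - t) k = PI - jacobi_am t k.
Proof.
  intros Hk; apply am_eq; [assumption|].
  replace (PI - jacobi_am t k) with (- jacobi_am t k + PI) by ring.
  rewrite ellipF_plus_PI, ellipF_odd, ellipF_am, ellipK_eq by assumption; ring.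
Qed.

Lemma am_range (k t : R) : 0 < k < 1 -> 0 <= t <= ellipK k -> 0 <= jacobi_am t k <= PI / 2.
Proof.
  intros Hk Ht; split; apply Rnot_lt_le; intros L.
  - pose proof (ellipF_expanding k _ _ Hk (Rlt_le _ _ L)) as E.
    rewrite ellipF_am, ellipF_0 in E by assumption; lra.
  - pose proof (ellipF_expanding k _ _ Hk (Rlt_le _ _ L)) as E.
    rewrite ellipF_am, <- ellipK_eq in E by assumption; lra.
Qed.

Definition jacobi_cn (t k : R) : R := cos (jacobi_am t k).
Definition jacobi_dn (t k : R) : R := dnphi k (jacobi_am t k).

Lemma is_derive_sn (k t : R) : 0 < k < 1 ->
  is_derive (fun t => jacobi_sn t k) t (jacobi_cn t k * jacobi_dn t k).
Proof.
  intros Hk; unfold jacobi_sn, jacobi_cn, jacobi_dn; rewrite Rmult_comm.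
  apply (is_derive_comp (K := R_AbsRing) (V := R_NormedModule) sin).
  - apply is_derive_Reals, derivable_pt_lim_sin.
  - now apply is_derive_am.
Qed.

Lemma is_derive_cn (k t : R) : 0 < k < 1 ->
  is_derive (fun t => jacobi_cn t k) t (- jacobi_sn t k * jacobi_dn t k).
Proof.
  intros Hk; unfold jacobi_sn, jacobi_cn, jacobi_dn; rewrite Rmult_comm.
  apply (is_derive_comp (K := R_AbsRing) (V := R_NormedModule) cos).
  - apply is_derive_Reals, derivable_pt_lim_cos.
  - now apply is_derive_am.
Qed.

Lemma dn_pos (k t : R) : 0 < k < 1 -> 0 < jacobi_dn t k.
Proof. apply dnphi_pos. Qed.

Lemma dn_le_1 (k t : R) : 0 < k < 1 -> jacobi_dn t k <= 1.
Proof. apply dnphi_le_1. Qed.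

Lemma dn_sqr (k t : R) : 0 < k < 1 -> jacobi_dn t k ^ 2 = 1 - k ^ 2 * jacobi_sn t k ^ 2.
Proof. apply dnphi_sqr. Qed.

Lemma sn2_cn2 (k t : R) : jacobi_sn t k ^ 2 + jacobi_cn t k ^ 2 = 1.
Proof. apply sin2_cos2_pow. Qed.

Lemma is_derive_dn (k t : R) : 0 < k < 1 ->
  is_derive (fun t => jacobi_dn t k) t (- k ^ 2 * jacobi_sn t k * jacobi_cn t k).
Proof.
  intros Hk.
  replace (- k ^ 2 * jacobi_sn t k * jacobi_cn t k) with
    (jacobi_dn t k * (- k ^ 2 * jacobi_sn t k * jacobi_cn t k / jacobi_dn t k))
    by (pose proof (dn_pos k t Hk); field; lra).
  apply (is_derive_comp (K := R_AbsRing) (V := R_NormedModule) (dnphi k)).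
  - now apply is_derive_dnphi.
  - now apply is_derive_am.
Qed.

Lemma sn_ge_0 (k t : R) : 0 < k < 1 -> 0 <= t <= ellipK k -> 0 <= jacobi_sn t k.
Proof. intros Hk Ht; pose proof (am_range k t Hk Ht); pose proof PI_RGT_0; apply sin_ge_0; lra. Qed.

Lemma cn_ge_0 (k t : R) : 0 < k < 1 -> 0 <= t <= ellipK k -> 0 <= jacobi_cn t k.
Proof. intros Hk Ht; pose proof (am_range k t Hk Ht); pose proof PI_RGT_0; apply cos_ge_0; lra. Qed.

Lemma sn_sqr_plus_2K (k t : R) : 0 < k < 1 ->
  jacobi_sn (t + 2 * ellipK k) k ^ 2 = jacobi_sn t k ^ 2.
Proof. intros Hk; unfold jacobi_sn; rewrite am_plus_2K, neg_sin by assumption; ring. Qed.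

Lemma sn_reflect (k t : R) : 0 < k < 1 -> jacobi_sn (2 * ellipK k - t) k = jacobi_sn t k.
Proof. intros Hk; unfold jacobi_sn; rewrite am_reflect by assumption; apply sin_PI_x. Qed.

(** * Comparison with the hyperbolic limit *)

(** The identity behind it is dn^2 - k^2 cn^2 = 1 - k^2. *)
Lemma kcn_le_dn (k t : R) : 0 < k < 1 -> k * jacobi_cn t k < jacobi_dn t k.
Proof.
  intros Hk; pose proof (dn_pos k t Hk); pose proof (dn_sqr k t Hk); pose proof (sn2_cn2 k t).
  assert (0 < 1 - k ^ 2) by nra.
  apply Rnot_le_lt; intros L.
  assert (jacobi_dn t k ^ 2 <= (k * jacobi_cn t k) ^ 2) by (apply pow_incr; lra).
  nra.
Qed.

(* k sn <= tanh t *)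
Lemma ksn_le (k t : R) : 0 < k < 1 -> 0 <= t ->
  k * jacobi_sn t k <= 1 - 2 / (1 + exp (2 * t)).
Proof.
  intros Hk Ht.
  assert (B : forall x, -1 < k * jacobi_sn x k < 1).
  { intros x; pose proof (sn2_cn2 k x); pose proof (pow2_ge_0 (jacobi_cn x k)); split; nra. }
  (* The function compared is 2 artanh(k sn t) - 2 t, with derivative 2 k cn / dn - 2, negative by
     [kcn_le_dn]. *)
  assert (L : ln (1 + k * jacobi_sn t k) - ln (1 - k * jacobi_sn t k) - 2 * t
     <= ln (1 + k * jacobi_sn 0 k) - ln (1 - k * jacobi_sn 0 k) - 2 * 0).
  { apply (le_of_derive_nonpos (fun t => ln (1 + k * jacobi_sn t k) - ln (1 - k * jacobi_sn t k) - 2 * t)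
      (fun t => 2 * (k * jacobi_cn t k - jacobi_dn t k) / jacobi_dn t k)); [assumption| |].
    - intros x _; specialize (B x).
      pose proof (is_derive_sn k x Hk) as D.
      auto_derive.
      + repeat split; try lra; now exists (jacobi_cn x k * jacobi_dn x k).
      + replace (Derive _ x) with (jacobi_cn x k * jacobi_dn x k)
          by (symmetry; now apply is_derive_unique).
        pose proof (dn_pos k x Hk) as P; pose proof (dn_sqr k x Hk) as Q.
        transitivity (2 * k * jacobi_cn x k * jacobi_dn x k / jacobi_dn x k ^ 2 - 2).
        * rewrite Q; field; repeat split; nra.
        * field; lra.
    - intros x _; pose proof (kcn_le_dn k x Hk); pose proof (dn_pos k x Hk).
      apply Rmult_le_reg_r with (jacobi_dn x k); [assumption|].
      field_simplify; lra. }
  unfold jacobi_sn at 3 4 in L; rewrite am_0, sin_0, Rmult_0_r, Rplus_0_r, Rminus_0_r, ln_1 in L by assumption.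
  pose proof (B t) as Bt.
  set (v := k * jacobi_sn t k) in *.
  assert (E : 1 + v <= exp (2 * t) * (1 - v)).
  { rewrite <- (exp_ln (1 + v)), <- (exp_ln (1 - v)) at 1 by lra.
    rewrite <- exp_plus.
    assert (ln (1 + v) <= 2 * t + ln (1 - v)) as [H|H] by lra; [left; now apply exp_increasing|rewrite H; lra]. }
  pose proof (exp_pos (2 * t)).
  apply Rmult_le_reg_r with (1 + exp (2 * t)); [lra|].
  field_simplify; nra.
Qed.

Lemma dn_sqr_ge_sech (k t : R) : 0 < k < 1 -> 0 <= t <= ellipK k ->
  let x := 1 / (1 + exp (2 * t)) in 4 * (x * (1 - x)) <= jacobi_dn t k ^ 2.
Proof.
  intros Hk Ht x; rewrite dn_sqr by assumption.
  pose proof (ksn_le k t Hk (proj1 Ht)) as L.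
  pose proof (sn_ge_0 k t Hk Ht).
  replace (2 / (1 + exp (2 * t))) with (2 * x) in L
    by (unfold x; field; pose proof (exp_pos (2 * t)); lra).
  assert (0 <= k * jacobi_sn t k) by nra.
  replace (k ^ 2 * jacobi_sn t k ^ 2) with ((k * jacobi_sn t k) ^ 2) by ring; nra.
Qed.

(** One has dn (dn - cn) = k'^2 sn^2 dn / (dn + cn) <= k'^2. The point of the majorant is that cn dn
    is the derivative of sn. *)
Lemma dn_sqr_le (k t : R) : 0 < k < 1 -> 0 <= t <= ellipK k ->
  jacobi_dn t k ^ 2 <= jacobi_cn t k * jacobi_dn t k + (1 - k ^ 2).
Proof.
  intros Hk Ht; pose proof (cn_ge_0 k t Hk Ht) as C; pose proof (dn_pos k t Hk) as D.
  pose proof (dn_sqr k t Hk) as E; pose proof (sn2_cn2 k t) as E'.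
  set (c := jacobi_cn t k) in *; set (d := jacobi_dn t k) in *; set (s := jacobi_sn t k) in *.
  assert (0 < 1 - k ^ 2) by nra.
  apply Rmult_le_reg_r with (d + c); [lra|].
  enough (d * (d ^ 2 - c ^ 2) <= (1 - k ^ 2) * (d + c)) by nra.
  replace (d ^ 2 - c ^ 2) with ((1 - k ^ 2) * s ^ 2) by nra.
  assert (0 <= s ^ 2 <= 1) by (split; [apply pow2_ge_0|pose proof (pow2_ge_0 c); lra]).
  assert (d * s ^ 2 <= d + c) by nra.
  replace (d * ((1 - k ^ 2) * s ^ 2)) with ((1 - k ^ 2) * (d * s ^ 2)) by ring.
  apply Rmult_le_compat_l; lra.
Qed.

(* ln (1 + k sn) - ln (dn + k cn) matches t to leading order at both ends of
   [0, K]: its derivative is 1 - k'^2 dn / ((1 + k sn) (dn + k cn)). *)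
Lemma ellipK_bounds (k : R) : 0 < k < 1 ->
  2 * ln (1 + k) - ln (sqrt (1 - k ^ 2)) <= ellipK k /\
  k ^ 2 * ellipK k <= 2 * ln (1 + k) - ln (sqrt (1 - k ^ 2)).
Proof.
  intros Hk.
  set (H := fun t => ln (1 + k * jacobi_sn t k) - ln (jacobi_dn t k + k * jacobi_cn t k)).
  set (q := fun t => (1 - k ^ 2) * jacobi_dn t k
     / ((1 + k * jacobi_sn t k) * (jacobi_dn t k + k * jacobi_cn t k))).
  pose proof (ellipK_pos k Hk) as HK.
  assert (HD : forall t, 0 <= t <= ellipK k -> is_derive H t (1 - q t)).
  { intros t Ht; unfold H, q.
    pose proof (sn_ge_0 k t Hk Ht); pose proof (cn_ge_0 k t Hk Ht); pose proof (dn_pos k t Hk).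
    pose proof (is_derive_sn k t Hk) as D1.
    pose proof (is_derive_cn k t Hk) as D2.
    pose proof (is_derive_dn k t Hk) as D3.
    assert (0 <= k * jacobi_sn t k) by nra.
    assert (0 <= k * jacobi_cn t k) by nra.
    auto_derive.
    - repeat split; try lra; eexists; eassumption.
    - replace (Derive (fun x => jacobi_sn x k) t) with (jacobi_cn t k * jacobi_dn t k)
        by (symmetry; now apply is_derive_unique).
      replace (Derive (fun x => jacobi_cn x k) t) with (- jacobi_sn t k * jacobi_dn t k)
        by (symmetry; now apply is_derive_unique).
      replace (Derive (fun x => jacobi_dn x k) t) with (- k ^ 2 * jacobi_sn t k * jacobi_cn t k)
        by (symmetry; now apply is_derive_unique).
      pose proof (dn_sqr k t Hk) as Q; pose proof (sn2_cn2 k t) as Q'.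
      set (s := jacobi_sn t k) in *; set (c := jacobi_cn t k) in *; set (d := jacobi_dn t k) in *.
      apply Rmult_eq_reg_r with ((1 + k * s) * (d + k * c)); [|nra].
      transitivity (k * c * d * (d + k * c) + (1 + k * s) * (k ^ 2 * s * c + k * s * d)).
      + field; split; lra.
      + transitivity ((1 + k * s) * (d + k * c) - (1 - k ^ 2) * d); [|field; split; lra].
        assert (k * c * d ^ 2 = k * c * (1 - k ^ 2 * s ^ 2)) by now rewrite Q.
        assert (k ^ 2 * d * c ^ 2 = k ^ 2 * d * (1 - s ^ 2)) by (f_equal; lra).
        nra. }
  (* The upper bound uses dn <= dn + k cn and 1 + k sn >= 1. Hence the derivative of [H] lies
     between k^2 and 1, which gives the two inequalities. *)
  assert (Hq : forall t, 0 <= t <= ellipK k -> 0 <= q t <= 1 - k ^ 2).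
  { intros t Ht; unfold q.
    pose proof (sn_ge_0 k t Hk Ht); pose proof (cn_ge_0 k t Hk Ht); pose proof (dn_pos k t Hk).
    assert (0 <= k * jacobi_sn t k) by nra.
    assert (0 <= k * jacobi_cn t k) by nra.
    assert (0 < 1 - k ^ 2) by nra.
    assert (0 < (1 + k * jacobi_sn t k) * (jacobi_dn t k + k * jacobi_cn t k))
      by (apply Rmult_lt_0_compat; lra).
    split.
    - apply Rdiv_le_0_compat; nra.
    - apply Rmult_le_reg_r with ((1 + k * jacobi_sn t k) * (jacobi_dn t k + k * jacobi_cn t k));
        [assumption|].
      unfold Rdiv; rewrite Rmult_assoc, Rinv_l, Rmult_1_r by lra.
      apply Rmult_le_compat_l; nra. }
  assert (E0 : H 0 = - ln (1 + k)).
  { unfold H, jacobi_sn, jacobi_cn, jacobi_dn, dnphi; rewrite am_0, sin_0, cos_0 by assumption.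
    replace (1 - k ^ 2 * 0 ^ 2) with 1 by ring; rewrite sqrt_1, Rmult_0_r, Rplus_0_r, ln_1, Rmult_1_r.
    ring. }
  assert (E1 : H (ellipK k) = ln (1 + k) - ln (sqrt (1 - k ^ 2))).
  { unfold H, jacobi_sn, jacobi_cn, jacobi_dn, dnphi; rewrite am_K, sin_PI2, cos_PI2 by assumption.
    rewrite Rmult_0_r, Rplus_0_r, Rmult_1_r; do 3 f_equal; ring. }
  split.
  - assert (L : H (ellipK k) - ellipK k <= H 0 - 0).
    { apply (le_of_derive_nonpos (fun t => H t - t) (fun t => 1 - q t - 1)); [lra| |].
      - intros t Ht; apply (is_derive_minus (K := R_AbsRing) (V := R_NormedModule) H).
        + now apply HD.
        + apply (is_derive_id (K := R_AbsRing)).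
      - intros t Ht; destruct (Hq t Ht); lra. }
    lra.
  - assert (L : k ^ 2 * ellipK k - H (ellipK k) <= k ^ 2 * 0 - H 0).
    { apply (le_of_derive_nonpos (fun t => k ^ 2 * t - H t) (fun t => k ^ 2 - (1 - q t))); [lra| |].
      - intros t Ht; apply (is_derive_minus (K := R_AbsRing) (V := R_NormedModule) (fun t => k ^ 2 * t) H).
        + auto_derive; [trivial|ring].
        + now apply HD.
      - intros t Ht; destruct (Hq t Ht); lra. }
    lra.
Qed.


(** * Picard iteration for Hill's equation *)

(** The hypothesis of the Weierstrass M-test on every bounded interval. *)
Definition locally_summable (fn : nat -> R -> R) : Prop :=
  forall r : posreal, exists An : nat -> R, ex_series An /\
    forall n y, Rabs y < r -> Rabs (fn n y) <= An n.

Lemma ex_series_Un_cv (An : nat -> R) : ex_series An -> Un_cv (sum_f_R0 An) (Series An).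
Proof. intros H; now apply is_series_Reals, Series_correct. Qed.

Lemma locally_summable_CVN (fn : nat -> R -> R) (r : posreal) (An : nat -> R) :
  ex_series An -> (forall n y, Rabs y < r -> Rabs (fn n y) <= An n) -> CVN_r fn r.
Proof.
  intros H1 H2; exists An, (Series An); split.
  - apply Un_cv_ext with (sum_f_R0 An); [|now apply ex_series_Un_cv].
    intros n; apply sum_eq; intros i _; symmetry; apply Rabs_pos_eq.
    eapply Rle_trans; [apply Rabs_pos|apply (H2 i 0); rewrite Rabs_R0; apply cond_pos].
  - intros n y Hy; apply H2; unfold Boule in Hy; now rewrite Rminus_0_r in Hy.
Qed.

Lemma locally_summable_ex_series (fn : nat -> R -> R) (y : R) :
  locally_summable fn -> ex_series (fun n => fn n y).
Proof.
  intros H; destruct (H (mkposreal (Rabs y + 1) ltac:(pose proof (Rabs_pos y); lra))) as (An & H1 & H2).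
  apply (ex_series_le (V := R_CompleteNormedModule) _ An); [|assumption].
  intros n; apply H2; simpl; lra.
Qed.

Lemma is_derive_series (fn fn' : nat -> R -> R) (x : R) :
  (forall n t, is_derive (fn n) t (fn' n t)) -> (forall n t, continuous (fn' n) t) ->
  locally_summable fn -> locally_summable fn' ->
  is_derive (fun t => Series (fun n => fn n t)) x (Series (fun n => fn' n x)).
Proof.
  intros HD HC S S'; apply is_derive_Reals.
  destruct (S' (mkposreal (Rabs x + 1) ltac:(pose proof (Rabs_pos x); lra))) as (An & H1 & H2).
  destruct (CVN_CVU_r fn' _ (locally_summable_CVN _ _ _ H1 H2) x ltac:(simpl; lra)) as [e He].
  apply (derivable_pt_lim_CVU (fun N t => SP fn N t) (fun N t => SP fn' N t)
    (fun t => Series (fun n => fn n t)) (fun t => Series (fun n => fn' n t)) x x e).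
  - unfold Boule; rewrite Rminus_diag, Rabs_R0; apply cond_pos.
  - intros y n _; apply is_derive_Reals; induction n as [|n IH].
    + apply HD.
    + exact (is_derive_plus (K := R_AbsRing) (V := R_NormedModule) _ _ y _ _ IH (HD (Datatypes.S n) y)).
  - intros y _; apply (ex_series_Un_cv (fun n => fn n y)); now apply locally_summable_ex_series.
  - exact He.
  - intros y Hy; apply (CVU_continuity _ _ x e He); [|assumption].
    intros n z _; induction n as [|n IH].
    + apply continuity_pt_filterlim, HC.
    + apply (continuity_pt_plus (SP fn' n) (fn' (Datatypes.S n))); [exact IH|].
      apply continuity_pt_filterlim, HC.
Qed.

(** The majorant of [g] is the antiderivative, vanishing at 0, of the majorant of [g1]; both g and -
    g are compared with it. *)
Lemma power_majorant_half_line (g g1 : R -> R) (C M : R) (n : nat) : 0 <= M ->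
  (forall t, is_derive g t (g1 t)) -> g 0 = 0 ->
  (forall t, 0 <= t -> Rabs (g1 t) <= M * (C * ((M * t) ^ n / INR (fact n)))) ->
  forall t, 0 <= t -> Rabs (g t) <= C * ((M * t) ^ S n / INR (fact (S n))).
Proof.
  intros HM HD H0 HB t Ht.
  assert (P : forall x, is_derive (fun t => C * ((M * t) ^ S n / INR (fact (S n)))) x
     (M * (C * ((M * x) ^ n / INR (fact n))))).
  { intros x.
    pose proof (INR_fact_neq_0 n); assert (INR (S n) <> 0) by (apply not_0_INR; lia).
    rewrite fact_simpl, mult_INR.
    set (F := INR (S n)) in *; set (G := INR (fact n)) in *.
    auto_derive; [trivial|].
    change (match n with O => 1 | S _ => INR n + 1 end) with F.
    field; now split. }
  assert (Z : C * ((M * 0) ^ S n / INR (fact (S n))) = 0).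
  { rewrite Rmult_0_r, pow_ne_zero by lia; unfold Rdiv; ring. }
  apply Rabs_le; split.
  - enough (- g t - C * ((M * t) ^ S n / INR (fact (S n)))
       <= - g 0 - C * ((M * 0) ^ S n / INR (fact (S n)))) by lra.
    apply (le_of_derive_nonpos (fun t => - g t - C * ((M * t) ^ S n / INR (fact (S n))))
      (fun x => - g1 x - M * (C * ((M * x) ^ n / INR (fact n))))); [assumption| |].
    + intros x _; apply (is_derive_minus (K := R_AbsRing) (V := R_NormedModule) (fun t => - g t)); [|apply P].
      now apply (is_derive_opp (K := R_AbsRing) (V := R_NormedModule) g).
    + intros x Hx; specialize (HB x (proj1 Hx)); apply Rabs_le_between in HB; lra.
  - enough (g t - C * ((M * t) ^ S n / INR (fact (S n)))
       <= g 0 - C * ((M * 0) ^ S n / INR (fact (S n)))) by lra.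
    apply (le_of_derive_nonpos (fun t => g t - C * ((M * t) ^ S n / INR (fact (S n))))
      (fun x => g1 x - M * (C * ((M * x) ^ n / INR (fact n))))); [assumption| |].
    + intros x _; apply (is_derive_minus (K := R_AbsRing) (V := R_NormedModule) g); [|apply P].
      apply HD.
    + intros x Hx; specialize (HB x (proj1 Hx)); apply Rabs_le_between in HB; lra.
Qed.

Lemma power_majorant (g g1 : R -> R) (C M : R) (n : nat) : 0 <= M ->
  (forall t, is_derive g t (g1 t)) -> g 0 = 0 ->
  (forall t, Rabs (g1 t) <= M * (C * ((M * Rabs t) ^ n / INR (fact n)))) ->
  forall t, Rabs (g t) <= C * ((M * Rabs t) ^ S n / INR (fact (S n))).
Proof.
  intros HM HD H0 HB t; destruct (Rle_dec 0 t) as [l|l].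
  - rewrite (Rabs_pos_eq t) by assumption.
    apply (power_majorant_half_line g g1); try assumption.
    intros x Hx; specialize (HB x); now rewrite (Rabs_pos_eq x) in HB.
  - rewrite (Rabs_left t) by lra.
    replace (g t) with (g (- - t)) by (f_equal; ring).
    apply (power_majorant_half_line (fun t => g (- t)) (fun t => -1 * g1 (- t))); try lra.
    + intros x; apply (is_derive_comp (K := R_AbsRing) (V := R_NormedModule) g Ropp); [apply HD|].
      auto_derive; [trivial|ring].
    + now rewrite Ropp_0.
    + intros x Hx; specialize (HB (- x)).
      rewrite Rabs_Ropp, (Rabs_pos_eq x) in HB by assumption.
      rewrite Rabs_mult, (Rabs_left (-1)) by lra; lra.
Qed.

Lemma is_derive_RInt_0 (f : R -> R) (t : R) : (forall x, continuous f x) ->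
  is_derive (fun t => RInt f 0 t) t (f t).
Proof.
  intros Hf; apply (is_derive_RInt (V := R_NormedModule) f _ 0); [|apply Hf].
  apply filter_forall; intros b; apply (RInt_correct (V := R_CompleteNormedModule)).
  apply (ex_RInt_continuous (V := R_CompleteNormedModule)); intros; apply Hf.
Qed.

(** These are the terms, not the partial sums, of the Picard series for the system y' = z, z' = - q
    y. *)
Fixpoint picard (q : R -> R) (u v : R) (n : nat) : (R -> R) * (R -> R) :=
  match n with
  | O => (fun _ => u, fun _ => v)
  | S m => (fun t => RInt (snd (picard q u v m)) 0 t,
            fun t => RInt (fun s => - (q s * fst (picard q u v m) s)) 0 t)
  end.

Lemma picard_continuous (q : R -> R) (u v : R) (n : nat) : (forall t, continuous q t) ->
  forall t, continuous (fst (picard q u v n)) t /\ continuous (snd (picard q u v n)) t.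
Proof.
  intros Hq; induction n as [|n IH]; intros t.
  - split; apply continuous_const.
  - split; simpl.
    + apply (ex_derive_continuous (fun t => RInt (snd (picard q u v n)) 0 t)).
      eexists; apply is_derive_RInt_0; intros x; apply IH.
    + apply (ex_derive_continuous (fun t => RInt (fun s => - (q s * fst (picard q u v n) s)) 0 t)).
      eexists; apply (is_derive_RInt_0 (fun s => - (q s * fst (picard q u v n) s))); intros x.
      apply (continuous_opp (V := R_NormedModule) (fun s => q s * fst (picard q u v n) s)).
      apply (continuous_mult (K := R_AbsRing) q); [apply Hq|apply IH].
Qed.

(** [M] has to dominate both coefficients of the first-order system, namely 1 and q, hence 1 <=
    M. *)
Lemma picard_bound (q : R -> R) (u v M : R) : (forall t, continuous q t) ->
  1 <= M -> (forall t, Rabs (q t) <= M) -> forall n t,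
  Rabs (fst (picard q u v n) t) <= (Rabs u + Rabs v) * ((M * Rabs t) ^ n / INR (fact n)) /\
  Rabs (snd (picard q u v n) t) <= (Rabs u + Rabs v) * ((M * Rabs t) ^ n / INR (fact n)).
Proof.
  intros Hc HM Hq n; induction n as [|n IH]; intros t.
  - simpl; pose proof (Rabs_pos u); pose proof (Rabs_pos v); lra.
  - split.
    + apply (power_majorant _ (snd (picard q u v n))); [lra| | |].
      * intros x; apply is_derive_RInt_0; intros y; now apply picard_continuous.
      * apply (RInt_point (V := R_CompleteNormedModule)).
      * intros x; destruct (IH x) as [_ B].
        pose proof (Rabs_pos (snd (picard q u v n) x)); nra.
    + apply (power_majorant _ (fun s => - (q s * fst (picard q u v n) s))); [lra| | |].
      * intros x; apply (is_derive_RInt_0 (fun s => - (q s * fst (picard q u v n) s))); intros y.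
        apply (continuous_opp (V := R_NormedModule) (fun s => q s * fst (picard q u v n) s)).
        apply (continuous_mult (K := R_AbsRing) q); [apply Hc|now apply picard_continuous].
      * apply (RInt_point (V := R_CompleteNormedModule)).
      * intros x; destruct (IH x) as [B _].
        rewrite Rabs_Ropp, Rabs_mult.
        apply Rmult_le_compat; try apply Rabs_pos; auto.
Qed.

Lemma ex_series_exp (C x : R) : ex_series (fun n => C * (x ^ n / INR (fact n))).
Proof.
  apply (ex_series_scal (V := R_NormedModule) C (fun n => x ^ n / INR (fact n))).
  exists (exp x).
  apply is_series_ext with (fun n => scal (pow_n x n) (/ INR (fact n))).
  - intros n; rewrite pow_n_pow; unfold scal; simpl; unfold mult; simpl; unfold Rdiv; ring.
  - apply is_exp_Reals.
Qed.

(** Differentiating term n + 1 of one component gives term n of the other, and the constant term 0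
    gives 0: termwise derivatives are the other series, one index later. *)
Definition delayed (fn : nat -> R -> R) (n : nat) (t : R) : R :=
  match n with O => 0 | S m => fn m t end.

Lemma locally_summable_delayed (fn : nat -> R -> R) :
  locally_summable fn -> locally_summable (delayed fn).
Proof.
  intros H r; destruct (H r) as (An & H1 & H2).
  exists (fun n => match n with O => 0 | S m => An m end); split.
  - now apply ex_series_incr_1.
  - intros [|n] y Hy; simpl; [rewrite Rabs_R0; lra|now apply H2].
Qed.

Lemma Series_delayed (fn : nat -> R -> R) (t : R) : locally_summable fn ->
  Series (fun n => delayed fn n t) = Series (fun n => fn n t).
Proof.
  intros H; rewrite Series_incr_1.
  - simpl; ring.
  - now apply locally_summable_ex_series, locally_summable_delayed.
Qed.

Lemma locally_summable_exp (fn : nat -> R -> R) (C M : R) : 0 <= C -> 0 <= M ->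
  (forall n t, Rabs (fn n t) <= C * ((M * Rabs t) ^ n / INR (fact n))) -> locally_summable fn.
Proof.
  intros HC HM H r; exists (fun n => C * ((M * r) ^ n / INR (fact n))); split; [apply ex_series_exp|].
  intros n y Hy; eapply Rle_trans; [apply H|].
  apply Rmult_le_compat_l; [assumption|].
  apply Rmult_le_compat_r; [left; apply Rinv_0_lt_compat, INR_fact_lt_0|].
  apply pow_incr; split.
  - apply Rmult_le_pos; [assumption|apply Rabs_pos].
  - apply Rmult_le_compat_l; lra.
Qed.

Lemma hill_existence (q : R -> R) (M u v : R) : (forall t, continuous q t) ->
  1 <= M -> (forall t, Rabs (q t) <= M) ->
  exists w, hill_solution q w /\ w 0 = u /\ Derive w 0 = v.
Proof.
  intros Hc HM Hq.
  set (y := fun n t => fst (picard q u v n) t).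
  set (z := fun n t => snd (picard q u v n) t).
  pose proof (picard_bound q u v M Hc HM Hq) as B.
  assert (HC : 0 <= Rabs u + Rabs v) by (pose proof (Rabs_pos u); pose proof (Rabs_pos v); lra).
  assert (Sy : locally_summable y).
  { apply locally_summable_exp with (Rabs u + Rabs v) M; [assumption|lra|]; intros n t; apply B. }
  assert (Sz : locally_summable z).
  { apply locally_summable_exp with (Rabs u + Rabs v) M; [assumption|lra|]; intros n t; apply B. }
  assert (Sqy : locally_summable (fun n t => - (q t * y n t))).
  { apply locally_summable_exp with (M * (Rabs u + Rabs v)) M; [nra|lra|]; intros n t.
    rewrite Rabs_Ropp, Rabs_mult, Rmult_assoc.
    apply Rmult_le_compat; try apply Rabs_pos; [apply Hq|apply B]. }
  assert (Cy : forall n t, continuous (y n) t) by (intros; now apply picard_continuous).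
  assert (Cz : forall n t, continuous (z n) t) by (intros; now apply picard_continuous).
  assert (Cqy : forall n t, continuous (fun t => - (q t * y n t)) t).
  { intros n t; apply (continuous_opp (V := R_NormedModule) (fun s => q s * y n s)).
    apply (continuous_mult (K := R_AbsRing) q); [apply Hc|apply Cy]. }
  assert (DY : forall t, is_derive (fun t => Series (fun n => y n t)) t (Series (fun n => z n t))).
  { intros t; rewrite <- (Series_delayed z) by assumption.
    apply is_derive_series; [| |assumption|now apply locally_summable_delayed].
    - intros [|n] x; [apply (is_derive_const (K := R_AbsRing) (V := R_NormedModule) u x)|].
      apply is_derive_RInt_0, Cz.
    - intros [|n] x; [apply continuous_const|apply Cz]. }
  assert (DZ : forall t, is_derive (fun t => Series (fun n => z n t)) t
                 (- (q t * Series (fun n => y n t)))).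
  { intros t.
    replace (- (q t * Series (fun n => y n t)))
      with (Series (fun n => delayed (fun n t => - (q t * y n t)) n t)).
    2:{ rewrite Series_delayed by assumption.
        rewrite (Series_ext _ (fun n => - q t * y n t)) by (intros; ring).
        rewrite Series_scal_l; ring. }
    apply is_derive_series; [| |assumption|now apply locally_summable_delayed].
    - intros [|n] x; [apply (is_derive_const (K := R_AbsRing) (V := R_NormedModule) v x)|].
      apply (is_derive_RInt_0 (fun s => - (q s * y n s))), Cqy.
    - intros [|n] x; [apply continuous_const|apply Cqy]. }
  assert (I : forall fn : nat -> R -> R, (forall n, fn (S n) 0 = 0) -> locally_summable fn ->
     Series (fun n => fn n 0) = fn 0%nat 0).
  { intros fn H0 H1; rewrite Series_incr_1 by now apply locally_summable_ex_series.
    rewrite (Series_ext _ (fun n => 0 * 0)) by (intros n; rewrite H0; ring).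
    rewrite Series_scal_l; ring. }
  exists (fun t => Series (fun n => y n t)); split; [|split].
  - intros t; split; [eexists; apply DY|].
    apply (is_derive_ext (fun t => Series (fun n => z n t))); [|apply DZ].
    intros s; symmetry; apply is_derive_unique, DY.
  - apply I; [|assumption]; intros n; apply (RInt_point (V := R_CompleteNormedModule)).
  - etransitivity; [apply is_derive_unique, DY|].
    apply I; [|assumption]; intros n; apply (RInt_point (V := R_CompleteNormedModule)).
Qed.

(** * Wronskians and the discriminant *)

Definition wronskian (u v : R -> R) (t : R) : R := u t * Derive v t - Derive u t * v t.

Lemma hill_is_derive (q w : R -> R) (t : R) : hill_solution q w -> is_derive w t (Derive w t).
Proof. intros H; apply Derive_correct, (proj1 (H t)). Qed.

Lemma wronskian_const (q u v : R -> R) : hill_solution q u -> hill_solution q v ->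
  forall s t, wronskian u v s = wronskian u v t.
Proof.
  intros Hu Hv; apply eq_of_derive_zero; intros x; unfold wronskian.
  replace 0 with ((Derive u x * Derive v x + u x * - (q x * v x))
    - (- (q x * u x) * v x + Derive u x * Derive v x)) by ring.
  apply (is_derive_minus (K := R_AbsRing) (V := R_NormedModule)
    (fun t => u t * Derive v t) (fun t => Derive u t * v t)).
  - apply (is_derive_mult u (Derive v)); [now apply hill_is_derive with q|apply Hv|apply Rmult_comm].
  - apply (is_derive_mult (Derive u) v); [apply Hu|now apply hill_is_derive with q|apply Rmult_comm].
Qed.

Lemma hill_solution_of (q w w' : R -> R) :
  (forall t, is_derive w t (w' t)) -> (forall t, is_derive w' t (- (q t * w t))) ->
  hill_solution q w /\ forall t, Derive w t = w' t.
Proof.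
  intros H1 H2.
  assert (E : forall t, Derive w t = w' t) by (intros t; apply is_derive_unique, H1).
  split; [|exact E]; intros t; split; [eexists; apply H1|].
  apply (is_derive_ext w'); [intros s; symmetry; apply E|apply H2].
Qed.

Lemma hill_lincomb (q u v : R -> R) (a b : R) : hill_solution q u -> hill_solution q v ->
  hill_solution q (fun t => a * u t + b * v t) /\
  forall t, Derive (fun t => a * u t + b * v t) t = a * Derive u t + b * Derive v t.
Proof.
  intros Hu Hv; apply hill_solution_of; intros t.
  - apply (is_derive_plus (K := R_AbsRing) (V := R_NormedModule) (fun t => a * u t)).
    + apply (is_derive_scal u), (hill_is_derive q); assumption.
    + apply (is_derive_scal v), (hill_is_derive q); assumption.
  - replace (- (q t * (a * u t + b * v t))) with (a * - (q t * u t) + b * - (q t * v t)) by ring.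
    apply (is_derive_plus (K := R_AbsRing) (V := R_NormedModule) (fun t => a * Derive u t)).
    + apply (is_derive_scal (Derive u)), Hu.
    + apply (is_derive_scal (Derive v)), Hv.
Qed.

Lemma hill_shift (q w : R -> R) (sigma : R) : (forall t, q (t + sigma) = q t) ->
  hill_solution q w ->
  hill_solution q (fun t => w (t + sigma)) /\
  forall t, Derive (fun t => w (t + sigma)) t = Derive w (t + sigma).
Proof.
  intros Hq Hw; apply hill_solution_of; intros t.
  - replace (Derive w (t + sigma)) with (1 * Derive w (t + sigma)) by ring.
    apply (is_derive_comp (K := R_AbsRing) (V := R_NormedModule) w (fun t => t + sigma)).
    + now apply hill_is_derive with q.
    + auto_derive; [trivial|ring].
  - replace (- (q t * w (t + sigma))) with (1 * - (q (t + sigma) * w (t + sigma)))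
      by (rewrite Hq; ring).
    apply (is_derive_comp (K := R_AbsRing) (V := R_NormedModule) (Derive w) (fun t => t + sigma)).
    + apply Hw.
    + auto_derive; [trivial|ring].
Qed.

Lemma hill_reflect (q w : R -> R) (sigma : R) : (forall t, q (sigma - t) = q t) ->
  hill_solution q w ->
  hill_solution q (fun t => w (sigma - t)) /\
  forall t, Derive (fun t => w (sigma - t)) t = -1 * Derive w (sigma - t).
Proof.
  intros Hq Hw; apply (hill_solution_of q (fun t => w (sigma - t))
    (fun t => -1 * Derive w (sigma - t))); intros t.
  - apply (is_derive_comp (K := R_AbsRing) (V := R_NormedModule) w (fun t => sigma - t)).
    + now apply hill_is_derive with q.
    + auto_derive; [trivial|ring].
  - replace (- (q t * w (sigma - t))) with (-1 * (-1 * - (q (sigma - t) * w (sigma - t))))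
      by (rewrite Hq; ring).
    apply (is_derive_scal (fun t => Derive w (sigma - t))).
    apply (is_derive_comp (K := R_AbsRing) (V := R_NormedModule) (Derive w) (fun t => sigma - t)).
    + apply Hw.
    + auto_derive; [trivial|ring].
Qed.

Definition normalized_pair (q y1 y2 : R -> R) : Prop :=
  hill_solution q y1 /\ hill_solution q y2 /\
  y1 0 = 1 /\ Derive y1 0 = 0 /\ y2 0 = 0 /\ Derive y2 0 = 1.

(** Cramer's rule: the Wronskian of y1 and y2 is 1, and those of w with y1 and y2 are constant, so
    the coefficients are the initial data of w. This also gives uniqueness for the initial value
    problem. *)
Lemma normalized_expansion (q y1 y2 w : R -> R) : normalized_pair q y1 y2 ->
  hill_solution q w -> forall t, w t = w 0 * y1 t + Derive w 0 * y2 t.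
Proof.
  intros (H1 & H2 & A & B & C & D) Hw t.
  pose proof (wronskian_const q y1 y2 H1 H2 t 0) as W12.
  pose proof (wronskian_const q w y2 Hw H2 t 0) as W2.
  pose proof (wronskian_const q y1 w H1 Hw t 0) as W1.
  unfold wronskian in *; rewrite A, B, C, D in *.
  transitivity ((y1 t * Derive y2 t - Derive y1 t * y2 t) * w t); [rewrite W12; ring|].
  transitivity ((w t * Derive y2 t - Derive w t * y2 t) * y1 t
    + (y1 t * Derive w t - Derive y1 t * w t) * y2 t); [ring|].
  rewrite W1, W2; ring.
Qed.

Lemma normalized_hill_basis (q y1 y2 : R -> R) :
  normalized_pair q y1 y2 -> hill_basis q y1 y2.
Proof.
  intros H; pose proof H as (H1 & H2 & A & B & C & D).
  split; [assumption|split; [assumption|split]].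
  - intros a b E; destruct (hill_lincomb q y1 y2 a b H1 H2) as [_ E'].
    specialize (E' 0); rewrite (Derive_ext _ (fun _ => 0)), Derive_const in E' by exact E.
    specialize (E 0); rewrite A, C in E; rewrite B, D in E'; lra.
  - intros w Hw; exists (w 0), (Derive w 0); now apply normalized_expansion with q.
Qed.

(** Evaluating [iota] requires that the trace be the same in every basis, so an arbitrary basis is
    first compared with the normalized one. *)
Lemma hill_discriminant_trace (q y1 y2 : R -> R) (sigma : R) : normalized_pair q y1 y2 ->
  (forall t, q (t + sigma) = q t) ->
  hill_discriminant q sigma = y1 sigma + Derive y2 sigma.
Proof.
  intros N Hq; pose proof N as (H1 & H2 & A & B & C & D).
  destruct (hill_shift q y1 sigma Hq H1) as [S1 S1'].
  destruct (hill_shift q y2 sigma Hq H2) as [S2 S2'].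
  apply (iota_unique (V := R_CompleteNormedModule)
    (fun d => is_hill_discriminant q sigma d)).
  - intros d (w1 & w2 & a11 & a12 & a21 & a22 & (Hw1 & Hw2 & Hind & _) & E1 & E2 & ->).
    pose proof (normalized_expansion q y1 y2 w1 N Hw1) as X1.
    pose proof (normalized_expansion q y1 y2 w2 N Hw2) as X2.
    destruct (hill_lincomb q y1 y2 (w1 0) (Derive w1 0) H1 H2) as [_ Y1].
    destruct (hill_lincomb q y1 y2 (w2 0) (Derive w2 0) H1 H2) as [_ Y2].
    destruct (hill_lincomb q w1 w2 a11 a21 Hw1 Hw2) as [_ Z1].
    destruct (hill_lincomb q w1 w2 a12 a22 Hw1 Hw2) as [_ Z2].
    destruct (hill_shift q w1 sigma Hq Hw1) as [_ T1].
    destruct (hill_shift q w2 sigma Hq Hw2) as [_ T2].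
    assert (F1 : Derive w1 sigma = a11 * Derive w1 0 + a21 * Derive w2 0).
    { rewrite <- Z1, <- (Derive_ext _ _ 0 E1), T1; f_equal; ring. }
    assert (F2 : Derive w2 sigma = a12 * Derive w1 0 + a22 * Derive w2 0).
    { rewrite <- Z2, <- (Derive_ext _ _ 0 E2), T2; f_equal; ring. }
    assert (G1 : Derive w1 sigma = w1 0 * Derive y1 sigma + Derive w1 0 * Derive y2 sigma).
    { rewrite <- Y1; now apply Derive_ext. }
    assert (G2 : Derive w2 sigma = w2 0 * Derive y1 sigma + Derive w2 0 * Derive y2 sigma).
    { rewrite <- Y2; now apply Derive_ext. }
    pose proof (E1 0) as E1'; pose proof (E2 0) as E2'.
    rewrite Rplus_0_l in E1', E2'.
    pose proof (X1 sigma) as X1'; pose proof (X2 sigma) as X2'.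
    rewrite E1' in X1'; rewrite E2' in X2'; rewrite F1 in G1; rewrite F2 in G2.
    set (p11 := w1 0) in *; set (p12 := Derive w1 0) in *.
    set (p21 := w2 0) in *; set (p22 := Derive w2 0) in *.
    set (m11 := y1 sigma) in *; set (m21 := y2 sigma) in *.
    set (m12 := Derive y1 sigma) in *; set (m22 := Derive y2 sigma) in *.
    (* If this determinant vanished, the relations I1 and I2 would force all initial data to be 0 by
       independence, hence w1 = 0, a contradiction. *)
    assert (Hdet : p11 * p22 - p12 * p21 <> 0).
    { intros Hdet.
      assert (I1 : forall t, p21 * w1 t + - p11 * w2 t = 0).
      { intros t; rewrite X1, X2.
        transitivity (- (p11 * p22 - p12 * p21) * y2 t); [ring|rewrite Hdet; ring]. }
      assert (I2 : forall t, p22 * w1 t + - p12 * w2 t = 0).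
      { intros t; rewrite X1, X2.
        transitivity ((p11 * p22 - p12 * p21) * y1 t); [ring|rewrite Hdet; ring]. }
      destruct (Hind _ _ I1) as [P1 P2]; destruct (Hind _ _ I2) as [P3 P4].
      assert (I3 : forall t, 1 * w1 t + 0 * w2 t = 0).
      { intros t; rewrite X1; replace p11 with 0 by lra; replace p12 with 0 by lra; ring. }
      destruct (Hind _ _ I3); lra. }
    apply Rmult_eq_reg_r with (p11 * p22 - p12 * p21); [|assumption].
    (* With u_i = (w_i, w_i'), the middle term is det(u1(sigma), u2(0)) + det(u1(0), u2(sigma)),
       which equals the determinant at 0 times the trace, whichever of the two matrices describes
       the shift. *)
    transitivity ((a11 * p11 + a21 * p21) * p22 - (a11 * p12 + a21 * p22) * p21
      + p11 * (a12 * p12 + a22 * p22) - p12 * (a12 * p11 + a22 * p21)); [ring|].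
    rewrite X1', X2', G1, G2; ring.
  - exists y1, y2, (y1 sigma), (y2 sigma), (Derive y1 sigma), (Derive y2 sigma).
    split; [now apply normalized_hill_basis|].
    split; [|split; [|reflexivity]]; intros t.
    + rewrite (normalized_expansion q y1 y2 _ N S1 t), S1', Rplus_0_l; ring.
    + rewrite (normalized_expansion q y1 y2 _ N S2 t), S2', Rplus_0_l; ring.
Qed.

(** The reflected y1(2K - t) and y2(2K - t) are again solutions; their Wronskians with y2 and y1,
    taken at 0 and at K, show that y1(2K) and y2'(2K) both equal y1 y2' + y1' y2 at K. *)
Lemma hill_discriminant_half_period (q y1 y2 : R -> R) (K : R) : normalized_pair q y1 y2 ->
  (forall t, q (t + 2 * K) = q t) -> (forall t, q (2 * K - t) = q t) ->
  hill_discriminant q (2 * K) = 2 * (y1 K * Derive y2 K + Derive y1 K * y2 K).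
Proof.
  intros N Hq Hr; rewrite (hill_discriminant_trace q y1 y2) by assumption.
  pose proof N as (H1 & H2 & A & B & C & D).
  destruct (hill_reflect q y1 (2 * K) Hr H1) as [R1 R1'].
  destruct (hill_reflect q y2 (2 * K) Hr H2) as [R2 R2'].
  pose proof (wronskian_const q _ y2 R1 H2 0 K) as W1.
  pose proof (wronskian_const q y1 _ H1 R2 0 K) as W2.
  unfold wronskian in W1, W2.
  rewrite !R1' in W1; rewrite !R2' in W2.
  rewrite A, B, ?C, ?D in *; rewrite ?C, ?D in *.
  rewrite Rminus_0_r in *.
  replace (2 * K - K) with K in * by ring.
  lra.
Qed.


(** * Derivatives of complex functions of a real variable *)

Definition is_Cderive (u : R -> C) (t : R) (l : C) : Prop :=
  is_derive (fun t => Re (u t)) t (Re l) /\ is_derive (fun t => Im (u t)) t (Im l).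

Lemma is_Cderive_mult (u v : R -> C) (t : R) (l m : C) :
  is_Cderive u t l -> is_Cderive v t m ->
  is_Cderive (fun t => u t * v t)%C t (l * v t + u t * m)%C.
Proof.
  intros [U1 U2] [V1 V2]; split.
  - replace (Re (l * v t + u t * m)%C) with
      ((Re l * Re (v t) + Re (u t) * Re m) - (Im l * Im (v t) + Im (u t) * Im m))
      by (unfold Re, Im; simpl; ring).
    apply (is_derive_minus (K := R_AbsRing) (V := R_NormedModule)
      (fun t => Re (u t) * Re (v t)) (fun t => Im (u t) * Im (v t))).
    + apply (is_derive_mult (fun t => Re (u t)) (fun t => Re (v t)) t (Re l) (Re m));
        [assumption|assumption|apply Rmult_comm].
    + apply (is_derive_mult (fun t => Im (u t)) (fun t => Im (v t)) t (Im l) (Im m));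
        [assumption|assumption|apply Rmult_comm].
  - replace (Im (l * v t + u t * m)%C) with
      ((Re l * Im (v t) + Re (u t) * Im m) + (Im l * Re (v t) + Im (u t) * Re m))
      by (unfold Re, Im; simpl; ring).
    apply (is_derive_plus (K := R_AbsRing) (V := R_NormedModule)
      (fun t => Re (u t) * Im (v t)) (fun t => Im (u t) * Re (v t))).
    + apply (is_derive_mult (fun t => Re (u t)) (fun t => Im (v t)) t (Re l) (Im m));
        [assumption|assumption|apply Rmult_comm].
    + apply (is_derive_mult (fun t => Im (u t)) (fun t => Re (v t)) t (Im l) (Re m));
        [assumption|assumption|apply Rmult_comm].
Qed.

Lemma is_Cderive_plus (u v : R -> C) (t : R) (l m : C) :
  is_Cderive u t l -> is_Cderive v t m -> is_Cderive (fun t => u t + v t)%C t (l + m)%C.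
Proof.
  intros [U1 U2] [V1 V2]; split.
  - apply (is_derive_plus (K := R_AbsRing) (V := R_NormedModule)
      (fun t => Re (u t)) (fun t => Re (v t))); assumption.
  - apply (is_derive_plus (K := R_AbsRing) (V := R_NormedModule)
      (fun t => Im (u t)) (fun t => Im (v t))); assumption.
Qed.

Lemma is_Cderive_const (c : C) (t : R) : is_Cderive (fun _ => c) t (RtoC 0).
Proof. split; apply (is_derive_const (K := R_AbsRing) (V := R_NormedModule)). Qed.

Lemma is_Cderive_RtoC (f : R -> R) (t l : R) :
  is_derive f t l -> is_Cderive (fun t => RtoC (f t)) t (RtoC l).
Proof.
  intros H; split; [exact H|].
  apply (is_derive_const (K := R_AbsRing) (V := R_NormedModule) 0 t).
Qed.

Lemma is_Cderive_comp (u : R -> C) (x : R -> R) (t : R) (l : C) (dx : R) :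
  is_Cderive u (x t) l -> is_derive x t dx ->
  is_Cderive (fun t => u (x t)) t (RtoC dx * l)%C.
Proof.
  intros [U1 U2] X; split.
  - replace (Re (RtoC dx * l)%C) with (dx * Re l) by (unfold Re, Im; simpl; ring).
    now apply (is_derive_comp (K := R_AbsRing) (V := R_NormedModule) (fun t => Re (u t)) x).
  - replace (Im (RtoC dx * l)%C) with (dx * Im l) by (unfold Re, Im; simpl; ring).
    now apply (is_derive_comp (K := R_AbsRing) (V := R_NormedModule) (fun t => Im (u t)) x).
Qed.

Lemma is_Cderive_Cexp (z : C) (t : R) :
  is_Cderive (fun t => Cexp (z * RtoC t)) t (z * Cexp (z * RtoC t))%C.
Proof.
  destruct z as [a b].
  assert (E : forall t, Cexp ((a, b) * RtoC t)
    = (exp (a * t) * cos (b * t), exp (a * t) * sin (b * t))).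
  { intros x; unfold Cexp; simpl.
    replace (a * x - b * 0) with (a * x) by ring.
    replace (a * 0 + b * x) with (b * x) by ring.
    apply injective_projections; simpl; ring. }
  rewrite E; split.
  - apply (is_derive_ext (fun t => exp (a * t) * cos (b * t))); [intros x; now rewrite E|].
    unfold Re; simpl; auto_derive; [trivial|ring].
  - apply (is_derive_ext (fun t => exp (a * t) * sin (b * t))); [intros x; now rewrite E|].
    unfold Im; simpl; auto_derive; [trivial|ring].
Qed.

Lemma is_Cderive_CPS (c : nat -> C) (x : R) : unit_radius c -> Rabs x < 1 ->
  is_Cderive (CPS c) x (CPS (Cderive_coef c) x).
Proof. intros H Hx; split; [now apply is_derive_CPS_Re|now apply is_derive_CPS_Im]. Qed.

(** * The solution e^{-st} F(x(t)) of the limit equation *)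

(* 1 - 2 xi(t) = tanh t and 4 xi(t) (1 - xi(t)) = 1 / cosh^2 t *)
Definition xi (t : R) : R := 1 / (1 + exp (2 * t)).

Lemma xi_range (t : R) : 0 < xi t < 1.
Proof.
  unfold xi; pose proof (exp_pos (2 * t)); split.
  - apply Rdiv_lt_0_compat; lra.
  - apply Rmult_lt_reg_r with (1 + exp (2 * t)); [lra|]; field_simplify; lra.
Qed.

Lemma xi_0 : xi 0 = 1 / 2.
Proof. unfold xi; rewrite Rmult_0_r, exp_0; field. Qed.

Lemma xi_le_half (t : R) : 0 <= t -> xi t <= 1 / 2.
Proof.
  intros Ht; unfold xi; pose proof (exp_ineq1_le (2 * t)).
  apply Rmult_le_reg_r with (1 + exp (2 * t)); [lra|]; field_simplify; lra.
Qed.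

Lemma is_derive_xi (t : R) : is_derive xi t (-2 * (xi t * (1 - xi t))).
Proof.
  unfold xi; pose proof (exp_pos (2 * t)); auto_derive; [lra|field; lra].
Qed.

(** The f of the overview; in scattering terms it is the Jost solution of the sech^2 potential,
    asymptotic to e^{-st} as t tends to infinity. *)
Definition jost (a : R) (s : C) (t : R) : C :=
  (Cexp (- s * RtoC t) * hypF a s (xi t))%C.

Definition jost1 (a : R) (s : C) (t : R) : C :=
  (Cexp (- s * RtoC t)
   * (- s * hypF a s (xi t) + RtoC (-2 * (xi t * (1 - xi t))) * hypF1 a s (xi t)))%C.

Lemma xi_Rabs (t : R) : Rabs (xi t) < 1.
Proof. pose proof (xi_range t); rewrite Rabs_pos_eq; lra. Qed.

Lemma is_Cderive_jost (a : R) (s : C) (t : R) : Im s <> 0 -> 0 <= Re s ->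
  is_Cderive (jost a s) t (jost1 a s t).
Proof.
  intros H Hs; unfold jost1.
  replace (Cexp (- s * RtoC t) * (- s * hypF a s (xi t)
      + RtoC (-2 * (xi t * (1 - xi t))) * hypF1 a s (xi t)))%C
    with ((- s * Cexp (- s * RtoC t)) * hypF a s (xi t)
      + Cexp (- s * RtoC t) * (RtoC (-2 * (xi t * (1 - xi t))) * hypF1 a s (xi t)))%C by ring.
  apply (is_Cderive_mult (fun t => Cexp (- s * RtoC t)) (fun t => hypF a s (xi t))).
  - apply is_Cderive_Cexp.
  - apply is_Cderive_comp; [|apply is_derive_xi].
    apply is_Cderive_CPS; [now apply hyp_unit_radius|apply xi_Rabs].
Qed.

Lemma is_Cderive_jost1 (a : R) (s : C) (t : R) : Im s <> 0 -> 0 <= Re s ->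
  is_Cderive (jost1 a s) t ((s * s - RtoC (a * (4 * (xi t * (1 - xi t))))) * jost a s t)%C.
Proof.
  intros H Hs.
  pose proof (hyp_ode a s (xi t) H Hs (xi_Rabs t)) as O.
  pose proof (hyp_unit_radius a s H Hs) as G.
  pose proof (unit_radius_derive _ G) as G1.
  set (x := xi t) in *.
  set (X := -2 * (x * (1 - x))).
  assert (DX : is_derive (fun t => -2 * (xi t * (1 - xi t))) t ((-2 + 4 * x) * X)).
  { pose proof (is_derive_xi t) as D; auto_derive.
    - repeat split; eexists; apply D.
    - replace (Derive _ t) with (-2 * (xi t * (1 - xi t)))
        by (symmetry; now apply is_derive_unique).
      fold x; unfold X; ring. }
  replace ((s * s - RtoC (a * (4 * (x * (1 - x))))) * jost a s t)%C
    with ((- s * Cexp (- s * RtoC t)) * (- s * hypF a s x + RtoC X * hypF1 a s x)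
      + Cexp (- s * RtoC t) * ((RtoC 0 * hypF a s x + - s * (RtoC X * hypF1 a s x))
         + (RtoC ((-2 + 4 * x) * X) * hypF1 a s x + RtoC X * (RtoC X * hypF2 a s x))))%C.
  - unfold X, x; apply (is_Cderive_mult (fun t => Cexp (- s * RtoC t))
      (fun t => - s * hypF a s (xi t) + RtoC (-2 * (xi t * (1 - xi t))) * hypF1 a s (xi t))%C).
    + apply is_Cderive_Cexp.
    + apply (is_Cderive_plus (fun t => - s * hypF a s (xi t))%C
        (fun t => RtoC (-2 * (xi t * (1 - xi t))) * hypF1 a s (xi t))%C).
      * apply (is_Cderive_mult (fun _ => - s)%C (fun t => hypF a s (xi t))); [apply is_Cderive_const|].
        apply is_Cderive_comp; [|apply is_derive_xi].
        apply is_Cderive_CPS; [assumption|apply xi_Rabs].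
      * apply (is_Cderive_mult (fun t => RtoC (-2 * (xi t * (1 - xi t)))) (fun t => hypF1 a s (xi t))).
        -- now apply is_Cderive_RtoC.
        -- apply is_Cderive_comp; [|apply is_derive_xi].
           apply is_Cderive_CPS; [assumption|apply xi_Rabs].
  - unfold jost; fold x; unfold X.
    repeat rewrite ?RtoC_mult, ?RtoC_plus, ?RtoC_minus.
    repeat rewrite ?RtoC_mult, ?RtoC_plus, ?RtoC_minus in O.
    set (E := Cexp (- s * RtoC t)).
    set (F := hypF a s x) in *; set (F1 := hypF1 a s x) in *; set (F2 := hypF2 a s x) in *.
    (* The two sides differ by 4 x (1 - x) e^{-st} times the left side of the hypergeometric
       equation. *)
    match type of O with ?L = _ =>
      transitivity ((s * s - RtoC a * (4 * (RtoC x * (1 - RtoC x)))) * (E * F)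
         + 4 * (RtoC x * (1 - RtoC x)) * E * L)%C end; [ring|rewrite O; ring].
Qed.

Lemma bounded_on_segment (f : R -> R) (a b : R) : a <= b ->
  (forall x, a <= x <= b -> ex_derive f x) ->
  exists M, forall x, a <= x <= b -> Rabs (f x) <= M.
Proof.
  intros Hab H.
  destruct (continuity_ab_maj (fun x => Rabs (f x)) a b Hab) as (m & Hm & _).
  - intros x Hx; apply (continuity_pt_comp f Rabs); [|apply Rcontinuity_abs].
    now apply continuity_pt_filterlim, (ex_derive_continuous f), H.
  - exists (Rabs (f m)); exact Hm.
Qed.

Lemma CPS_bounded_half (c : nat -> C) : unit_radius c ->
  exists M, 0 <= M /\ forall x, 0 <= x <= 1/2 -> Cmod (CPS c x) <= M.
Proof.
  intros H.
  destruct (bounded_on_segment (fun x => Re (CPS c x)) 0 (1/2) ltac:(lra)) as [M1 B1].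
  { intros x Hx; eexists; apply is_derive_CPS_Re; [assumption|rewrite Rabs_pos_eq; lra]. }
  destruct (bounded_on_segment (fun x => Im (CPS c x)) 0 (1/2) ltac:(lra)) as [M2 B2].
  { intros x Hx; eexists; apply is_derive_CPS_Im; [assumption|rewrite Rabs_pos_eq; lra]. }
  exists (M1 + M2); split.
  - specialize (B1 0 ltac:(lra)); specialize (B2 0 ltac:(lra)).
    pose proof (Rabs_pos (Re (CPS c 0))); pose proof (Rabs_pos (Im (CPS c 0))); lra.
  - intros x Hx; eapply Rle_trans; [apply Cmod_le_Rabs|].
    specialize (B1 x Hx); specialize (B2 x Hx); lra.
Qed.

Lemma Rabs_diff_le_derive (f df : R -> R) (M x : R) : 0 <= x ->
  (forall y, 0 <= y <= x -> is_derive f y (df y)) ->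
  (forall y, 0 <= y <= x -> Rabs (df y) <= M) -> Rabs (f x - f 0) <= M * x.
Proof.
  intros Hx HD HB.
  destruct (MVT_gen f 0 x df) as (c & Hc & E).
  - rewrite Rmin_left, Rmax_right by assumption; intros y Hy; apply HD; lra.
  - rewrite Rmin_left, Rmax_right by assumption; intros y Hy.
    apply continuity_pt_filterlim, (ex_derive_continuous f); eexists; now apply HD.
  - rewrite Rmin_left, Rmax_right in Hc by assumption.
    rewrite E, Rminus_0_r, Rabs_mult, (Rabs_pos_eq x) by assumption.
    apply Rmult_le_compat_r; [assumption|now apply HB].
Qed.

(** Only x <= 1/2 occurs, because t >= 0, and there the singular point x = 1 is out of reach. The
    last bound controls the deviation from a pure exponential at t = K. *)
Lemma hyp_bounds (a : R) (s : C) : Im s <> 0 -> 0 <= Re s ->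
  exists M, 0 <= M /\ forall x, 0 <= x <= 1/2 ->
    Cmod (hypF a s x) <= M /\ Cmod (hypF1 a s x) <= M /\ Cmod (hypF a s x - 1)%C <= M * x.
Proof.
  intros H Hs.
  pose proof (hyp_unit_radius a s H Hs) as G.
  pose proof (unit_radius_derive _ G) as G1.
  destruct (CPS_bounded_half _ G) as (M0 & P0 & B0).
  destruct (CPS_bounded_half _ G1) as (M1 & P1 & B1).
  exists (M0 + 2 * M1); split; [lra|]; intros x Hx.
  split; [|split].
  - eapply Rle_trans; [now apply B0|lra].
  - eapply Rle_trans; [now apply B1|lra].
  - rewrite <- (hypF_0 a s).
    apply Rle_trans with (M1 * x + M1 * x); [|nra].
    eapply Rle_trans; [apply Cmod_le_Rabs|apply Rplus_le_compat].
    + apply (Rabs_diff_le_derive (fun x => Re (hypF a s x)) (fun x => Re (hypF1 a s x))); [lra| |].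
      * intros y Hy; apply is_derive_CPS_Re; [assumption|rewrite Rabs_pos_eq; lra].
      * intros y Hy; eapply Rle_trans; [apply Rabs_Re_le_Cmod|apply B1; lra].
    + apply (Rabs_diff_le_derive (fun x => Im (hypF a s x)) (fun x => Im (hypF1 a s x))); [lra| |].
      * intros y Hy; apply is_derive_CPS_Im; [assumption|rewrite Rabs_pos_eq; lra].
      * intros y Hy; eapply Rle_trans; [apply Rabs_Im_le_Cmod|apply B1; lra].
Qed.

(** * Solutions of Lame's equation on [0, K] *)

Lemma lame_potential_dn (h nu k t : R) : 0 < k < 1 ->
  lame_potential h nu k t = h - nu * (nu + 1) + nu * (nu + 1) * jacobi_dn t k ^ 2.
Proof. intros Hk; unfold lame_potential; rewrite dn_sqr by assumption; ring. Qed.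

Lemma lame_normalized_pair (h nu k : R) : 0 < k < 1 ->
  exists y1 y2, normalized_pair (lame_potential h nu k) y1 y2.
Proof.
  intros Hk; set (q := lame_potential h nu k).
  assert (Hc : forall t, continuous q t).
  { intros t; apply (ex_derive_continuous q); unfold q, lame_potential.
    pose proof (is_derive_sn k t Hk); auto_derive; eexists; eassumption. }
  assert (Hq : forall t, Rabs (q t) <= 1 + Rabs (h - nu * (nu + 1)) + Rabs (nu * (nu + 1))).
  { intros t; unfold q; rewrite lame_potential_dn by assumption.
    eapply Rle_trans; [apply Rabs_triang|].
    rewrite Rabs_mult, (Rabs_pos_eq (jacobi_dn t k ^ 2)) by apply pow2_ge_0.
    pose proof (dn_pos k t Hk); pose proof (dn_le_1 k t Hk).
    pose proof (Rabs_pos (nu * (nu + 1))).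
    assert (jacobi_dn t k ^ 2 <= 1) by nra.
    nra. }
  assert (HM : 1 <= 1 + Rabs (h - nu * (nu + 1)) + Rabs (nu * (nu + 1))).
  { pose proof (Rabs_pos (h - nu * (nu + 1))); pose proof (Rabs_pos (nu * (nu + 1))); lra. }
  destruct (hill_existence q _ 1 0 Hc HM Hq) as (y1 & H1 & A & B).
  destruct (hill_existence q _ 0 1 Hc HM Hq) as (y2 & H2 & C & D).
  exists y1, y2; repeat split; try assumption; try apply H1; apply H2.
Qed.

Lemma lame_discriminant_eq (h nu k : R) (y1 y2 : R -> R) : 0 < k < 1 ->
  normalized_pair (lame_potential h nu k) y1 y2 ->
  lame_discriminant h nu k = 2 * (y1 (ellipK k) * Derive y2 (ellipK k)
    + Derive y1 (ellipK k) * y2 (ellipK k)).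
Proof.
  intros Hk N; apply hill_discriminant_half_period with (1 := N); intros t; unfold lame_potential.
  - now rewrite sn_sqr_plus_2K.
  - now rewrite sn_reflect.
Qed.

(* The energy y'^2 + w^2 y^2 grows at a rate at most |a| dn^2 / w <= (|a| / w) am'. *)
Lemma lame_energy (h nu w k t : R) (y : R -> R) : 0 < k < 1 -> 0 < w ->
  w ^ 2 = h - nu * (nu + 1) -> 0 <= t <= ellipK k ->
  hill_solution (lame_potential h nu k) y ->
  Derive y t ^ 2 + w ^ 2 * y t ^ 2
  <= (Derive y 0 ^ 2 + w ^ 2 * y 0 ^ 2) * exp (Rabs (nu * (nu + 1)) / w * (PI / 2)).
Proof.
  intros Hk Hw Hw2 Ht Hy.
  set (a := nu * (nu + 1)) in *.
  set (b := Rabs a / w).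
  assert (Hb : 0 <= b) by (apply Rdiv_le_0_compat; [apply Rabs_pos|assumption]).
  (* Gronwall with the weight exp(- b am t): dn <= 1 weakens the rate b dn^2 to b dn = b am', and am
     runs only from 0 to pi/2, so the total growth does not depend on k. *)
  assert (L : (Derive y t ^ 2 + w ^ 2 * y t ^ 2) * exp (- b * jacobi_am t k)
     <= (Derive y 0 ^ 2 + w ^ 2 * y 0 ^ 2) * exp (- b * jacobi_am 0 k)).
  { apply (le_of_derive_nonpos
      (fun t => (Derive y t ^ 2 + w ^ 2 * y t ^ 2) * exp (- b * jacobi_am t k))
      (fun t => exp (- b * jacobi_am t k) * (- 2 * a * jacobi_dn t k ^ 2 * (y t * Derive y t)
         - b * jacobi_dn t k * (Derive y t ^ 2 + w ^ 2 * y t ^ 2)))); [lra| |].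
    - intros x _.
      pose proof (hill_is_derive _ y x Hy) as D0.
      destruct (Hy x) as [_ D1].
      rewrite lame_potential_dn in D1 by assumption; fold a in D1; rewrite <- Hw2 in D1.
      pose proof (is_derive_am k x Hk) as D2.
      set (y' := Derive y) in *.
      auto_derive.
      + repeat split; eexists; eassumption.
      + replace (Derive (fun x => y' x) x) with (- ((w ^ 2 + a * jacobi_dn x k ^ 2) * y x))
          by (symmetry; now apply is_derive_unique).
        replace (Derive (fun x => y x) x) with (y' x)
          by (symmetry; now apply is_derive_unique).
        replace (Derive (fun x => jacobi_am x k) x) with (jacobi_dn x k)
          by (symmetry; now apply is_derive_unique).
        ring.
    - intros x _; pose proof (exp_pos (- b * jacobi_am x k)).
      enough (- 2 * a * jacobi_dn x k ^ 2 * (y x * Derive y x)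
         <= b * jacobi_dn x k * (Derive y x ^ 2 + w ^ 2 * y x ^ 2)) by nra.
      pose proof (dn_pos k x Hk); pose proof (dn_le_1 k x Hk).
      set (d := jacobi_dn x k) in *; set (u := y x); set (v := Derive y x).
      assert (Hab : Rabs a = b * w) by (unfold b; field; lra).
      assert (T : - a * (2 * (u * v)) <= b * (v ^ 2 + w ^ 2 * u ^ 2)).
      { apply Rle_trans with (Rabs (- a * (2 * (u * v)))); [apply Rle_abs|].
        rewrite !Rabs_mult, Rabs_Ropp, (Rabs_pos_eq 2), Hab by lra.
        replace (v ^ 2) with (Rabs v ^ 2) by apply pow2_abs.
        replace (u ^ 2) with (Rabs u ^ 2) by apply pow2_abs.
        assert (0 <= b * (Rabs v - w * Rabs u) ^ 2) by (apply Rmult_le_pos; [assumption|apply pow2_ge_0]).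
        nra. }
      assert (T0 : 0 <= b * (v ^ 2 + w ^ 2 * u ^ 2)).
      { apply Rmult_le_pos; [assumption|].
        pose proof (pow2_ge_0 v); pose proof (pow2_ge_0 (w * u)); nra. }
      apply Rle_trans with (d ^ 2 * (b * (v ^ 2 + w ^ 2 * u ^ 2))).
      + pose proof (pow2_ge_0 d); nra.
      + assert (d ^ 2 <= d) by nra. nra. }
  rewrite am_0, Rmult_0_r, exp_0, Rmult_1_r in L by assumption.
  pose proof (am_range k t Hk Ht) as R.
  set (e0 := Derive y 0 ^ 2 + w ^ 2 * y 0 ^ 2) in *.
  set (e := Derive y t ^ 2 + w ^ 2 * y t ^ 2) in *.
  assert (He0 : 0 <= e0).
  { unfold e0; pose proof (pow2_ge_0 (Derive y 0)); pose proof (pow2_ge_0 (w * y 0)); nra. }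
  replace e with (e * exp (- b * jacobi_am t k) * exp (b * jacobi_am t k)).
  2:{ rewrite Rmult_assoc, <- exp_plus.
      replace (- b * jacobi_am t k + b * jacobi_am t k) with 0 by ring.
      rewrite exp_0; ring. }
  pose proof (exp_pos (b * jacobi_am t k)).
  apply Rle_trans with (e0 * exp (b * jacobi_am t k)); [nra|].
  apply Rmult_le_compat_l; [assumption|].
  assert (b * jacobi_am t k <= b * (PI / 2)) as [I|I] by (apply Rmult_le_compat_l; lra).
  - left; now apply exp_increasing.
  - rewrite I; lra.
Qed.

(** [M] is chosen before [k], which is what matters as K tends to infinity. The condition at 0
    admits both normalized solutions. *)
Lemma lame_bounded (h nu w : R) : 0 < w -> w ^ 2 = h - nu * (nu + 1) ->
  exists M, 0 <= M /\ forall k y t, 0 < k < 1 -> 0 <= t <= ellipK k ->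
    hill_solution (lame_potential h nu k) y ->
    Derive y 0 ^ 2 + y 0 ^ 2 <= 1 -> Rabs (y t) <= M /\ Rabs (Derive y t) <= M.
Proof.
  intros Hw Hw2.
  set (E := (1 + w ^ 2) * exp (Rabs (nu * (nu + 1)) / w * (PI / 2))).
  assert (HE : 0 < E) by (apply Rmult_lt_0_compat; [nra|apply exp_pos]).
  exists (1 + E + E / w ^ 2); split.
  - assert (0 <= E / w ^ 2) by (apply Rdiv_le_0_compat; nra); lra.
  - intros k y t Hk Ht Hy H0.
    pose proof (lame_energy h nu w k t y Hk Hw Hw2 Ht Hy) as B.
    assert (B' : Derive y t ^ 2 + w ^ 2 * y t ^ 2 <= E).
    { eapply Rle_trans; [exact B|]; unfold E.
      apply Rmult_le_compat_r; [left; apply exp_pos|].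
      pose proof (pow2_ge_0 (Derive y 0)); pose proof (pow2_ge_0 (y 0)); pose proof (pow2_ge_0 w).
      assert (w ^ 2 * y 0 ^ 2 <= w ^ 2) by nra. nra. }
    assert (G : forall u m, 0 <= m -> u ^ 2 <= m -> Rabs u <= 1 + m).
    { intros u m Hm Hu; rewrite <- pow2_abs in Hu; pose proof (Rabs_pos u); nra. }
    assert (0 <= E / w ^ 2) by (apply Rdiv_le_0_compat; nra).
    pose proof (pow2_ge_0 (Derive y t)); pose proof (pow2_ge_0 (y t)).
    split.
    + apply Rle_trans with (1 + E / w ^ 2); [|lra].
      apply G; [assumption|].
      apply Rmult_le_reg_r with (w ^ 2); [nra|].
      unfold Rdiv; rewrite Rmult_assoc, Rinv_l by nra; nra.
    + apply Rle_trans with (1 + E); [|lra]; apply G; nra.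
Qed.

(** * Comparison with the limit equation *)

(** The lower bound for K contains K >= - ln k', so e^{2K} >= 1 / k'^2. *)
Lemma xi_K_le (k : R) : 0 < k < 1 -> xi (ellipK k) <= 1 - k ^ 2.
Proof.
  intros Hk; destruct (ellipK_bounds k Hk) as [B _].
  assert (P : 0 < 1 - k ^ 2) by nra.
  assert (0 <= ln (1 + k)) by (rewrite <- ln_1; apply ln_le; lra).
  assert (E : / (1 - k ^ 2) <= exp (2 * ellipK k)).
  { rewrite <- (exp_ln (/ (1 - k ^ 2))) by now apply Rinv_0_lt_compat.
    rewrite ln_Rinv by assumption.
    assert (L : ln (1 - k ^ 2) = 2 * ln (sqrt (1 - k ^ 2))).
    { rewrite <- (sqrt_sqrt (1 - k ^ 2)) at 1 by lra.
      rewrite ln_mult by (apply sqrt_lt_R0; assumption); ring. }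
    assert (- ln (1 - k ^ 2) <= 2 * ellipK k) as [I|I] by lra.
    - left; now apply exp_increasing.
    - rewrite I; lra. }
  unfold xi; pose proof (Rinv_0_lt_compat _ P).
  apply Rmult_le_reg_r with (1 + exp (2 * ellipK k)); [lra|].
  unfold Rdiv; rewrite Rmult_assoc, Rinv_l by lra.
  apply Rle_trans with ((1 - k ^ 2) * (/ (1 - k ^ 2))).
  - rewrite Rinv_r; lra.
  - apply Rmult_le_compat_l; lra.
Qed.

(* [sn t + k'^2 t + 2 xi t] is an antiderivative of a majorant of dn^2 - sech^2. *)
Lemma wronskian_drift (h nu w k M1 M2 : R) (y f f' : R -> R) : 0 < k < 1 ->
  w ^ 2 = h - nu * (nu + 1) -> 0 <= M1 -> 0 <= M2 ->
  hill_solution (lame_potential h nu k) y ->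
  (forall t, is_derive f t (f' t)) ->
  (forall t, is_derive f' t (- (w ^ 2 + nu * (nu + 1) * (4 * (xi t * (1 - xi t)))) * f t)) ->
  (forall t, 0 <= t <= ellipK k -> Rabs (y t) <= M1) ->
  (forall t, 0 <= t <= ellipK k -> Rabs (f t) <= M2) ->
  Rabs (y (ellipK k) * f' (ellipK k) - Derive y (ellipK k) * f (ellipK k)
        - (y 0 * f' 0 - Derive y 0 * f 0))
  <= Rabs (nu * (nu + 1)) * M1 * M2 * ((1 - k ^ 2) * ellipK k + 2 * (1 - k ^ 2)).
Proof.
  intros Hk Hw2 HM1 HM2 Hy Hf Hf' By Bf.
  set (a := nu * (nu + 1)) in *.
  set (m := Rabs a * M1 * M2).
  assert (Hm : 0 <= m).
  { unfold m; repeat apply Rmult_le_pos; try assumption; apply Rabs_pos. }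
  pose proof (ellipK_pos k Hk) as HK.
  set (W := fun t => y t * f' t - Derive y t * f t).
  set (p := fun t => a * (jacobi_dn t k ^ 2 - 4 * (xi t * (1 - xi t))) * (y t * f t)).
  set (Q := fun t => jacobi_sn t k + (1 - k ^ 2) * t + 2 * xi t).
  set (Q' := fun t => jacobi_cn t k * jacobi_dn t k + (1 - k ^ 2) - 4 * (xi t * (1 - xi t))).
  assert (DW : forall t, is_derive W t (p t)).
  { intros t; unfold W, p.
    pose proof (hill_is_derive _ y t Hy) as D0.
    destruct (Hy t) as [_ D1].
    rewrite lame_potential_dn in D1 by assumption; fold a in D1; rewrite <- Hw2 in D1.
    pose proof (Hf t) as D2; pose proof (Hf' t) as D3.
    set (y' := Derive y) in *.
    auto_derive.
    - repeat split; eexists; eassumption.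
    - replace (Derive (fun x => y' x) t) with (- ((w ^ 2 + a * jacobi_dn t k ^ 2) * y t))
        by (symmetry; now apply is_derive_unique).
      replace (Derive (fun x => y x) t) with (y' t)
        by (symmetry; now apply is_derive_unique).
      replace (Derive (fun x => f x) t) with (f' t)
        by (symmetry; now apply is_derive_unique).
      replace (Derive (fun x => f' x) t) with (- (w ^ 2 + a * (4 * (xi t * (1 - xi t)))) * f t)
        by (symmetry; now apply is_derive_unique).
      ring. }
  assert (DQ : forall t, is_derive Q t (Q' t)).
  { intros t; unfold Q, Q'.
    pose proof (is_derive_sn k t Hk) as D0; pose proof (is_derive_xi t) as D1.
    auto_derive.
    - repeat split; eexists; eassumption.
    - replace (Derive (fun x => jacobi_sn x k) t) with (jacobi_cn t k * jacobi_dn t k)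
        by (symmetry; now apply is_derive_unique).
      replace (Derive (fun x => xi x) t) with (-2 * (xi t * (1 - xi t)))
        by (symmetry; now apply is_derive_unique).
      ring. }
  assert (Bp : forall t, 0 <= t <= ellipK k -> Rabs (p t) <= m * Q' t).
  { intros t Ht; unfold p, Q', m.
    pose proof (dn_sqr_ge_sech k t Hk Ht) as L1; cbv zeta in L1; fold (xi t) in L1.
    pose proof (dn_sqr_le k t Hk Ht) as L2.
    rewrite !Rabs_mult, (Rabs_pos_eq (jacobi_dn t k ^ 2 - 4 * (xi t * (1 - xi t)))) by lra.
    specialize (By t Ht); specialize (Bf t Ht).
    assert (B2 : Rabs (y t) * Rabs (f t) <= M1 * M2).
    { apply Rmult_le_compat; try apply Rabs_pos; assumption. }
    set (d := jacobi_dn t k ^ 2 - 4 * (xi t * (1 - xi t))) in *.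
    apply Rle_trans with (Rabs a * d * (M1 * M2)).
    - apply Rmult_le_compat_l; [|assumption].
      apply Rmult_le_pos; [apply Rabs_pos|unfold d; lra].
    - replace (Rabs a * d * (M1 * M2)) with (m * d) by (unfold m; ring).
      fold m; apply Rmult_le_compat_l; [assumption|unfold d; lra]. }
  (* The contributions sn K = 1 and 2 xi(0) = 1 cancel: dn^2 and sech^2 have nearly the same total
     mass, and only terms of order k'^2 K are left. *)
  assert (QK : Q (ellipK k) - Q 0 <= (1 - k ^ 2) * ellipK k + 2 * (1 - k ^ 2)).
  { unfold Q, jacobi_sn; rewrite am_0, am_K, sin_0, sin_PI2, xi_0 by assumption.
    pose proof (xi_K_le k Hk); lra. }
  change (Rabs (W (ellipK k) - W 0) <= m * ((1 - k ^ 2) * ellipK k + 2 * (1 - k ^ 2))).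
  apply Rle_trans with (m * (Q (ellipK k) - Q 0)); [|now apply Rmult_le_compat_l].
  apply Rabs_le; split.
  - enough (- W (ellipK k) - m * Q (ellipK k) <= - W 0 - m * Q 0) by lra.
    apply (le_of_derive_nonpos (fun t => - W t - m * Q t) (fun t => - p t - m * Q' t)); [lra| |].
    + intros t _; apply (is_derive_minus (K := R_AbsRing) (V := R_NormedModule)
        (fun t => - W t) (fun t => m * Q t)).
      * now apply (is_derive_opp (K := R_AbsRing) (V := R_NormedModule) W).
      * now apply (is_derive_scal Q).
    + intros t Ht; specialize (Bp t Ht); apply Rabs_le_between in Bp; lra.
  - enough (W (ellipK k) - m * Q (ellipK k) <= W 0 - m * Q 0) by lra.
    apply (le_of_derive_nonpos (fun t => W t - m * Q t) (fun t => p t - m * Q' t)); [lra| |].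
    + intros t _; apply (is_derive_minus (K := R_AbsRing) (V := R_NormedModule)
        W (fun t => m * Q t)).
      * apply DW.
      * now apply (is_derive_scal Q).
    + intros t Ht; specialize (Bp t Ht); apply Rabs_le_between in Bp; lra.
Qed.

Lemma Cmod_Cexp_imaginary (z : C) : Re z = 0 -> Cmod (Cexp z) = 1.
Proof.
  intros H; unfold Cexp; rewrite H, exp_0, Cmod_mult, Cmod_1, Rmult_1_l.
  transitivity (sqrt 1); [|apply sqrt_1].
  unfold Cmod; cbn [fst snd]; f_equal.
  rewrite <- (sin2_cos2_pow (Im z)); ring.
Qed.

(* Multiplying by e^{sK} turns [jost] and [jost1] at K into 1 and -s up to O(k'^2). *)
Lemma lame_at_K (h nu w : R) : 0 < w -> w ^ 2 = h - nu * (nu + 1) ->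
  let a := nu * (nu + 1) in let s := (Ci * RtoC w)%C in
  exists M, 0 <= M /\ forall k y, 0 < k < 1 ->
    hill_solution (lame_potential h nu k) y ->
    Derive y 0 ^ 2 + y 0 ^ 2 <= 1 ->
    Cmod (s * RtoC (y (ellipK k)) + RtoC (Derive y (ellipK k))
      + Cexp (s * RtoC (ellipK k)) * (RtoC (y 0) * jost1 a s 0 - RtoC (Derive y 0) * jost a s 0))%C
    <= M * ((1 - k ^ 2) * (1 + ellipK k)).
Proof.
  intros Hw Hw2 a s.
  assert (Hs0 : Re s = 0) by (unfold s; simpl; ring).
  assert (Hs1 : Im s = w) by (unfold s; simpl; ring).
  assert (Hs : Im s <> 0) by lra.
  assert (Hs' : 0 <= Re s) by lra.
  assert (Hms : Cmod s = w).
  { unfold s; rewrite Cmod_mult, Cmod_Ci, Cmod_R, Rabs_pos_eq; lra. }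
  assert (Hss : (s * s)%C = RtoC (- w ^ 2)).
  { unfold s; apply injective_projections; simpl; ring. }
  destruct (lame_bounded h nu w Hw Hw2) as (M1 & HM1 & By).
  destruct (hyp_bounds a s Hs Hs') as (M2 & HM2 & BF).
  set (m := Rabs a * M1 * M2).
  assert (Hm : 0 <= m).
  { unfold m; repeat apply Rmult_le_pos; try assumption; apply Rabs_pos. }
  exists (4 * m + M1 * (w * M2 + 2 * M2) + M1 * M2).
  split; [assert (0 <= M1 * (w * M2 + 2 * M2)) by (apply Rmult_le_pos; nra); nra|].
  intros k y Hk Hy H0.
  pose proof (ellipK_pos k Hk) as HK.
  set (K := ellipK k) in *.
  assert (Hk2 : 0 < 1 - k ^ 2) by nra.
  assert (By' : forall t, 0 <= t <= K -> Rabs (y t) <= M1 /\ Rabs (Derive y t) <= M1).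
  { intros t Ht; now apply (By k y t). }
  assert (Bj : forall t, 0 <= t <= K -> Cmod (jost a s t) <= M2).
  { intros t Ht; unfold jost; rewrite Cmod_mult, Cmod_Cexp_imaginary, Rmult_1_l.
    - apply BF; pose proof (xi_range t); pose proof (xi_le_half t (proj1 Ht)); lra.
    - unfold s; simpl; ring. }
  assert (DR : forall t, is_derive (fun t => Re (jost1 a s t)) t
     (- (w ^ 2 + a * (4 * (xi t * (1 - xi t)))) * Re (jost a s t))).
  { intros t; destruct (is_Cderive_jost1 a s t Hs Hs') as [D _].
    rewrite Hss, <- RtoC_minus in D.
    replace (- (w ^ 2 + a * (4 * (xi t * (1 - xi t)))) * Re (jost a s t))
      with (Re (RtoC (- w ^ 2 - a * (4 * (xi t * (1 - xi t)))) * jost a s t)%C); [exact D|].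
    unfold Re; cbn [fst snd Cmult RtoC]; ring. }
  assert (DI : forall t, is_derive (fun t => Im (jost1 a s t)) t
     (- (w ^ 2 + a * (4 * (xi t * (1 - xi t)))) * Im (jost a s t))).
  { intros t; destruct (is_Cderive_jost1 a s t Hs Hs') as [_ D].
    rewrite Hss, <- RtoC_minus in D.
    replace (- (w ^ 2 + a * (4 * (xi t * (1 - xi t)))) * Im (jost a s t))
      with (Im (RtoC (- w ^ 2 - a * (4 * (xi t * (1 - xi t)))) * jost a s t)%C); [exact D|].
    unfold Im; cbn [fst snd Cmult RtoC]; ring. }
  pose proof (wronskian_drift h nu w k M1 M2 y (fun t => Re (jost a s t)) (fun t => Re (jost1 a s t))
    Hk Hw2 HM1 HM2 Hy (fun t => proj1 (is_Cderive_jost a s t Hs Hs')) DR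
    (fun t Ht => proj1 (By' t Ht))
    (fun t Ht => Rle_trans _ _ _ (Rabs_Re_le_Cmod _) (Bj t Ht))) as WR.
  pose proof (wronskian_drift h nu w k M1 M2 y (fun t => Im (jost a s t)) (fun t => Im (jost1 a s t))
    Hk Hw2 HM1 HM2 Hy (fun t => proj2 (is_Cderive_jost a s t Hs Hs')) DI
    (fun t Ht => proj1 (By' t Ht))
    (fun t Ht => Rle_trans _ _ _ (Rabs_Im_le_Cmod _) (Bj t Ht))) as WI.
  cbv beta in WR, WI; fold a in WR, WI; fold m in WR, WI; fold K in WR, WI.
  set (W0 := (RtoC (y 0) * jost1 a s 0 - RtoC (Derive y 0) * jost a s 0)%C).
  set (WK := (RtoC (y K) * jost1 a s K - RtoC (Derive y K) * jost a s K)%C).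
  (* The drift bound holds for each component with k'^2 K + 2 k'^2 <= 2 k'^2 (1 + K); two components
     make the factor 4. *)
  assert (BW : Cmod (WK - W0)%C <= 4 * m * ((1 - k ^ 2) * (1 + K))).
  { eapply Rle_trans; [apply Cmod_le_Rabs|].
    apply Rle_trans with (m * ((1 - k ^ 2) * K + 2 * (1 - k ^ 2)) + m * ((1 - k ^ 2) * K + 2 * (1 - k ^ 2))).
    - apply Rplus_le_compat.
      + eapply Rle_trans; [right|exact WR]; f_equal.
        unfold WK, W0, Re, Im; cbn [fst snd Cmult Cplus Cminus Copp RtoC]; ring.
      + eapply Rle_trans; [right|exact WI]; f_equal.
        unfold WK, W0, Re, Im; cbn [fst snd Cmult Cplus Cminus Copp RtoC]; ring.
    - assert (0 <= m * ((1 - k ^ 2) * K)) by (apply Rmult_le_pos; [|apply Rmult_le_pos]; lra).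
      nra. }
  set (e := Cexp (s * RtoC K)).
  assert (He : Cmod e = 1) by (apply Cmod_Cexp_imaginary; unfold s; simpl; ring).
  assert (Hee : (e * Cexp (- s * RtoC K))%C = 1%C).
  { unfold e; rewrite <- Cexp_plus.
    replace (s * RtoC K + - s * RtoC K)%C with (RtoC 0) by ring; apply Cexp_0. }
  pose proof (xi_range K) as X1; pose proof (xi_le_half K ltac:(lra)) as X2.
  assert (X3 : xi K <= 1 - k ^ 2) by now apply xi_K_le.
  set (x := xi K) in *.
  assert (Ef : (e * jost a s K)%C = hypF a s x).
  { unfold jost; rewrite Cmult_assoc, Hee; fold x; ring. }
  assert (Eg : (e * jost1 a s K)%C = (- s * hypF a s x + RtoC (-2 * (x * (1 - x))) * hypF1 a s x)%C).
  { unfold jost1; rewrite Cmult_assoc, Hee; fold x; ring. }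
  destruct (BF x ltac:(lra)) as (B0 & B1 & B2).
  destruct (By' K ltac:(lra)) as [By0 By1].
  (* The left side is split into the Wronskian drift, turned by e^{sK}, and the errors made when
     e^{sK} f and e^{sK} f' at K are replaced by 1 and - s. *)
  replace (s * RtoC (y K) + RtoC (Derive y K) + e * W0)%C
    with (- (e * (WK - W0)) + (RtoC (y K) * (- s * (hypF a s x - 1)
        + RtoC (-2 * (x * (1 - x))) * hypF1 a s x)
        + - (RtoC (Derive y K) * (hypF a s x - 1))))%C.
  2:{ transitivity (- (e * WK) + e * W0 + (RtoC (y K) * (- s * (hypF a s x - 1)
        + RtoC (-2 * (x * (1 - x))) * hypF1 a s x)
        + - (RtoC (Derive y K) * (hypF a s x - 1))))%C; [ring|].
      replace (e * WK)%C with (RtoC (y K) * (e * jost1 a s K) - RtoC (Derive y K) * (e * jost a s K))%C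
        by (unfold WK; ring).
      rewrite Ef, Eg; ring. }
  eapply Rle_trans; [apply Cmod_triangle|].
  rewrite Cmod_opp, Cmod_mult, He, Rmult_1_l.
  rewrite !Rmult_plus_distr_r, Rplus_assoc.
  apply Rplus_le_compat; [exact BW|].
  assert (X4 : x <= (1 - k ^ 2) * (1 + K)).
  { apply Rle_trans with (1 - k ^ 2); [assumption|nra]. }
  eapply Rle_trans; [apply Cmod_triangle|].
  rewrite Cmod_opp, !Cmod_mult, !Cmod_R.
  apply Rplus_le_compat.
  - rewrite Rmult_assoc; apply Rmult_le_compat; [apply Rabs_pos|apply Cmod_ge_0|assumption|].
    eapply Rle_trans; [apply Cmod_triangle|].
    rewrite !Cmod_mult, Cmod_opp, Hms, Cmod_R.
    rewrite Rmult_plus_distr_r; apply Rplus_le_compat.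
    + rewrite Rmult_assoc; apply Rmult_le_compat_l; [lra|].
      eapply Rle_trans; [exact B2|apply Rmult_le_compat_l; assumption].
    + rewrite Rabs_mult, (Rabs_left (-2)), (Rabs_pos_eq (x * (1 - x))) by first [lra|apply Rmult_le_pos; lra].
      replace (2 * M2 * ((1 - k ^ 2) * (1 + K))) with (2 * ((1 - k ^ 2) * (1 + K)) * M2) by ring.
      apply Rmult_le_compat; [nra|apply Cmod_ge_0|nra|assumption].
  - rewrite Rmult_assoc; apply Rmult_le_compat; [apply Rabs_pos|apply Cmod_ge_0|assumption|].
    eapply Rle_trans; [exact B2|apply Rmult_le_compat_l; assumption].
Qed.


(** * Asymptotics of K and assembly of the estimate *)

(** Replacing ln(1 + k) by ln 2 in [ellipK_bounds] costs at most 1 - k each time, and replacing k^2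
    K by K costs k'^2 K. *)
Lemma ellipK_asymptotic (k : R) : 0 < k < 1 ->
  Rabs (ellipK k - ln (4 / sqrt (1 - k ^ 2))) <= 2 * ((1 - k ^ 2) * (1 + ellipK k)).
Proof.
  intros Hk; destruct (ellipK_bounds k Hk) as [B1 B2].
  pose proof (ellipK_pos k Hk) as HK.
  assert (P : 0 < 1 - k ^ 2) by nra.
  pose proof (sqrt_lt_R0 _ P) as P'.
  rewrite ln_div by lra.
  assert (L4 : ln 4 = 2 * ln 2).
  { replace 4 with (2 * 2) by ring; rewrite ln_mult by lra; ring. }
  assert (U : ln (1 + k) <= ln 2) by (apply ln_le; lra).
  assert (D : ln 2 - ln (1 + k) <= 1 - k).
  { rewrite <- ln_div by lra; eapply Rle_trans; [apply ln_le_sub1, Rdiv_lt_0_compat; lra|].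
    apply Rmult_le_reg_r with (1 + k); [lra|]; field_simplify; nra. }
  assert (0 <= (1 - k ^ 2) * ellipK k) by (apply Rmult_le_pos; lra).
  assert (1 - k <= 1 - k ^ 2) by nra.
  apply Rabs_le; split; nra.
Qed.

Lemma ellipK_log_bound (k : R) : 3 / 4 < k < 1 ->
  (1 - k ^ 2) * (1 + ellipK k) <= 12 * Rabs ((1 - k) * ln (1 - k)).
Proof.
  intros Hk; destruct (ellipK_bounds k ltac:(lra)) as [_ B].
  pose proof (ellipK_pos k ltac:(lra)) as HK.
  (* Since 1 - k < 1/4 < 1/e, the logarithm is at least 1 in absolute value and absorbs all
     constants. *)
  assert (Hl : ln (1 - k) <= -1).
  { rewrite <- (ln_exp (-1)); apply ln_le; [lra|].
    replace (-1) with (- (1)) by ring; rewrite exp_Ropp; pose proof exp_le_3; pose proof (exp_pos 1).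
    apply Rle_trans with (/ 3); [lra|now apply Rinv_le_contravar]. }
  assert (P : 0 < 1 - k ^ 2) by nra.
  assert (L : ln (1 - k ^ 2) = 2 * ln (sqrt (1 - k ^ 2))).
  { rewrite <- (sqrt_sqrt (1 - k ^ 2)) at 1 by lra.
    rewrite ln_mult by (apply sqrt_lt_R0; assumption); ring. }
  replace (1 - k ^ 2) with ((1 - k) * (1 + k)) in L at 1 by ring.
  rewrite ln_mult in L by lra.
  assert (U : ln (1 + k) <= 1) by (eapply Rle_trans; [apply ln_le_sub1; lra|lra]).
  rewrite Rabs_mult, (Rabs_pos_eq (1 - k)), (Rabs_left (ln (1 - k))) by lra.
  set (l := - ln (1 - k)) in *.
  assert (HK' : k ^ 2 * ellipK k <= 5 / 2 * l) by (unfold l; lra).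
  assert (ellipK k <= 5 * l).
  { assert (1 / 2 <= k ^ 2) by nra; nra. }
  assert (1 <= l) by (unfold l; lra).
  replace (1 - k ^ 2) with ((1 - k) * (1 + k)) by ring.
  apply Rle_trans with ((1 - k) * 2 * (6 * l)); [|lra].
  apply Rmult_le_compat; nra.
Qed.

Lemma Cexp_imaginary_lipschitz (w x y : R) :
  Cmod (Cexp (Ci * RtoC (w * x)) - Cexp (Ci * RtoC (w * y)))%C <= 2 * Rabs w * Rabs (x - y).
Proof.
  assert (G : forall f f' : R -> R, (forall t, is_derive f t (f' t)) ->
    (forall t, Rabs (f' t) <= 1) -> forall u v, Rabs (f u - f v) <= Rabs (u - v)).
  { intros f f' H1 H2 u v.
    destruct (MVT_gen f v u f') as (c & _ & E).
    - intros; apply H1.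
    - intros t _; apply continuity_pt_filterlim, (ex_derive_continuous f); eexists; apply H1.
    - rewrite E, Rabs_mult; specialize (H2 c); pose proof (Rabs_pos (u - v)); nra. }
  assert (E : forall t, Cexp (Ci * RtoC t) = (cos t, sin t)).
  { intros t; unfold Cexp; simpl.
    replace (0 * t - 1 * 0) with 0 by ring; replace (0 * 0 + 1 * t) with t by ring.
    rewrite exp_0; apply injective_projections; simpl; ring. }
  rewrite !E; eapply Rle_trans; [apply Cmod_le_Rabs|].
  replace (2 * Rabs w * Rabs (x - y)) with (Rabs (w * x - w * y) + Rabs (w * x - w * y))
    by (rewrite <- Rmult_minus_distr_l, Rabs_mult; ring).
  apply Rplus_le_compat.
  - apply (G cos (fun t => - sin t)).
    + intros t; apply is_derive_Reals, derivable_pt_lim_cos.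
    + intros t; rewrite Rabs_Ropp; apply Rabs_le, SIN_bound.
  - apply (G sin cos).
    + intros t; apply is_derive_Reals, derivable_pt_lim_sin.
    + intros t; apply Rabs_le, COS_bound.
Qed.

(** The condition e <= m absorbs the quadratic error e^2 into m e. *)
Lemma Cmult_error (u v a b : C) (m e : R) :
  Cmod (u - a)%C <= e -> Cmod (v - b)%C <= e -> Cmod a <= m -> Cmod b <= m -> e <= m ->
  Cmod (u * v - a * b)%C <= 3 * m * e.
Proof.
  intros H1 H2 H3 H4 He.
  replace (u * v - a * b)%C with ((u - a) * (v - b) + ((u - a) * b + a * (v - b)))%C by ring.
  pose proof (Cmod_ge_0 (u - a)); pose proof (Cmod_ge_0 (v - b)).
  pose proof (Cmod_ge_0 a); pose proof (Cmod_ge_0 b).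
  assert (Cmod ((u - a) * (v - b)) <= e * m).
  { rewrite Cmod_mult; apply Rmult_le_compat; lra. }
  assert (Cmod ((u - a) * b) <= e * m) by (rewrite Cmod_mult; apply Rmult_le_compat; lra).
  assert (Cmod (a * (v - b)) <= m * e) by (rewrite Cmod_mult; apply Rmult_le_compat; lra).
  eapply Rle_trans; [apply Cmod_triangle|].
  pose proof (Cmod_triangle ((u - a) * b) (a * (v - b))); lra.
Qed.

(** The a priori bound 12 on k'^2 (1 + K) is what [Cmult_error] needs: it makes the error at most 12
    M, a summand of [m]. It holds near k = 1 because |(1 - k) ln(1 - k)| <= 1. *)
Lemma lame_discriminant_at_K (h nu w : R) : 0 < w -> w ^ 2 = h - nu * (nu + 1) ->
  exists M, 0 <= M /\ forall k, 0 < k < 1 -> (1 - k ^ 2) * (1 + ellipK k) <= 12 ->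
    Rabs (lame_discriminant h nu k
      - 2 * Re (hypB (nu * (nu + 1)) (Ci * RtoC w) * Cexp (Ci * RtoC (2 * w * ellipK k)))%C)
    <= M * ((1 - k ^ 2) * (1 + ellipK k)).
Proof.
  intros Hw Hw2.
  destruct (lame_at_K h nu w Hw Hw2) as (M & HM & HB).
  set (a := nu * (nu + 1)) in *; set (s := (Ci * RtoC w)%C) in *.
  assert (Hs0 : s <> 0%C) by (apply Im_neq_0_Cneq; unfold s; simpl; lra).
  assert (N2 : RtoC 2 <> 0%C) by (intros E; apply RtoC_inj in E; lra).
  set (m := 12 * M + Cmod (jost1 a s 0) + Cmod (jost a s 0)).
  assert (Hm : 0 <= m).
  { unfold m; pose proof (Cmod_ge_0 (jost1 a s 0)); pose proof (Cmod_ge_0 (jost a s 0)); lra. }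
  exists (2 / w * (3 * m * M)); split.
  { apply Rmult_le_pos; [apply Rdiv_le_0_compat; lra|]. apply Rmult_le_pos; nra. }
  intros k Hk Hsmall.
  destruct (lame_normalized_pair h nu k Hk) as (y1 & y2 & N).
  rewrite (lame_discriminant_eq h nu k y1 y2 Hk N).
  destruct N as (H1 & H2 & A & B & C & D).
  pose proof (HB k y1 Hk H1 ltac:(rewrite A, B; lra)) as E1.
  pose proof (HB k y2 Hk H2 ltac:(rewrite C, D; lra)) as E2.
  rewrite A, B in E1; rewrite C, D in E2.
  pose proof (ellipK_pos k Hk) as HK.
  set (K := ellipK k) in *.
  set (eps := (1 - k ^ 2) * (1 + K)) in *.
  set (e := Cexp (s * RtoC K)) in *.
  assert (He : Cmod e = 1) by (apply Cmod_Cexp_imaginary; unfold s; simpl; ring).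
  set (Z1 := (s * RtoC (y1 K) + RtoC (Derive y1 K))%C) in *.
  set (Z2 := (s * RtoC (y2 K) + RtoC (Derive y2 K))%C) in *.
  assert (Heps : 0 <= eps) by (unfold eps; apply Rmult_le_pos; nra).
  assert (Q : Cmod (Z1 * Z2 - (- e * jost1 a s 0) * (e * jost a s 0))%C <= 3 * m * (M * eps)).
  { apply Cmult_error.
    - replace (Z1 - - e * jost1 a s 0)%C
        with (Z1 + e * (1 * jost1 a s 0 - 0 * jost a s 0))%C by ring; exact E1.
    - replace (Z2 - e * jost a s 0)%C
        with (Z2 + e * (0 * jost1 a s 0 - 1 * jost a s 0))%C by ring; exact E2.
    - rewrite Cmod_mult, Cmod_opp, He; unfold m; pose proof (Cmod_ge_0 (jost a s 0)); lra.
    - rewrite Cmod_mult, He; unfold m; pose proof (Cmod_ge_0 (jost1 a s 0)); lra.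
    - unfold m; pose proof (Cmod_ge_0 (jost a s 0)); pose proof (Cmod_ge_0 (jost1 a s 0)); nra. }
  assert (EB : ((- e * jost1 a s 0) * (e * jost a s 0))%C
     = (s * (hypB a s * Cexp (Ci * RtoC (2 * w * K))))%C).
  { replace (Cexp (Ci * RtoC (2 * w * K))) with (e * e)%C.
    2:{ unfold e; rewrite <- Cexp_plus; f_equal; unfold s; rewrite !RtoC_mult; ring. }
    unfold jost1, jost, hypB; rewrite xi_0.
    replace (- s * RtoC 0)%C with (RtoC 0) by ring; rewrite Cexp_0.
    replace (-2 * (1 / 2 * (1 - 1 / 2))) with (- (1 / 2)) by field.
    rewrite RtoC_opp, RtoC_div by lra; field; repeat split; assumption. }
  rewrite EB in Q.
  set (T := (hypB a s * Cexp (Ci * RtoC (2 * w * K)))%C) in *.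
  (* Taking imaginary parts, with s = iw and real y1, y2, isolates w (y1 y2' + y1' y2), and s T
     contributes w Re T. *)
  assert (I : Rabs (w * (y1 K * Derive y2 K + Derive y1 K * y2 K) - w * Re T) <= 3 * m * (M * eps)).
  { eapply Rle_trans; [|exact Q]; eapply Rle_trans; [|apply Rabs_Im_le_Cmod].
    right; f_equal; unfold Z1, Z2, s, Re, Im; destruct T as [Tr Ti]; simpl; ring. }
  replace (2 * (y1 K * Derive y2 K + Derive y1 K * y2 K) - 2 * Re T)
    with (2 / w * (w * (y1 K * Derive y2 K + Derive y1 K * y2 K) - w * Re T)) by (field; lra).
  rewrite Rabs_mult, (Rabs_pos_eq (2 / w)) by (apply Rdiv_le_0_compat; lra).
  replace (2 / w * (3 * m * M) * eps) with (2 / w * (3 * m * (M * eps))) by ring.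
  apply Rmult_le_compat_l; [apply Rdiv_le_0_compat; lra|exact I].
Qed.

Theorem mainTheorem2 :
  forall h nu : R,
    (- (1 / 2) <= nu)%R -> (0 < h)%R -> (nu * (nu + 1) < h)%R ->
    let omega := sqrt (h - nu * (nu + 1))%R in
    let B :=
      (Gamma (1 + Ci * omega) * Gamma (Ci * omega)
       / (Gamma (1 + Ci * omega + nu) * Gamma (Ci * omega - nu)))%C in
    is_bigO (at_left 1)
      (fun k : R =>
         let k' := sqrt (1 - k ^ 2)%R in
         (lame_discriminant h nu k
          - 2 * Re (B * Cexp (2 * Ci * omega * ln (4 / k')%R)%C)%C)%R)
      (fun k : R => ((1 - k) * ln (1 - k))%R).
Proof.
  intros h nu _ _ Ha w B.
  assert (Hw : 0 < w) by (apply sqrt_lt_R0; lra).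
  assert (Hw2 : w ^ 2 = h - nu * (nu + 1)) by (apply pow2_sqrt; lra).
  destruct (lame_discriminant_at_K h nu w Hw Hw2) as (M & HM & HB).
  assert (EB : hypB (nu * (nu + 1)) (Ci * RtoC w) = B).
  { unfold B; apply hypB_Gamma; simpl; lra. }
  rewrite EB in HB.
  (* [c] accounts for putting ln(4/k') in place of K in the phase: |B|, the Lipschitz constant 2 (2
     w) of the exponential, and the 2 of [ellipK_asymptotic]. *)
  set (c := 2 * (Cmod B * (2 * (2 * w) * 2))).
  exists ((M + c) * 12).
  assert (Hc : 0 <= c) by (unfold c; pose proof (Cmod_ge_0 B); nra).
  (* Radius 1/4 gives k > 3/4, the range of [ellipK_log_bound]. *)
  exists (mkposreal (1 / 4) ltac:(lra)); intros k Hk Hk1.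
  assert (Hk' : 3 / 4 < k < 1).
  { unfold ball in Hk; simpl in Hk; unfold AbsRing_ball, abs, minus, plus, opp in Hk; simpl in Hk.
    apply Rabs_lt_between in Hk; lra. }
  clear Hk Hk1.
  pose proof (ellipK_log_bound k Hk') as HL.
  assert (Hsmall : (1 - k ^ 2) * (1 + ellipK k) <= 12).
  (* From - ln u <= 1/u - 1 with u = 1 - k one gets u |ln u| <= 1. *)
  { assert (P : - ln (1 - k) <= / (1 - k) - 1).
    { rewrite <- ln_Rinv by lra; apply ln_le_sub1, Rinv_0_lt_compat; lra. }
    assert (Q : (1 - k) * - ln (1 - k) <= 1).
    { apply Rle_trans with ((1 - k) * (/ (1 - k) - 1)); [apply Rmult_le_compat_l; lra|].
      field_simplify; lra. }
    assert (ln (1 - k) <= 0) by (pose proof (ln_le_sub1 (1 - k)); lra).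
    rewrite Rabs_left1 in HL by nra; lra. }
  specialize (HB k ltac:(lra) Hsmall).
  pose proof (ellipK_asymptotic k ltac:(lra)) as HA.
  cbv zeta; set (L := ln (4 / sqrt (1 - k ^ 2))) in *.
  set (eps := (1 - k ^ 2) * (1 + ellipK k)) in *.
  set (E1 := Cexp (Ci * RtoC (2 * w * ellipK k))) in *.
  replace (Cexp (2 * Ci * w * L)) with (Cexp (Ci * RtoC (2 * w * L)))
    by (f_equal; rewrite !RtoC_mult; ring).
  set (E2 := Cexp (Ci * RtoC (2 * w * L))).
  assert (HE : Cmod (E1 - E2) <= 2 * (2 * w) * (2 * eps)).
  { eapply Rle_trans; [apply Cexp_imaginary_lipschitz|].
    rewrite (Rabs_pos_eq (2 * w)) by lra; apply Rmult_le_compat_l; lra. }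
  assert (HC : Rabs (2 * Re (B * E1)%C - 2 * Re (B * E2)%C) <= c * eps).
  { replace (2 * Re (B * E1)%C - 2 * Re (B * E2)%C) with (2 * Re (B * (E1 - E2))%C)
      by (unfold Re; simpl; ring).
    rewrite Rabs_mult, (Rabs_pos_eq 2) by lra.
    apply Rle_trans with (2 * (Cmod B * (2 * (2 * w) * (2 * eps)))); [|unfold c; right; ring].
    apply Rmult_le_compat_l; [lra|].
    eapply Rle_trans; [apply Rabs_Re_le_Cmod|]; rewrite Cmod_mult.
    apply Rmult_le_compat_l; [apply Cmod_ge_0|exact HE]. }
  apply Rle_trans with ((M + c) * eps); [|rewrite Rmult_assoc; apply Rmult_le_compat_l; lra].
  replace (lame_discriminant h nu k - 2 * Re (B * E2)%C)
    with ((lame_discriminant h nu k - 2 * Re (B * E1)%C)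
      + (2 * Re (B * E1)%C - 2 * Re (B * E2)%C)) by ring.
  eapply Rle_trans; [apply Rabs_triang|]; lra.
Qed.
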